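(* Let $(T(t))_{t\ge0}$ be a uniformly bounded $C_0$-semigroup on a Banach space $X$ ($\|T(t)\|\le M$ for all $t\ge0$) with infinitesimal generator $(-A,D(A))$. (i) For $n\in\mathbb N\cup\{0\}$ and $\alpha>-1$: $\int_0^\infty\ell_n^{(\alpha)}(t)T(t)x\,dt=A^n(A+1)^{-n-\alpha-1}x$ for all $x\in X$. (ii) For $n\in\mathbb N\cup\{0\}$ and $\alpha>0$: $\int_0^\infty\ell_n^{(\alpha)}(t)(t+A)^{-1}x\,dt=\int_0^\infty\varphi_{n,\alpha}(t)T(t)x\,dt$ for all $x\in X$. (iii) For $x\in D(A)$, $\alpha>-1$ and $t>0$: $T(t)x=\sum_{n=0}^\infty A^n(A+1)^{-n-\alpha-1}x\,L_n^{(\alpha)}(t)$, the series converging in $X$. (iv) For $x\in D(A)$, $\alpha>-1$ and $t>0$: $T(t)x=\big(\tfrac{1-V}{2}\big)^{\alpha+1}\sum_{n=0}^\infty\big(\tfrac{V+1}{2}\big)^n x\,L_n^{(\alpha)}(t)$. (v) For $x\in X$, $\alpha>1$ and $\lambda>0$: $(\lambda+A)^{-1}x=\sum_{n=0}^\infty\Big(\int_0^\infty\varphi_{n,\alpha}(t)T(t)x\,dt\Big)L_n^{(\alpha)}(\lambda)$, the series converging in $X$.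
   Context: $L_n^{(\alpha)}(t)=\sum_{k=0}^n(-1)^k\binom{n+\alpha}{n-k}\frac{t^k}{k!}$ is the generalized Laguerre polynomial; $\ell_n^{(\alpha)}(t):=\frac{n!}{\Gamma(n+\alpha+1)}t^{\alpha}e^{-t}L_n^{(\alpha)}(t)$ for $t>0$; $\varphi_{n,\alpha}(t):=\frac{t^n}{(t+1)^{n+\alpha+1}}$. The generator is defined by $-Ax=\lim_{t\to0^+}\frac{T(t)x-x}{t}$ on the set $D(A)$ where the limit exists. For $\gamma>0$ and $\lambda>0$ the fractional power of the resolvent is $(\lambda+A)^{-\gamma}x:=\frac{1}{\Gamma(\gamma)}\int_0^\infty t^{\gamma-1}e^{-\lambda t}T(t)x\,dt$, $x\in X$. The cogenerator is the bounded operator $V:=(A-1)(A+1)^{-1}$, so that $\frac{1-V}{2}=(A+1)^{-1}$ and $\frac{V+1}{2}=A(A+1)^{-1}$; accordingly $\big(\frac{1-V}{2}\big)^{\alpha+1}$ means $(A+1)^{-\alpha-1}$.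
   Formalization: In (iv) the operator ((1-V)/2)^{α+1} is applied to each term of the series, which then converges in X to T(t)x, because the inner series of ((V+1)/2)^n x L_n^{(α)}(t) need not converge for x in D(A) (for example for unitary groups with α>0). *)

(* Defs.v *)
From Stdlib Require Import Reals Arith Factorial.
From Coquelicot Require Import Coquelicot.
Open Scope R_scope.

Definition Int0inf {V : CompleteNormedModule R_AbsRing} (f : R -> V) : V :=
  RInt_gen f (at_right 0) (Rbar_locally p_infty).
Definition is_Int0inf {V : NormedModule R_AbsRing} (f : R -> V) (l : V) : Prop :=
  is_RInt_gen f (at_right 0) (Rbar_locally p_infty) l.

Definition Gamma (g : R) : R :=
  Int0inf (V := R_CompleteNormedModule) (fun t => Rpower t (g - 1) * exp (- t)).

Fixpoint falling (a : R) (m : nat) : R :=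
  match m with O => 1 | S m' => falling a m' * (a - INR m') end.
Definition gbinom (a : R) (m : nat) : R := falling a m / INR (fact m).

Definition Laguerre (n : nat) (alpha t : R) : R :=
  sum_f_R0 (fun k => (-1) ^ k * gbinom (INR n + alpha) (n - k) * t ^ k / INR (fact k)) n.

Definition ell (n : nat) (alpha t : R) : R :=
  INR (fact n) / Gamma (INR n + alpha + 1) * Rpower t alpha * exp (- t) * Laguerre n alpha t.

Definition phi (n : nat) (alpha t : R) : R :=
  t ^ n / Rpower (t + 1) (INR n + alpha + 1).

Section Semigroup.
Context {X : CompleteNormedModule R_AbsRing}.

Definition bounded_C0_semigroup (T : R -> X -> X) (M : R) : Prop :=
  (forall t, 0 <= t -> forall x y, T t (plus x y) = plus (T t x) (T t y)) /\
  (forall t, 0 <= t -> forall (a : R) x, T t (scal a x) = scal a (T t x)) /\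
  (forall t, 0 <= t -> forall x, norm (T t x) <= M * norm x) /\
  (forall x, T 0 x = x) /\
  (forall t s, 0 <= t -> 0 <= s -> forall x, T (t + s) x = T t (T s x)) /\
  (forall x, filterlim (fun t => T t x) (at_right 0) (locally x)).

(* graph of the operator A, where -A is the generator:
   -A x = lim_{t->0+} (T(t)x - x)/t *)
Definition gen (T : R -> X -> X) (x y : X) : Prop :=
  filterlim (fun t => scal (/ t) (minus (T t x) x)) (at_right 0) (locally (opp y)).

Definition inDA (T : R -> X -> X) (x : X) : Prop := exists y, gen T x y.

Definition Aop (T : R -> X -> X) (x : X) : X := iota (gen T x).

(* graph of A^n :  Apow T n x y  <->  x in D(A^n) and A^n x = y *)
Fixpoint Apow (T : R -> X -> X) (n : nat) (x y : X) : Prop :=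
  match n with
  | O => y = x
  | S m => exists z, Apow T m x z /\ gen T z y
  end.

(* (lambda + A)^(-gamma) x = 1/Gamma(gamma) int_0^oo t^(gamma-1) e^(-lambda t) T(t)x dt *)
Definition Res (T : R -> X -> X) (g lam : R) (x : X) : X :=
  Int0inf (fun t => scal (Rpower t (g - 1) * exp (- lam * t) / Gamma g) (T t x)).

(* cogenerator V = (A-1)(A+1)^(-1) and (V+1)/2 = A (A+1)^(-1) *)
Definition cogen (T : R -> X -> X) (x : X) : X :=
  minus (Aop T (Res T 1 1 x)) (Res T 1 1 x).
Definition Vhalf (T : R -> X -> X) (x : X) : X :=
  scal (/ 2) (plus (cogen T x) x).

End Semigroup.

(* Main.v *)
(** Write [w_b(s) = s^b e^(-s)].  The Gamma densities give [A (A+1)^(-g-1) = (A+1)^(-g) - (A+1)^(-g-1)], and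
    [ell_(n+1)^a = ell_n^a - ell_n^(a+1)]; so [A^n (A+1)^(-n-a-1) x] and the integral of [ell_n^a T x]
    satisfy the same recursion in [n], and agree for [n = 0].  The same recursion, satisfied by
    [phi_n^a], reduces (ii) to Fubini's theorem for the kernel [e^(-tv)].

    For the expansions, [e^(-s) T(s) x] has derivative [- e^(-s) T(s) (x + Ax)], hence
    [T(t) x] is the integral of [F_t(s) T(s) (x + Ax)] with [F_t(s) = e^(t-s) 1_(s > t)].  The Laguerre
    coefficient of [F_t / w_(a+1)] at [L_n^(a+1)] is exactly [L_n^a(t)], so the [N]-th partial sum
    of (iii) is the integral of [T(s) (x + Ax)] against the [N]-th Laguerre partial sum of [F_t].
    These converge in [L^2(1 / w_(a+1))] by completeness of the Laguerre polynomials, hence in [L^1].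
    For (v) with [a > 2] the same argument applies to the resolvent, which is
    [O(1/s + 1/s^2)] together with its derivative; for [1 < a <= 2] summation by parts
    replaces [a] by [a + 1] up to a boundary term, which tends to zero because
    [L_n^(a+1)(t)^2 <= C n^(a+1)] (a discrete energy estimate for the three-term recurrence). *)

Require Import Defs.
From Stdlib Require Import Reals Lra Lia List Arith Factorial.
From Coquelicot Require Import Coquelicot.
Open Scope R_scope.

(** * Linear combinations and improper integrals *)

(** All integrals are improper Riemann integrals, so no exchange of limits is free. Convergence
    comes from comparison with scalar integrals, ultimately with ones that have explicit
    antiderivatives; Fubini's theorem is proved by differentiating an iterated integral in its upper
    limit; and the passage from [L^2] to [L^1] is the inequality [D Y <= k/2 D^2 + Y^2/(2k)], with
    [k] fixed before the number of terms. Point evaluation at [t] is not continuous in [L^2]. For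
    [x] in the domain it becomes an integral over [(t, oo)], whose density with respect to [w_(a+1)]
    is bounded because [t > 0]; raising the parameter also makes it positive for every [a > -1], so
    boundary terms at 0 vanish. In (v) the square of [1/s + 1/s^2] against [w_(a+1)] contains
    [s^(a-3)] near 0, integrable only for [a > 2]: this obstacle is why smaller [a] need the growth
    of Laguerre polynomials in the degree. Completeness is established only for the function [F_t]:
    it is approximated by Bernstein polynomials in [e^(-t/4)], and then each exponential is expanded
    in a Taylor series. *)

Section LinearCombinations.
Context {V : ModuleSpace R_Ring}.

(** Syntax for a reflexive procedure: two linear combinations of the same atoms agree as soon as
    their coefficients do. The remaining scalar identities go to [ring] or [field], so coefficients
    such as [/ h] are allowed. *)
Inductive lexpr : Type :=
  | LVar (i : nat) | LZero | LPlus (a b : lexpr) | LOpp (a : lexpr) | LScal (r : R) (a : lexpr).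

Fixpoint lden (l : list V) (e : lexpr) : V :=
  match e with
  | LVar i => nth i l zero
  | LZero => zero
  | LPlus a b => plus (lden l a) (lden l b)
  | LOpp a => opp (lden l a)
  | LScal r a => scal r (lden l a)
  end.

Fixpoint lcoef (e : lexpr) (i : nat) : R :=
  match e with
  | LVar j => if Nat.eqb j i then 1 else 0
  | LZero => 0
  | LPlus a b => lcoef a i + lcoef b i
  | LOpp a => - lcoef a i
  | LScal r a => r * lcoef a i
  end.

Fixpoint lin (l : list V) (c : nat -> R) : V :=
  match l with
  | nil => zero
  | v :: l' => plus (scal (c O) v) (lin l' (fun i => c (S i)))
  end.

Lemma lin_plus l : forall c d, lin l (fun i => c i + d i) = plus (lin l c) (lin l d).
Proof.
  induction l as [|v l IH]; intros c d; simpl; [now rewrite plus_zero_l|].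
  rewrite (IH (fun i => c (S i)) (fun i => d (S i))).
  replace (scal (c O + d O) v) with (plus (scal (c O) v) (scal (d O) v))
    by (symmetry; exact (scal_distr_r (c O) (d O) v)).
  rewrite <- !plus_assoc; f_equal.
  rewrite !plus_assoc; f_equal; apply plus_comm.
Qed.

Lemma lin_scal l : forall r c, lin l (fun i => r * c i) = scal r (lin l c).
Proof.
  induction l as [|v l IH]; intros r c; simpl; [now rewrite scal_zero_r|].
  rewrite (IH r (fun i => c (S i))), scal_distr_l, scal_assoc; reflexivity.
Qed.

Lemma lin_zero l : lin l (fun _ => 0) = zero.
Proof.
  induction l as [|v l IH]; simpl; [easy|].
  rewrite IH, plus_zero_r; apply (scal_zero_l v).
Qed.

Lemma lin_ext l : forall c d, (forall i, c i = d i) -> lin l c = lin l d.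
Proof.
  induction l as [|v l IH]; intros c d H; simpl; [easy|].
  rewrite (H O), (IH _ (fun i => d (S i))); auto.
Qed.

Lemma lin_var l : forall i, lin l (fun j => if Nat.eqb i j then 1 else 0) = nth i l zero.
Proof.
  induction l as [|v l IH]; intros [|i]; simpl; try easy.
  - rewrite lin_zero, plus_zero_r; apply (scal_one v).
  - rewrite IH; etransitivity; [|apply plus_zero_l]; f_equal; apply (scal_zero_l v).
Qed.

Lemma lden_lin l e : lden l e = lin l (lcoef e).
Proof.
  induction e as [i| |a IHa b IHb|a IHa|r a IHa]; simpl.
  - now rewrite lin_var.
  - now rewrite lin_zero.
  - now rewrite IHa, IHb, lin_plus.
  - rewrite IHa, <- scal_opp_one, <- lin_scal.
    apply lin_ext; intros i; unfold opp, one; simpl; ring.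
  - now rewrite IHa, lin_scal.
Qed.

(** A computed conjunction instead of a bounded quantifier, so that evaluation and [split] leave one
    real identity per atom. *)
Fixpoint eq_upto (n : nat) (c d : nat -> R) : Prop :=
  match n with
  | O => True
  | S m => c O = d O /\ eq_upto m (fun i => c (S i)) (fun i => d (S i))
  end.

Lemma lin_eq_upto l : forall c d, eq_upto (length l) c d -> lin l c = lin l d.
Proof.
  induction l as [|v l IH]; intros c d H; simpl in *; [easy|].
  destruct H as [H1 H2]; rewrite H1, (IH _ (fun i => d (S i))); auto.
Qed.

Lemma lden_eq l e1 e2 : eq_upto (length l) (lcoef e1) (lcoef e2) -> lden l e1 = lden l e2.
Proof. intros H; rewrite !lden_lin; now apply lin_eq_upto. Qed.

End LinearCombinations.

Ltac lc_index x l :=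
  lazymatch l with
  | cons x _ => constr:(O)
  | cons _ ?l' => let n := lc_index x l' in constr:(S n)
  end.
Ltac lc_add x l :=
  lazymatch l with
  | context [cons x _] => l
  | _ => constr:(cons x l)
  end.
Ltac lc_atoms e l :=
  lazymatch e with
  | plus ?a ?b => let l := lc_atoms a l in lc_atoms b l
  | minus ?a ?b => let l := lc_atoms a l in lc_atoms b l
  | opp ?a => lc_atoms a l
  | scal _ ?a => lc_atoms a l
  | zero => l
  | _ => lc_add e l
  end.
Ltac lc_reify e l :=
  lazymatch e with
  | plus ?a ?b => let a := lc_reify a l in let b := lc_reify b l in constr:(LPlus a b)
  | minus ?a ?b => let a := lc_reify a l in let b := lc_reify b l in constr:(LPlus a (LOpp b))
  | opp ?a => let a := lc_reify a l in constr:(LOpp a)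
  | scal ?r ?a => let a := lc_reify a l in constr:(LScal r a)
  | zero => constr:(LZero)
  | _ => let n := lc_index e l in constr:(LVar n)
  end.
(* Reduces an equality between linear combinations of vectors to the equality of the
   coefficients of each vector. *)
Ltac lincomb :=
  match goal with
  | |- @eq ?T ?a ?b =>
    let l := lc_atoms a (@nil T) in let l := lc_atoms b l in
    let a' := lc_reify a l in let b' := lc_reify b l in
    refine (lden_eq l a' b' _); cbn [length eq_upto lcoef Nat.eqb]; repeat split
  end.
Ltac module_eq := lincomb; ring.

(* Coquelicot reaches the group structure of a complete normed module along several
   convertible but syntactically different paths; [nm] selects the one through [NormedModule]. *)
Ltac nm_op op V :=
  repeat match goal with
  | |- context [op ?G] =>
    lazymatch G with NormedModule.AbelianMonoid _ _ => fail | NormedModule.AbelianGroup _ _ => fail | _ => idtac end;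
    first [ progress change (op G) with (op (NormedModule.AbelianMonoid R_AbsRing V))
          | progress change (op G) with (op (NormedModule.AbelianGroup R_AbsRing V)) ]
  | H : context [op ?G] |- _ =>
    lazymatch G with NormedModule.AbelianMonoid _ _ => fail | NormedModule.AbelianGroup _ _ => fail | _ => idtac end;
    first [ progress change (op G) with (op (NormedModule.AbelianMonoid R_AbsRing V)) in H
          | progress change (op G) with (op (NormedModule.AbelianGroup R_AbsRing V)) in H ]
  end.
Ltac nm_with V :=
  nm_op (@plus) V; nm_op (@zero) V; nm_op (@minus) V; nm_op (@opp) V.
Ltac nm :=
  repeat match goal with
  | |- context [CompleteNormedModule.ModuleSpace ?K ?V] =>
    change (CompleteNormedModule.ModuleSpace K V)
      with (NormedModule.ModuleSpace K (CompleteNormedModule.NormedModule K V))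
  | H : context [CompleteNormedModule.ModuleSpace ?K ?V] |- _ =>
    change (CompleteNormedModule.ModuleSpace K V)
      with (NormedModule.ModuleSpace K (CompleteNormedModule.NormedModule K V)) in H
  end;
  match goal with
  | |- context [@norm R_AbsRing ?V _] => nm_with V
  | |- context [NormedModule.ModuleSpace R_AbsRing ?V] => nm_with V
  | |- context [CompleteNormedModule.NormedModule R_AbsRing ?V] =>
    nm_with (CompleteNormedModule.NormedModule R_AbsRing V)
  | V : CompleteNormedModule R_AbsRing |- _ => nm_with (CompleteNormedModule.NormedModule R_AbsRing V)
  | V : NormedModule R_AbsRing |- _ => nm_with V
  end.

Ltac norm_as e' :=
  match goal with |- context [norm ?e] => replace e with e' by (lincomb; first [ring | field; lra]) end; nm.

Section Norms.
Context {V : NormedModule R_AbsRing}.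

Lemma norm_minus_sym (x y : V) : norm (minus x y) = norm (minus y x).
Proof. rewrite <- norm_opp; f_equal; module_eq. Qed.

Lemma norm_minus_triangle (x y z : V) :
  norm (minus x z) <= norm (minus x y) + norm (minus y z).
Proof.
  replace (minus x z) with (plus (minus x y) (minus y z)) by module_eq.
  apply norm_triangle.
Qed.

Lemma norm_le_minus (x y : V) : norm x <= norm (minus x y) + norm y.
Proof.
  replace x with (plus (minus x y) y) at 1 by module_eq.
  apply norm_triangle.
Qed.

Lemma norm_scal_le (a : R) (x : V) : norm (scal a x) <= Rabs a * norm x.
Proof. exact (norm_scal a x). Qed.

(** The axioms of a normed module give only the upper bound; for nonzero [a] the converse is the
    same bound applied to [/ a]. *)
Lemma norm_scal_R (a : R) (x : V) : norm (scal a x) = Rabs a * norm x.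
Proof.
  apply Rle_antisym; [apply norm_scal_le|].
  destruct (Req_dec a 0) as [->|Ha]; [rewrite Rabs_R0, Rmult_0_l; apply norm_ge_0|].
  assert (H := norm_scal_le (/ a) (scal a x)).
  replace (scal (/ a) (scal a x)) with x in H by (lincomb; field; easy).
  apply Rle_trans with (Rabs a * (Rabs (/ a) * norm (scal a x))).
  - apply Rmult_le_compat_l; [apply Rabs_pos|exact H].
  - rewrite <- Rmult_assoc, <- Rabs_mult, Rinv_r, Rabs_R1 by easy; lra.
Qed.

Lemma eq_of_norm_lt (x y : V) :
  (forall e, 0 < e -> norm (minus x y) < e) -> x = y.
Proof.
  intros H.
  assert (H0 : norm (minus x y) = 0).
  { destruct (Rle_lt_or_eq_dec 0 _ (norm_ge_0 (minus x y))) as [h|h]; [|now rewrite <- h].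
    specialize (H _ h); lra. }
  apply norm_eq_zero in H0.
  replace x with (plus (minus x y) y) by module_eq.
  rewrite H0; apply plus_zero_l.
Qed.

Lemma filterlim_norm_eps {T} (F : (T -> Prop) -> Prop) {FF : Filter F} (f : T -> V) (l : V) :
  filterlim f F (locally l) <->
  forall e, 0 < e -> F (fun x => norm (minus (f x) l) < e).
Proof.
  rewrite filterlim_locally_ball_norm; split.
  - intros H e He; exact (H (mkposreal e He)).
  - intros H [e He]; exact (H e He).
Qed.

Lemma at_right_0_iff (P : R -> Prop) :
  at_right 0 P <-> exists d, 0 < d /\ forall x, 0 < x < d -> P x.
Proof.
  split.
  - intros [d Hd]; exists d; split; [apply cond_pos|].
    intros x Hx; apply Hd; [|lra].
    unfold ball; simpl; unfold AbsRing_ball, abs, minus, plus, opp; simpl.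
    rewrite Rabs_pos_eq; lra.
  - intros [d [Hd H]]; exists (mkposreal d Hd); intros x Hx Hx0; apply H; split; [easy|].
    unfold ball in Hx; simpl in Hx; unfold AbsRing_ball, abs, minus, plus, opp in Hx; simpl in Hx.
    apply Rabs_def2 in Hx; lra.
Qed.

End Norms.

(** * Improper integrals over the positive half-line *)

Section ImproperIntegral.
Context {V0 : CompleteNormedModule R_AbsRing}.
Local Notation V := (CompleteNormedModule.NormedModule R_AbsRing V0).

(** The proper integral [J] stays existentially quantified, because integrability on compact
    intervals is part of the convergence and not presupposed. *)
Lemma is_Int0inf_iff (f : R -> V) (l : V) :
  is_Int0inf f l <->
  forall e, 0 < e -> exists d N, 0 < d /\
    forall a b, 0 < a < d -> N < b ->
    exists J, is_RInt f a b J /\ norm (minus J l) < e.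
Proof.
  split.
  - intros H e He.
    destruct (H (ball_norm l (mkposreal e He))) as [Q S HQ [N HN] HQS].
    { apply locally_ball_norm. }
    apply at_right_0_iff in HQ; destruct HQ as [d [Hd HQ]].
    exists d, N; split; [easy|]; intros a b Ha Hb.
    exact (HQS a b (HQ a Ha) (HN b Hb)).
  - intros H P HP.
    apply locally_norm_le_locally in HP.
    destruct HP as [e HP]; destruct (H e (cond_pos e)) as [d [N [Hd H']]].
    apply Filter_prod with (fun a => 0 < a < d) (fun b => N < b).
    + apply at_right_0_iff; now exists d.
    + now exists N.
    + intros a b Ha Hb; destruct (H' a b Ha Hb) as [J [HJ HJl]].
      exists J; split; [exact HJ|]; now apply HP.
Qed.

Definition loc_int (f : R -> V) : Prop := forall a b, 0 < a -> a <= b -> ex_RInt f a b.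

Lemma loc_int_continuous (f : R -> V) :
  (forall t, 0 < t -> continuous f t) -> loc_int f.
Proof.
  intros H a b Ha Hab; apply ex_RInt_continuous; intros z Hz.
  rewrite Rmin_left in Hz by easy; apply H; lra.
Qed.

Lemma loc_int_ext (f g : R -> V) :
  (forall t, 0 < t -> f t = g t) -> loc_int f -> loc_int g.
Proof.
  intros H Hf a b Ha Hab; apply (ex_RInt_ext f); [|now apply Hf].
  intros x; rewrite Rmin_left by easy; intros Hx; apply H; lra.
Qed.

Lemma is_Int0inf_loc (f : R -> V) l : is_Int0inf f l -> loc_int f.
Proof.
  intros H a b Ha Hab; rewrite is_Int0inf_iff in H.
  destruct (H 1 Rlt_0_1) as [d [N [Hd H']]].
  destruct (H' (Rmin a (d / 2)) (Rmax b (N + 1))) as [J [HJ _]].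
  - split; [apply Rmin_glb_lt; lra|].
    apply Rle_lt_trans with (d / 2); [apply Rmin_r|lra].
  - apply Rlt_le_trans with (N + 1); [lra|apply Rmax_r].
  - assert (H1 := Rmin_l a (d / 2)); assert (H2 := Rmax_l b (N + 1)).
    apply (ex_RInt_Chasles_1 f a b (Rmax b (N + 1))); [lra|].
    apply (ex_RInt_Chasles_2 f (Rmin a (d / 2))); [lra|].
    now exists J.
Qed.

Lemma is_Int0inf_RInt (f : R -> V) (l : V) :
  loc_int f ->
  (is_Int0inf f l <->
   forall e, 0 < e -> exists d N, 0 < d /\
    forall a b, 0 < a < d -> N < b -> a <= b -> norm (minus (RInt f a b : V) l) < e).
Proof.
  intros Hf; rewrite is_Int0inf_iff; split; intros H e He;
    destruct (H e He) as [d [N [Hd H']]].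
  - exists d, N; split; [easy|]; intros a b Ha Hb Hab.
    destruct (H' a b Ha Hb) as [J [HJ HJl]].
    now rewrite (is_RInt_unique _ _ _ _ HJ).
  (* An upper threshold of at least [d] forces [a < d < b], so the endpoints are ordered. *)
  - exists d, (Rmax N d); split; [easy|]; intros a b Ha Hb.
    assert (H1 := Rmax_l N d); assert (H2 := Rmax_r N d).
    exists (RInt f a b); split; [apply RInt_correct, Hf; lra|].
    apply H'; lra.
Qed.

Lemma Int0inf_unique (f : R -> V) l : is_Int0inf f l -> Int0inf (V := V0) f = l.
Proof. apply is_RInt_gen_unique. Qed.

Lemma is_Int0inf_inj (f : R -> V) l l' : is_Int0inf f l -> is_Int0inf f l' -> l = l'.
Proof. intros H H'; now rewrite <- (Int0inf_unique f l H), <- (Int0inf_unique f l' H'). Qed.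

Lemma is_Int0inf_ext (f g : R -> V) l :
  (forall t, 0 < t -> f t = g t) -> is_Int0inf f l -> is_Int0inf g l.
Proof.
  intros H; apply is_RInt_gen_ext.
  apply Filter_prod with (fun a => 0 < a < 1) (fun b => 1 < b).
  - apply at_right_0_iff; exists 1; split; [lra|easy].
  - now exists 1.
  - intros a b Ha Hb x; simpl; rewrite Rmin_left by lra; intros Hx; apply H; lra.
Qed.

Lemma is_Int0inf_plus (f g : R -> V) lf lg :
  is_Int0inf f lf -> is_Int0inf g lg ->
  is_Int0inf (fun t => plus (f t) (g t)) (plus lf lg).
Proof. intros Hf Hg; exact (is_RInt_gen_plus f g lf lg Hf Hg). Qed.

Lemma is_Int0inf_minus (f g : R -> V) lf lg :
  is_Int0inf f lf -> is_Int0inf g lg ->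
  is_Int0inf (fun t => minus (f t) (g t)) (minus lf lg).
Proof. intros Hf Hg; exact (is_RInt_gen_minus f g lf lg Hf Hg). Qed.

Lemma is_Int0inf_scal (f : R -> V) (k : R) l :
  is_Int0inf f l -> is_Int0inf (fun t => scal k (f t)) (scal k l).
Proof. intros Hf; exact (is_RInt_gen_scal f k l Hf). Qed.

Lemma is_Int0inf_derive (F f : R -> V) (l0 l1 : V) :
  (forall t, 0 < t -> is_derive F t (f t)) ->
  (forall t, 0 < t -> continuous f t) ->
  filterlim F (at_right 0) (locally l0) ->
  filterlim F (Rbar_locally p_infty) (locally l1) ->
  is_Int0inf f (minus l1 l0).
Proof.
  intros Hd Hc H0 H1; apply is_Int0inf_iff; intros e He.
  rewrite (filterlim_norm_eps (at_right 0)) in H0.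
  rewrite (filterlim_norm_eps (Rbar_locally p_infty)) in H1.
  specialize (H0 (e / 2) ltac:(lra)); specialize (H1 (e / 2) ltac:(lra)).
  apply at_right_0_iff in H0; destruct H0 as [d [Hd0 H0]]; destruct H1 as [N H1].
  exists d, (Rmax N d); split; [easy|]; intros a b Ha Hb.
  assert (h1 := Rmax_l N d); assert (h2 := Rmax_r N d).
  exists (minus (F b) (F a)); split.
  - apply (is_RInt_derive F f); intros x; rewrite Rmin_left by lra; intros Hx;
      [apply Hd|apply Hc]; lra.
  - replace (minus (minus (F b) (F a)) (minus l1 l0))
      with (minus (minus (F b) l1) (minus (F a) l0)) by module_eq.
    eapply Rle_lt_trans; [apply norm_triangle|]; rewrite norm_opp.
    specialize (H0 a Ha); specialize (H1 b ltac:(lra)); lra.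
Qed.


End ImproperIntegral.

(** * Comparison with scalar integrals *)

Section DominatedIntegrals.
Context {V0 : CompleteNormedModule R_AbsRing}.
Local Notation V := (CompleteNormedModule.NormedModule R_AbsRing V0).

(** The two integrals differ by the two added end pieces, each bounded by the integral of [h] over
    it. The right side being an increment of the integral of [h], the Cauchy property passes from
    [h] to [f]. *)
Lemma RInt_norm_extend (f : R -> V) (h : R -> R) a a' b' b :
  loc_int f -> (forall x y, 0 < x -> x <= y -> ex_RInt h x y) ->
  (forall t, 0 < t -> norm (f t) <= h t) ->
  0 < a -> a <= a' -> a' <= b' -> b' <= b ->
  norm (minus (RInt f a b : V) (RInt f a' b')) <= RInt h a b - RInt h a' b'.
Proof.
  intros Hf Hh Hfh Ha H1 H2 H3.
  assert (Hn : forall x y, 0 < x -> x <= y -> norm (RInt f x y) <= RInt h x y).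
  { intros x y Hx Hxy; apply (norm_RInt_le f h x y); [easy| | |].
    - intros z Hz; apply Hfh; lra.
    - apply RInt_correct, Hf; lra.
    - apply (RInt_correct h), Hh; lra. }
  rewrite <- (RInt_Chasles f a a' b) by (apply Hf; lra).
  rewrite <- (RInt_Chasles f a' b' b) by (apply Hf; lra).
  rewrite <- (RInt_Chasles h a a' b) by (apply Hh; lra).
  rewrite <- (RInt_Chasles h a' b' b) by (apply Hh; lra).
  norm_as (plus (RInt f a a') (RInt f b' b)).
  eapply Rle_trans; [apply norm_triangle|].
  assert (K1 := Hn a a' ltac:(lra) ltac:(lra)); assert (K2 := Hn b' b ltac:(lra) ltac:(lra)).
  unfold plus in *; simpl in *; lra.
Qed.

(** The comparison test: completeness of the space turns the Cauchy estimate into a limit, and the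
    norm bound on compact intervals survives in it. *)
Lemma is_Int0inf_dominated (f : R -> V) (h : R -> R) (lh : R) :
  loc_int f -> (forall t, 0 < t -> norm (f t) <= h t) ->
  is_Int0inf (V := R_NormedModule) h lh ->
  exists l, is_Int0inf f l /\ norm l <= lh.
Proof.
  intros Hf Hfh Hh.
  assert (Lh : forall x y, 0 < x -> x <= y -> ex_RInt h x y).
  { intros x y; exact (is_Int0inf_loc (V0 := R_CompleteNormedModule) h lh Hh x y). }
  assert (Hh' : forall e, 0 < e -> exists d N, 0 < d /\ d <= N /\
    forall a b, 0 < a < d -> N < b -> a <= b -> Rabs (RInt h a b - lh) < e).
  { intros e He.
    rewrite (is_Int0inf_iff (V0 := R_CompleteNormedModule)) in Hh; destruct (Hh e He) as [d [N [Hd H]]].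
    exists d, (Rmax d N); split; [easy|]; split; [apply Rmax_l|]; intros a b Ha Hb Hab.
    destruct (H a b Ha) as [J [HJ HJl]]; [assert (K := Rmax_r d N); lra|].
    now rewrite (is_RInt_unique h a b J HJ). }
  set (F := filter_prod (at_right 0) (Rbar_locally p_infty)).
  assert (Hl : exists l : V, filterlim (fun ab => RInt f (fst ab) (snd ab)) F (locally l)).
  { refine (proj1 (filterlim_locally_cauchy (U := CompleteNormedModule.CompleteSpace _ V0)
      (F := F) (fun ab => RInt f (fst ab) (snd ab))) _); intros e.
    destruct (Hh' (e / 4) ltac:(destruct e; simpl; lra)) as [d [N [Hd [HdN H]]]].
    exists (fun ab => 0 < fst ab < d /\ N < snd ab); split.
    { apply Filter_prod with (fun a => 0 < a < d) (fun b => N < b); try easy.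
      - apply at_right_0_iff; now exists d.
      - now exists N. }
    intros [a b] [a' b']; simpl; intros [Ha Hb] [Ha' Hb'].
    apply (norm_compat1 (RInt f a b) (RInt f a' b') e).
    (* The two intervals need not be nested, so both are compared with the smallest interval
       containing them; this costs four errors of size [e / 4]. *)
    set (a0 := Rmin a a'); set (b0 := Rmax b b').
    assert (a0 <= a) by apply Rmin_l; assert (a0 <= a') by apply Rmin_r.
    assert (b <= b0) by apply Rmax_l; assert (b' <= b0) by apply Rmax_r.
    assert (0 < a0) by (apply Rmin_glb_lt; lra).
    assert (K1 := RInt_norm_extend f h a0 a b b0 Hf Lh Hfh ltac:(lra) ltac:(lra) ltac:(lra) ltac:(lra)).
    assert (K2 := RInt_norm_extend f h a0 a' b' b0 Hf Lh Hfh ltac:(lra) ltac:(lra) ltac:(lra) ltac:(lra)).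
    assert (K := norm_minus_triangle (RInt f a' b') (RInt f a0 b0) (RInt f a b)).
    rewrite (norm_minus_sym (RInt f a' b') (RInt f a0 b0)) in K.
    assert (h0 := Rabs_def2 _ _ (H a0 b0 ltac:(lra) ltac:(lra) ltac:(lra))).
    assert (h1 := Rabs_def2 _ _ (H a b ltac:(lra) ltac:(lra) ltac:(lra))).
    assert (h2 := Rabs_def2 _ _ (H a' b' ltac:(lra) ltac:(lra) ltac:(lra))).
    destruct e as [e He]; simpl in *; nm; lra. }
  destruct Hl as [l Hl]; exists l.
  assert (HI : forall e, 0 < e -> exists d N, 0 < d /\
    forall a b, 0 < a < d -> N < b -> a <= b -> norm (minus (RInt f a b : V) l) < e).
  { intros e He.
    destruct (proj1 (filterlim_norm_eps (V := V) F _ l) Hl e He) as [Q S HQ [N HN] HQS].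
    apply at_right_0_iff in HQ; destruct HQ as [d [Hd HQ]].
    exists d, N; split; [easy|]; intros a b Ha Hb _; exact (HQS a b (HQ a Ha) (HN b Hb)). }
  split; [now apply is_Int0inf_RInt|].
  apply le_epsilon; intros e He.
  destruct (HI (e / 2) ltac:(lra)) as [d [N [Hd H]]].
  destruct (Hh' (e / 2) ltac:(lra)) as [d' [N' [Hd' [HdN' H']]]].
  set (a := Rmin d d' / 2); set (b := Rmax (N + 1) (N' + 1)).
  assert (E1 : Rmin d d' <= d) by apply Rmin_l; assert (E2 : Rmin d d' <= d') by apply Rmin_r.
  assert (E3 : 0 < Rmin d d') by (apply Rmin_glb_lt; lra).
  assert (E4 : N + 1 <= b) by apply Rmax_l; assert (E5 : N' + 1 <= b) by apply Rmax_r.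
  assert (Ea : 0 < a < Rmin d d') by (unfold a; lra).
  specialize (H a b ltac:(lra) ltac:(lra) ltac:(lra)).
  specialize (H' a b ltac:(lra) ltac:(lra) ltac:(lra)); apply Rabs_def2 in H'.
  assert (K : norm (RInt f a b) <= RInt h a b).
  { apply (norm_RInt_le f h a b); [lra| | |].
    - intros z Hz; apply Hfh; lra.
    - apply RInt_correct, Hf; lra.
    - apply (RInt_correct h), Lh; lra. }
  assert (K' := norm_le_minus l (RInt f a b)); rewrite norm_minus_sym in K'; lra.
Qed.

End DominatedIntegrals.

(** * Bounded linear maps under the integral sign *)

Section LinearImage.
Context {V W : NormedModule R_AbsRing}.
Variables (L : V -> W) (K : R).
Hypothesis Lplus : forall x y, L (plus x y) = plus (L x) (L y).
Hypothesis Lscal : forall (k : R) x, L (scal k x) = scal k (L x).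
Hypothesis Lnorm : forall x, norm (L x) <= K * norm x.

Lemma linmap_zero : L zero = zero.
Proof.
  rewrite <- (scal_zero_l (zero : V)) at 1.
  etransitivity; [apply (Lscal 0)|]; apply (scal_zero_l (L zero)).
Qed.

Lemma linmap_minus x y : L (minus x y) = minus (L x) (L y).
Proof.
  replace (minus x y) with (plus x (scal (-1) y)) by module_eq.
  rewrite Lplus, Lscal; module_eq.
Qed.

Lemma linmap_filterlim {U} (F : (U -> Prop) -> Prop) {FF : Filter F} (f : U -> V) l :
  filterlim f F (locally l) -> filterlim (fun u => L (f u)) F (locally (L l)).
Proof.
  intros H; apply (filterlim_norm_eps F); intros e He.
  assert (HK : 0 < Rabs K + 1) by (assert (h := Rabs_pos K); lra).
  generalize (proj1 (filterlim_norm_eps F f l) H (e / (Rabs K + 1))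
    ltac:(apply Rdiv_lt_0_compat; lra)).
  apply filter_imp; intros u Hu.
  rewrite <- linmap_minus.
  eapply Rle_lt_trans; [apply Lnorm|].
  apply Rle_lt_trans with (Rabs K * norm (minus (f u) l)).
  - apply Rmult_le_compat_r; [apply norm_ge_0|apply Rle_abs].
  - apply (Rmult_lt_compat_l (Rabs K + 1)) in Hu; [|easy].
    replace ((Rabs K + 1) * (e / (Rabs K + 1))) with e in Hu by (field; lra).
    assert (h := norm_ge_0 (minus (f u) l)); lra.
Qed.

Lemma linmap_Riemann_sum (f : R -> V) (s : SF_seq) :
  Riemann_sum (fun t => L (f t)) s = L (Riemann_sum f s).
Proof.
  apply (SF_cons_ind (fun s => Riemann_sum (fun t => L (f t)) s = L (Riemann_sum f s))).
  - intros x; exact (eq_sym linmap_zero).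
  - intros h s0 IH; rewrite !Riemann_sum_cons, Lplus, Lscal, IH; reflexivity.
Qed.

Lemma linmap_is_RInt (f : R -> V) a b l :
  is_RInt f a b l -> is_RInt (fun t => L (f t)) a b (L l).
Proof.
  intros H; unfold is_RInt.
  apply (filterlim_ext (fun s => L (scal (sign (b - a)) (Riemann_sum f s)))).
  - intros s; now rewrite linmap_Riemann_sum, Lscal.
  - now apply (linmap_filterlim (Riemann_fine a b)).
Qed.

End LinearImage.

Section LinearImage0inf.
Context {V0 W0 : CompleteNormedModule R_AbsRing}.
Local Notation V := (CompleteNormedModule.NormedModule R_AbsRing V0).
Local Notation W := (CompleteNormedModule.NormedModule R_AbsRing W0).

Lemma linmap_is_Int0inf (L : V -> W) (K : R) (f : R -> V) l :
  (forall x y, L (plus x y) = plus (L x) (L y)) ->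
  (forall (k : R) x, L (scal k x) = scal k (L x)) ->
  (forall x, norm (L x) <= K * norm x) ->
  is_Int0inf f l -> is_Int0inf (fun t => L (f t)) (L l).
Proof.
  intros Lp Ls Ln H; apply is_Int0inf_iff; intros e He.
  assert (HK : 0 < Rabs K + 1) by (assert (h := Rabs_pos K); lra).
  destruct (proj1 (is_Int0inf_iff f l) H (e / (Rabs K + 1))) as [d [N [Hd H']]].
  { apply Rdiv_lt_0_compat; lra. }
  exists d, N; split; [easy|]; intros a b Ha Hb.
  destruct (H' a b Ha Hb) as [J [HJ HJl]].
  exists (L J); split; [now apply (linmap_is_RInt L K)|].
  rewrite <- (linmap_minus L) by easy.
  eapply Rle_lt_trans; [apply Ln|].
  apply Rle_lt_trans with (Rabs K * norm (minus J l)).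
  - apply Rmult_le_compat_r; [apply norm_ge_0|apply Rle_abs].
  - apply (Rmult_lt_compat_l (Rabs K + 1)) in HJl; [|easy].
    replace ((Rabs K + 1) * (e / (Rabs K + 1))) with e in HJl by (field; lra).
    assert (h := norm_ge_0 (minus J l)); lra.
Qed.

End LinearImage0inf.

Notation is_Int0infR := (is_Int0inf (V := R_NormedModule)).
Notation loc_intR := (loc_int (V0 := R_CompleteNormedModule)).

(** With [f] as its own dominating function, the comparison test bounds a norm by [l]. *)
Lemma is_Int0infR_ge0 (f : R -> R) (l : R) :
  (forall t, 0 < t -> 0 <= f t) -> is_Int0infR f l -> 0 <= l.
Proof.
  intros Hf H.
  destruct (is_Int0inf_dominated (V0 := R_CompleteNormedModule) f f l) as [l' [H' Hl]].
  - now apply (is_Int0inf_loc (V0 := R_CompleteNormedModule) f l).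
  - intros t Ht; apply Req_le, Rabs_pos_eq, Hf, Ht.
  - easy.
  - eapply Rle_trans; [apply (norm_ge_0 l')|exact Hl].
Qed.

Lemma is_Int0infR_minus (f g : R -> R) (lf lg : R) :
  is_Int0infR f lf -> is_Int0infR g lg -> is_Int0infR (fun t => f t - g t) (lf - lg).
Proof. apply (is_Int0inf_minus (V0 := R_CompleteNormedModule)). Qed.

Lemma is_Int0infR_plus (f g : R -> R) (lf lg : R) :
  is_Int0infR f lf -> is_Int0infR g lg -> is_Int0infR (fun t => f t + g t) (lf + lg).
Proof. apply (is_Int0inf_plus (V0 := R_CompleteNormedModule)). Qed.

Lemma is_Int0infR_scal (k : R) (f : R -> R) (lf : R) :
  is_Int0infR f lf -> is_Int0infR (fun t => k * f t) (k * lf).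
Proof. apply (is_Int0inf_scal (V0 := R_CompleteNormedModule)). Qed.

Lemma is_Int0infR_ext (f g : R -> R) (l : R) :
  (forall t, 0 < t -> f t = g t) -> is_Int0infR f l -> is_Int0infR g l.
Proof. apply (is_Int0inf_ext (V0 := R_CompleteNormedModule)). Qed.

Lemma is_Int0infR_inj (f : R -> R) (l l' : R) : is_Int0infR f l -> is_Int0infR f l' -> l = l'.
Proof. apply (is_Int0inf_inj (V0 := R_CompleteNormedModule)). Qed.

Lemma is_Int0infR_dominated (f h : R -> R) (lh : R) :
  loc_intR f -> (forall t, 0 < t -> Rabs (f t) <= h t) -> is_Int0infR h lh ->
  exists l : R, is_Int0infR f l /\ Rabs l <= lh.
Proof. apply (is_Int0inf_dominated (V0 := R_CompleteNormedModule)). Qed.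

Lemma is_Int0infR_derive (F f : R -> R) (l0 l1 : R) :
  (forall t, 0 < t -> is_derive F t (f t)) ->
  (forall t, 0 < t -> continuous f t) ->
  filterlim F (at_right 0) (locally l0) ->
  filterlim F (Rbar_locally p_infty) (locally l1) ->
  is_Int0infR f (l1 - l0).
Proof. apply (is_Int0inf_derive (V0 := R_CompleteNormedModule)). Qed.

Section Step.
Context {V0 : CompleteNormedModule R_AbsRing}.
Local Notation V := (CompleteNormedModule.NormedModule R_AbsRing V0).

Definition step (c : R) (f g : R -> V) (t : R) : V := if Rlt_dec t c then f t else g t.

Lemma loc_int_step c (f g : R -> V) : loc_int f -> loc_int g -> loc_int (step c f g).
Proof.
  intros Hf Hg.
  assert (H1 : forall a b, 0 < a -> a <= b -> b <= c -> ex_RInt (step c f g) a b).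
  { intros a b Ha Hab Hb; apply (ex_RInt_ext f); [|now apply Hf].
    intros x; rewrite Rmax_right by easy; intros Hx; unfold step.
    destruct (Rlt_dec x c); [easy|lra]. }
  assert (H2 : forall a b, 0 < a -> a <= b -> c <= a -> ex_RInt (step c f g) a b).
  { intros a b Ha Hab Hb; apply (ex_RInt_ext g); [|now apply Hg].
    intros x; rewrite Rmin_left by easy; intros Hx; unfold step.
    destruct (Rlt_dec x c); [lra|easy]. }
  intros a b Ha Hab.
  destruct (Rle_dec b c); [now apply H1|].
  destruct (Rle_dec c a); [now apply H2|].
  apply ex_RInt_Chasles with c; [apply H1|apply H2]; lra.
Qed.

(** Puts an integral over [(c, oo)] in the form of one over [(0, oo)], so that Laguerre partial sums
    can be subtracted from it under one integral sign. *)
Lemma is_Int0inf_step_zero c (g J : R -> V) l :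
  0 < c -> (forall b, c < b -> is_RInt g c b (J b)) ->
  filterlim J (Rbar_locally p_infty) (locally l) ->
  is_Int0inf (step c (fun _ => zero) g) l.
Proof.
  intros Hc HJ Hl; apply is_Int0inf_iff; intros e He.
  destruct (proj1 (filterlim_norm_eps (V := V) (Rbar_locally p_infty) J l) Hl e He) as [N HN].
  exists c, (Rmax N c); split; [easy|]; intros a b Ha Hb.
  assert (h1 := Rmax_l N c); assert (h2 := Rmax_r N c).
  exists (J b); split; [|apply HN; lra].
  replace (J b) with (plus (scal (c - a) zero) (J b)).
  - apply is_RInt_Chasles with c.
    + apply (is_RInt_ext (fun _ => zero)).
      * intros x; rewrite Rmax_right by lra; intros Hx; unfold step.
        destruct (Rlt_dec x c); [easy|lra].
      * apply (is_RInt_const (V := V)).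
    + apply (is_RInt_ext g); [|apply HJ; lra].
      intros x; rewrite Rmin_left by lra; intros Hx; unfold step.
      destruct (Rlt_dec x c); [lra|easy].
  - module_eq.
Qed.

End Step.

(** * The Gamma function *)

Lemma Rpower_pos x a : 0 < Rpower x a.
Proof. apply exp_pos. Qed.

Lemma exp_le x y : x <= y -> exp x <= exp y.
Proof. intros [h|h]; [left; now apply exp_increasing|subst; apply Rle_refl]. Qed.

Lemma exp_le_1 x : x <= 0 -> exp x <= 1.
Proof. intros h; rewrite <- exp_0; now apply exp_le. Qed.

Lemma Rpower_inv c a : 0 < c -> Rpower (/ c) a = / Rpower c a.
Proof. intros Hc; unfold Rpower; rewrite ln_Rinv by easy; rewrite <- exp_Ropp; f_equal; ring. Qed.

Lemma is_derive_Rpower a t : 0 < t -> is_derive (fun t => Rpower t a) t (a * Rpower t (a - 1)).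
Proof.
  intros Ht; unfold Rpower; auto_derive; [lra|].
  replace ((a - 1) * ln t) with (a * ln t + - ln t) by ring.
  rewrite exp_plus, exp_Ropp, exp_ln by lra; field; lra.
Qed.

Lemma continuous_Rpower a t : 0 < t -> continuous (fun t => Rpower t a) t.
Proof.
  intros Ht; apply (ex_derive_continuous (V := R_NormedModule)).
  eexists; now apply is_derive_Rpower.
Qed.

Lemma continuous_exp_lin c t : continuous (fun t => exp (c * t)) t.
Proof.
  apply (ex_derive_continuous (V := R_NormedModule)); auto_derive; easy.
Qed.

Lemma is_derive_exp_lin c t : is_derive (fun t => exp (c * t)) t (c * exp (c * t)).
Proof. auto_derive; [easy|ring]. Qed.

Lemma Rpower_succ x a : 0 < x -> Rpower x (a + 1) = Rpower x a * x.
Proof. intros Hx; rewrite Rpower_plus, Rpower_1; easy. Qed.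

Lemma Rpower_pred x a : 0 < x -> Rpower x a = Rpower x (a - 1) * x.
Proof. intros Hx; rewrite <- Rpower_succ by easy; f_equal; ring. Qed.

Lemma Rpower_le_base x y a : 0 <= a -> 0 < x -> x <= y -> Rpower x a <= Rpower y a.
Proof. intros Ha Hx Hxy; apply Rle_Rpower_l; lra. Qed.

Lemma Rpower_1_base a : Rpower 1 a = 1.
Proof. unfold Rpower; rewrite ln_1, Rmult_0_r; apply exp_0. Qed.

Lemma Rpower_ge_1 x a : 0 <= a -> 1 <= x -> 1 <= Rpower x a.
Proof.
  intros Ha Hx; rewrite <- (Rpower_1_base a); apply Rpower_le_base; lra.
Qed.

Lemma ln_le_minus_1 u : 0 < u -> ln u <= u - 1.
Proof.
  intros Hu; destruct (Req_dec (ln u) 0) as [h|h].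
  - assert (u = 1) by (rewrite <- (exp_ln u Hu), h; apply exp_0); subst; lra.
  - assert (K := exp_ineq1 (ln u) h); rewrite exp_ln in K by easy; lra.
Qed.

(** For [p > 0] the exponent [p ln (1 + t) - c t] is largest at [1 + t = p / c]; the constant comes
    from [ln u <= u - 1] at [u = (1 + t) / (p / c)]. *)
Lemma exp_absorbs_power p c :
  0 < c -> exists K, 0 < K /\ forall t, 0 <= t -> Rpower (1 + t) p * exp (- c * t) <= K.
Proof.
  intros Hc; destruct (Rle_dec p 0) as [Hp|Hp].
  - exists 1; split; [lra|]; intros t Ht.
    replace 1 with (1 * 1) by ring; apply Rmult_le_compat; try (left; apply exp_pos).
    + replace p with (- (- p)) by ring; rewrite Rpower_Ropp.
      rewrite <- Rinv_1; apply Rinv_le_contravar; [lra|apply Rpower_ge_1; lra].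
    + rewrite <- exp_0; apply exp_le; nra.
  - assert (Hq : 0 < p / c) by (apply Rdiv_lt_0_compat; lra).
    exists (exp (c - p + p * ln (p / c))); split; [apply exp_pos|]; intros t Ht.
    unfold Rpower; rewrite <- exp_plus; apply exp_le.
    assert (K := ln_le_minus_1 ((1 + t) / (p / c)) ltac:(apply Rdiv_lt_0_compat; lra)).
    rewrite ln_div in K by lra.
    apply (Rmult_le_compat_l p) in K; [|lra].
    replace (p * ((1 + t) / (p / c) - 1)) with (c * (1 + t) - p) in K by (field; lra).
    lra.
Qed.

Section Limits.
Context {V : NormedModule R_AbsRing}.

Lemma filterlim_zero_at_0 (F : R -> V) K g :
  0 < g -> 0 <= K -> (forall t, 0 < t < 1 -> norm (F t) <= K * Rpower t g) ->
  filterlim F (at_right 0) (locally (zero : V)).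
Proof.
  intros Hg HK HF; apply (filterlim_norm_eps (at_right 0)); intros e He.
  apply at_right_0_iff.
  set (d := Rpower (e / (K + 1)) (/ g)).
  assert (Hq : 0 < e / (K + 1)) by (apply Rdiv_lt_0_compat; lra).
  exists (Rmin 1 d); split; [apply Rmin_glb_lt; [lra|apply exp_pos]|].
  intros t [Ht1 Ht2].
  assert (h1 := Rmin_l 1 d); assert (h2 := Rmin_r 1 d).
  norm_as (F t).
  eapply Rle_lt_trans; [apply HF; lra|].
  assert (Hd : Rpower t g <= e / (K + 1)).
  { apply Rle_trans with (Rpower d g); [apply Rpower_le_base; lra|].
    unfold d; rewrite Rpower_mult, Rinv_l by lra; rewrite Rpower_1; lra. }
  apply Rle_lt_trans with (K * (e / (K + 1))); [apply Rmult_le_compat_l; lra|].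
  apply (Rmult_lt_reg_r (K + 1)); [lra|].
  replace (K * (e / (K + 1)) * (K + 1)) with (K * e) by (field; lra); lra.
Qed.

Lemma filterlim_zero_at_infty (F : R -> V) (u : R -> R) :
  (forall t, 1 < t -> norm (F t) <= u t) ->
  is_lim u p_infty 0 ->
  filterlim F (Rbar_locally p_infty) (locally (zero : V)).
Proof.
  intros HF Hu; apply (filterlim_norm_eps (Rbar_locally p_infty)); intros e He.
  apply is_lim_spec in Hu; destruct (Hu (mkposreal e He)) as [N HN]; simpl in HN.
  exists (Rmax N 1); intros t Ht.
  assert (h1 := Rmax_l N 1); assert (h2 := Rmax_r N 1).
  norm_as (F t).
  eapply Rle_lt_trans; [apply HF; lra|].
  specialize (HN t ltac:(lra)); apply Rabs_def2 in HN; lra.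
Qed.

End Limits.

Lemma is_lim_exp_decay K c : 0 < c -> is_lim (fun t => K * exp (- c * t)) p_infty 0.
Proof.
  intros Hc; apply is_lim_spec; intros [e He]; simpl.
  set (k := Rabs K + 1); assert (Hk : 0 < k) by (unfold k; assert (h := Rabs_pos K); lra).
  exists (- ln (e / k) / c); intros t Ht.
  rewrite Rminus_0_r, Rabs_mult, (Rabs_pos_eq (exp _)) by (left; apply exp_pos).
  apply Rle_lt_trans with (k * exp (- c * t)).
  - apply Rmult_le_compat_r; [left; apply exp_pos|unfold k; lra].
  - apply Rlt_le_trans with (k * exp (ln (e / k))).
    + apply Rmult_lt_compat_l; [easy|]; apply exp_increasing.
      apply (Rmult_lt_compat_l c) in Ht; [|easy].
      replace (c * (- ln (e / k) / c)) with (- ln (e / k)) in Ht by (field; lra); lra.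
    + rewrite exp_ln by (apply Rdiv_lt_0_compat; lra); right; field; lra.
Qed.

Lemma filterlim_at_right_0_continuous {V : NormedModule R_AbsRing} (F : R -> V) :
  continuous F 0 -> filterlim F (at_right 0) (locally (F 0)).
Proof.
  intros H; eapply filterlim_filter_le_1; [|exact H].
  intros P HP; now apply filter_le_within.
Qed.

(* Antiderivative: [(t / (1 + t)) ^ g / g]. *)
Lemma is_Int0inf_beta g :
  0 < g -> is_Int0infR (fun t => Rpower t (g - 1) / Rpower (1 + t) (g + 1)) (/ g).
Proof.
  intros Hg; replace (/ g) with (/ g - 0) by ring.
  apply (is_Int0infR_derive (fun t => / g * Rpower (t / (1 + t)) g)).
  - intros t Ht; unfold Rpower; auto_derive.
    + split; [lra|]; split; [apply Rmult_lt_0_compat; [easy|apply Rinv_0_lt_compat; lra]|easy].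
    + change (t * / (1 + t)) with (t / (1 + t)).
      rewrite ln_div by lra.
      replace (g * (ln t - ln (1 + t)))
        with ((g - 1) * ln t + ln t + - ((g + 1) * ln (1 + t)) + ln (1 + t)) by ring.
      rewrite !exp_plus, exp_Ropp, !exp_ln by lra; field.
      assert (h := exp_pos ((g + 1) * ln (1 + t))); lra.
  - intros t Ht; apply (continuous_scal (fun t => Rpower t (g - 1)) (fun t => / Rpower (1 + t) (g + 1))).
    + now apply continuous_Rpower.
    + apply (ex_derive_continuous (V := R_NormedModule)); unfold Rpower; auto_derive.
      split; [lra|]; split; [|easy]; apply Rgt_not_eq, exp_pos.
  - apply (filterlim_zero_at_0 (V := R_NormedModule) _ (/ g) g); [easy|left; now apply Rinv_0_lt_compat|].
    intros t Ht; assert (0 < / g) by now apply Rinv_0_lt_compat.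
    unfold norm; simpl; unfold abs; simpl.
    rewrite Rabs_pos_eq by (apply Rmult_le_pos; [lra|left; apply exp_pos]).
    apply Rmult_le_compat_l; [lra|].
    apply Rpower_le_base; [lra|apply Rdiv_lt_0_compat; lra|].
    apply Rle_div_l; nra.
  - apply (filterlim_ext_loc (fun t => / g * Rpower (1 - / (1 + t)) g)).
    { exists 0; intros t Ht; do 2 f_equal; field; lra. }
    replace (/ g) with (/ g * Rpower (1 - 0) g) at 1
      by (rewrite Rminus_0_r, Rpower_1_base; ring).
    apply (filterlim_comp _ _ _ (fun t => / (1 + t)) (fun u => / g * Rpower (1 - u) g)
             _ (locally 0)).
    + assert (H : is_lim (fun t => / (1 + t)) p_infty 0).
      { apply is_lim_spec; intros [e He]; simpl; exists (/ e); intros t Ht.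
        assert (0 < / e) by now apply Rinv_0_lt_compat.
        rewrite Rminus_0_r, Rabs_pos_eq by (left; apply Rinv_0_lt_compat; lra).
        rewrite <- (Rinv_inv e); apply Rinv_lt_contravar; [|lra].
        apply Rmult_lt_0_compat; lra. }
      exact H.
    + apply (ex_derive_continuous (V := R_NormedModule) (fun u => / g * Rpower (1 - u) g)).
      unfold Rpower; auto_derive; lra.
Qed.

(** The Beta integrand, whose integral is explicit, dominates every integrand of Gamma type: the
    singularity [t^(g-1)] at 0 is kept and the exponential is traded for [(1 + t)^(-g-1)]. *)
Lemma gamma_integrand_le g p c :
  0 < g -> 0 < c -> exists K, 0 < K /\ forall t, 0 < t ->
  Rpower t (g - 1) * Rpower (1 + t) p * exp (- c * t) <=
  K * (Rpower t (g - 1) / Rpower (1 + t) (g + 1)).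
Proof.
  intros Hg Hc; destruct (exp_absorbs_power (p + (g + 1)) c Hc) as [K [HK H]].
  exists K; split; [easy|]; intros t Ht.
  specialize (H t ltac:(lra)); rewrite Rpower_plus in H.
  assert (h1 := Rpower_pos t (g - 1)); assert (h2 := Rpower_pos (1 + t) (g + 1)).
  apply (Rmult_le_reg_r (Rpower (1 + t) (g + 1))); [easy|].
  replace (K * (Rpower t (g - 1) / Rpower (1 + t) (g + 1)) * Rpower (1 + t) (g + 1))
    with (Rpower t (g - 1) * K) by (field; lra).
  replace (Rpower t (g - 1) * Rpower (1 + t) p * exp (- c * t) * Rpower (1 + t) (g + 1))
    with (Rpower t (g - 1) * (Rpower (1 + t) p * Rpower (1 + t) (g + 1) * exp (- c * t))) by ring.
  apply Rmult_le_compat_l; lra.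
Qed.

Lemma ex_Int0inf_power_exp {V0 : CompleteNormedModule R_AbsRing}
  (f : R -> CompleteNormedModule.NormedModule R_AbsRing V0) K g p c :
  0 < g -> 0 < c -> 0 <= K -> loc_int f ->
  (forall t, 0 < t -> norm (f t) <= K * (Rpower t (g - 1) * Rpower (1 + t) p * exp (- c * t))) ->
  exists l, is_Int0inf f l.
Proof.
  intros Hg Hc HK Hf H.
  destruct (gamma_integrand_le g p c Hg Hc) as [K' [HK' H']].
  destruct (is_Int0inf_dominated f
    (fun t => K * K' * (Rpower t (g - 1) / Rpower (1 + t) (g + 1))) (K * K' * / g)) as [l [Hl _]].
  - easy.
  - intros t Ht; eapply Rle_trans; [now apply H|].
    rewrite (Rmult_assoc K K'); apply Rmult_le_compat_l; auto.
  - now apply is_Int0infR_scal, is_Int0inf_beta.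
  - now exists l.
Qed.

Lemma continuous_power_exp a c t :
  0 < t -> continuous (fun t => Rpower t a * exp (- c * t)) t.
Proof.
  intros Ht; apply (continuous_mult (fun t => Rpower t a) (fun t => exp (- c * t)));
    [now apply continuous_Rpower|apply continuous_exp_lin].
Qed.

Lemma ex_Gamma_integral g c :
  0 < g -> 0 < c -> exists l, is_Int0infR (fun t => Rpower t (g - 1) * exp (- c * t)) l.
Proof.
  intros Hg Hc.
  apply (ex_Int0inf_power_exp (V0 := R_CompleteNormedModule) _ 1 g 0 c); try lra.
  - apply (loc_int_continuous (V0 := R_CompleteNormedModule)); intros t Ht.
    now apply continuous_power_exp.
  - intros t Ht; unfold norm; simpl; unfold abs; simpl.
    rewrite Rpower_O by lra; rewrite Rmult_1_r, Rmult_1_l; apply Req_le, Rabs_pos_eq.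
    apply Rmult_le_pos; left; apply exp_pos.
Qed.

Lemma is_Gamma g : 0 < g -> is_Int0infR (fun t => Rpower t (g - 1) * exp (- t)) (Gamma g).
Proof.
  intros Hg; destruct (ex_Gamma_integral g 1 Hg Rlt_0_1) as [l Hl].
  assert (H : is_Int0infR (fun t => Rpower t (g - 1) * exp (- t)) l).
  { revert Hl; apply is_Int0infR_ext; intros t _; do 2 f_equal; ring. }
  unfold Gamma; now rewrite (Int0inf_unique (V0 := R_CompleteNormedModule) _ _ H).
Qed.

Lemma RInt_le_Int0infR (f : R -> R) (l a b : R) :
  (forall t, 0 < t -> 0 <= f t) -> is_Int0infR f l -> 0 < a -> a <= b -> RInt f a b <= l.
Proof.
  intros Hf H Ha Hab.
  assert (L := is_Int0inf_loc (V0 := R_CompleteNormedModule) f l H).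
  apply le_epsilon; intros e He.
  destruct (proj1 (is_Int0inf_RInt (V0 := R_CompleteNormedModule) f l L) H e He) as [d [N [Hd H']]].
  set (a' := Rmin a (d / 2)); set (b' := Rmax b (N + 1)).
  assert (a' <= a) by apply Rmin_l; assert (a' <= d / 2) by apply Rmin_r.
  assert (b <= b') by apply Rmax_l; assert (N + 1 <= b') by apply Rmax_r.
  assert (0 < a') by (apply Rmin_glb_lt; lra).
  specialize (H' a' b' ltac:(lra) ltac:(lra) ltac:(lra)).
  assert (K := RInt_norm_extend (V0 := R_CompleteNormedModule) f f a' a b b' L L
    ltac:(intros t Ht; apply Req_le, Rabs_pos_eq; auto) ltac:(lra) ltac:(lra) ltac:(lra) ltac:(lra)).
  assert (K2 := norm_ge_0 (minus (RInt f a' b' : R_NormedModule) (RInt f a b))).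
  unfold norm, minus, plus, opp in H'; simpl in H'; unfold abs in H'; simpl in H'.
  assert (K3 := Rle_trans _ _ _ K2 K); apply Rabs_def2 in H'; lra.
Qed.

Lemma Gamma_pos g : 0 < g -> 0 < Gamma g.
Proof.
  intros Hg; apply Rlt_le_trans with (RInt (fun t => Rpower t (g - 1) * exp (- t)) 1 2).
  - apply RInt_gt_0; [lra| |].
    + intros t Ht; apply Rmult_lt_0_compat; apply exp_pos.
    + intros t Ht; apply (continuous_ext (fun t => Rpower t (g - 1) * exp (- 1 * t))).
      * intros x; do 2 f_equal; ring.
      * apply continuous_power_exp; lra.
  - apply RInt_le_Int0infR; [|now apply is_Gamma|lra|lra].
    intros t Ht; apply Rmult_le_pos; left; apply exp_pos.
Qed.

Lemma power_exp_lim_0 g c :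
  0 < g -> 0 < c -> filterlim (fun t => Rpower t g * exp (- c * t)) (at_right 0) (locally 0).
Proof.
  intros Hg Hc; apply (filterlim_zero_at_0 (V := R_NormedModule) _ 1 g); try lra.
  intros t Ht; unfold norm; simpl; unfold abs; simpl.
  rewrite Rabs_pos_eq by (apply Rmult_le_pos; left; apply exp_pos).
  rewrite (Rmult_comm 1); apply Rmult_le_compat_l; [left; apply exp_pos|].
  rewrite <- exp_0; apply exp_le; nra.
Qed.

Lemma power_exp_decay g c :
  0 < c -> exists K, 0 < K /\ forall t, 0 < t -> 1 <= t ->
  Rpower t g * exp (- c * t) <= K * exp (- (c / 2) * t).
Proof.
  intros Hc; destruct (exp_absorbs_power (Rmax g 0) (c / 2) ltac:(lra)) as [K [HK H]].
  exists K; split; [easy|]; intros t Ht Ht1.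
  replace (- c * t) with (- (c / 2) * t + - (c / 2) * t) by field.
  rewrite exp_plus, <- Rmult_assoc; apply Rmult_le_compat_r; [left; apply exp_pos|].
  eapply Rle_trans; [|apply (H t); lra].
  apply Rmult_le_compat_r; [left; apply exp_pos|].
  apply Rle_trans with (Rpower t (Rmax g 0)).
  - apply Rle_Rpower; [lra|apply Rmax_l].
  - apply Rpower_le_base; [apply Rmax_r|lra|lra].
Qed.

Lemma power_exp_lim_infty g c :
  0 < c -> is_lim (fun t => Rpower t g * exp (- c * t)) p_infty 0.
Proof.
  intros Hc; destruct (power_exp_decay g c Hc) as [K [HK H]].
  apply (filterlim_zero_at_infty (V := R_NormedModule) _ (fun t => K * exp (- (c / 2) * t))).
  - intros t Ht; unfold norm; simpl; unfold abs; simpl.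
    rewrite Rabs_pos_eq by (apply Rmult_le_pos; left; apply exp_pos); apply H; lra.
  - apply is_lim_exp_decay; lra.
Qed.

(** The function [g t^(g-1) e^(-t) - t^g e^(-t)] is the derivative of [t^g e^(-t)], which vanishes
    at both ends. *)
Lemma Gamma_succ g : 0 < g -> Gamma (g + 1) = g * Gamma g.
Proof.
  intros Hg.
  assert (H : is_Int0infR (fun t => g * (Rpower t (g - 1) * exp (- t))
                                    - Rpower t (g + 1 - 1) * exp (- t)) (g * Gamma g - Gamma (g + 1))).
  { apply is_Int0infR_minus; [apply is_Int0infR_scal|]; apply is_Gamma; lra. }
  assert (H' : is_Int0infR (fun t => g * (Rpower t (g - 1) * exp (- t))
                                    - Rpower t (g + 1 - 1) * exp (- t)) (0 - 0)).
  { apply (is_Int0infR_derive (fun t => Rpower t g * exp (- 1 * t))).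
    - intros t Ht.
      replace (g * (Rpower t (g - 1) * exp (- t)) - Rpower t (g + 1 - 1) * exp (- t))
        with (plus (mult (g * Rpower t (g - 1)) (exp (- 1 * t)))
                   (mult (Rpower t g) (- 1 * exp (- 1 * t)))).
      + apply (is_derive_mult (fun t => Rpower t g) (fun t => exp (- 1 * t))).
        * now apply is_derive_Rpower.
        * apply is_derive_exp_lin.
        * exact Rmult_comm.
      + unfold plus, mult; simpl.
        replace (g + 1 - 1) with g by ring; replace (- 1 * t) with (- t) by ring; ring.
    - intros t Ht.
      apply (continuous_ext (fun t => g * (Rpower t (g - 1) * exp (- 1 * t))
                                    - Rpower t (g + 1 - 1) * exp (- 1 * t))).
      { intros x; now replace (- 1 * x) with (- x) by ring. }
      apply (continuous_minus (V := R_NormedModule)).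
      + apply (continuous_scal_r (V := R_NormedModule) g); now apply continuous_power_exp.
      + now apply continuous_power_exp.
    - exact (power_exp_lim_0 g 1 Hg Rlt_0_1).
    - exact (power_exp_lim_infty g 1 Rlt_0_1). }
  assert (E := is_Int0infR_inj _ _ _ H H'); lra.
Qed.

Lemma is_Int0inf_exp c : 0 < c -> is_Int0infR (fun t => exp (- c * t)) (/ c).
Proof.
  intros Hc; replace (/ c) with (0 - - / c * exp (- c * 0))
    by (rewrite Rmult_0_r, exp_0; ring).
  apply (is_Int0infR_derive (fun t => - / c * exp (- c * t))).
  - intros t Ht; auto_derive; [easy|field; lra].
  - intros t Ht; apply continuous_exp_lin.
  - apply (filterlim_at_right_0_continuous (V := R_NormedModule) (fun t => - / c * exp (- c * t))).
    apply (continuous_scal_r (V := R_NormedModule) (- / c)), continuous_exp_lin.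
  - apply (is_lim_exp_decay (- / c) c Hc).
Qed.

Lemma Gamma_1 : Gamma 1 = 1.
Proof.
  apply (is_Int0infR_inj (fun t => Rpower t (1 - 1) * exp (- t))); [apply is_Gamma; lra|].
  assert (H := is_Int0inf_exp 1 Rlt_0_1); rewrite Rinv_1 in H; revert H; apply is_Int0infR_ext.
  intros t Ht; rewrite Rminus_diag, Rpower_O by easy.
  rewrite Rmult_1_l; f_equal; ring.
Qed.

(** A linear substitution carried out on proper integrals, the thresholds near 0 and infinity being
    rescaled by [c]. *)
Lemma is_Gamma_scaled g c :
  0 < g -> 0 < c -> is_Int0infR (fun t => Rpower t (g - 1) * exp (- c * t)) (Gamma g / Rpower c g).
Proof.
  intros Hg Hc; destruct (ex_Gamma_integral g c Hg Hc) as [l Hl].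
  assert (E : Gamma g = Rpower c g * l).
  { apply (is_Int0infR_inj (fun t => Rpower t (g - 1) * exp (- t))); [now apply is_Gamma|].
    apply (is_Int0inf_iff (V0 := R_CompleteNormedModule)); intros e He.
    apply (is_Int0infR_scal (Rpower c g)) in Hl.
    destruct (proj1 (is_Int0inf_iff (V0 := R_CompleteNormedModule) _ _) Hl e He) as [d [N [Hd H]]].
    exists (c * d), (c * Rmax N 0); split; [now apply Rmult_lt_0_compat|]; intros a b Ha Hb.
    assert (h1 := Rmax_l N 0); assert (h2 := Rmax_r N 0).
    assert (Hb' : Rmax N 0 < / c * b).
    { apply (Rmult_lt_reg_l c); [easy|]; rewrite <- Rmult_assoc, Rinv_r by lra; lra. }
    assert (0 < b) by (assert (0 <= c * Rmax N 0) by (apply Rmult_le_pos; lra); lra).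
    assert (0 < / c) by now apply Rinv_0_lt_compat.
    destruct (H (/ c * a) (/ c * b)) as [J [HJ HJl]]; [|lra|].
    { split; [apply Rmult_lt_0_compat; lra|].
      apply (Rmult_lt_reg_l c); [easy|]; rewrite <- Rmult_assoc, Rinv_r by lra; lra. }
    exists J; split; [|easy].
    rewrite <- (Rplus_0_r (/ c * a)), <- (Rplus_0_r (/ c * b)) in HJ.
    apply (is_RInt_comp_lin (V := R_NormedModule)) in HJ; revert HJ.
    apply (is_RInt_ext (V := R_NormedModule)); intros x Hx.
    assert (0 < Rmin a b) by (apply Rmin_glb_lt; lra).
    unfold scal; simpl; unfold mult; simpl.
    rewrite Rplus_0_r, <- Rpower_mult_distr, Rpower_inv, (Rpower_pred c g) by lra.
    replace (- c * (/ c * x)) with (- x) by (field; lra).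
    field; split; [apply Rgt_not_eq, exp_pos|lra]. }
  revert Hl; rewrite E; intros Hl; unfold Rdiv.
  rewrite (Rmult_comm (Rpower c g)), Rmult_assoc, Rinv_r, Rmult_1_r; [easy|].
  apply Rgt_not_eq, exp_pos.
Qed.

(** * Laguerre polynomials *)

Ltac eqR := match goal with |- @eq _ ?a ?b => change (@eq R a b) end.

Lemma falling_succ a m : falling (a + 1) (S m) = (a + 1) * falling a m.
Proof.
  induction m as [|m IH]; [simpl; ring|].
  change (falling (a + 1) (S (S m))) with (falling (a + 1) (S m) * (a + 1 - INR (S m))).
  rewrite IH, S_INR; simpl; ring.
Qed.

Lemma gbinom_pascal a m : gbinom (a + 1) (S m) = gbinom a (S m) + gbinom a m.
Proof.
  unfold gbinom; rewrite falling_succ.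
  change (falling a (S m)) with (falling a m * (a - INR m)).
  change (fact (S m)) with (S m * fact m)%nat; rewrite mult_INR, S_INR.
  assert (h := pos_INR m); field; split; [apply INR_fact_neq_0|lra].
Qed.

Lemma gbinom_absorb a m : (INR m + 1) * gbinom (a + 1) (S m) = (a + 1) * gbinom a m.
Proof.
  unfold gbinom; rewrite falling_succ.
  change (fact (S m)) with (S m * fact m)%nat; rewrite mult_INR, S_INR.
  assert (h := pos_INR m); field; split; [apply INR_fact_neq_0|lra].
Qed.

Lemma gbinom_absorb_top a m : (a + 1 - INR m) * gbinom (a + 1) m = (a + 1) * gbinom a m.
Proof.
  unfold gbinom; assert (H := falling_succ a m).
  change (falling (a + 1) (S m)) with (falling (a + 1) m * (a + 1 - INR m)) in H.
  unfold Rdiv; rewrite <- !Rmult_assoc, <- H; ring.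
Qed.

Definition peval (c : nat -> R) (n : nat) (t : R) : R := sum_f_R0 (fun k => c k * t ^ k) n.

Lemma peval_extend c n N t :
  (n <= N)%nat -> (forall k, (n < k)%nat -> c k = 0) -> peval c N t = peval c n t.
Proof.
  intros H Hc; induction H as [|N H IH]; [easy|].
  unfold peval in *; simpl; rewrite IH, Hc by lia; ring.
Qed.

Lemma peval_plus c d n t : peval c n t + peval d n t = peval (fun k => c k + d k) n t.
Proof. unfold peval; rewrite <- sum_plus; apply sum_eq; intros; ring. Qed.

Lemma peval_scal r c n t : r * peval c n t = peval (fun k => r * c k) n t.
Proof. unfold peval; rewrite scal_sum; apply sum_eq; intros; ring. Qed.

Lemma peval_ext c d n t : (forall k, (k <= n)%nat -> c k = d k) -> peval c n t = peval d n t.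
Proof. intros H; unfold peval; apply sum_eq; intros; now rewrite H. Qed.

Lemma peval_shift c n t :
  t * peval c n t = peval (fun k => match k with O => 0 | S j => c j end) (S n) t.
Proof.
  unfold peval; rewrite (decomp_sum _ (S n) ltac:(lia)); simpl pred.
  rewrite scal_sum, Rmult_0_l, Rplus_0_l; apply sum_eq; intros; simpl; ring.
Qed.

Lemma is_derive_peval c n t :
  is_derive (peval c (S n)) t (peval (fun k => (INR k + 1) * c (S k)) n t).
Proof.
  induction n as [|n IH].
  - unfold peval; simpl; auto_derive; [easy|ring].
  - apply (is_derive_ext (fun t => peval c (S n) t + c (S (S n)) * t ^ (S (S n)))); [easy|].
    change (peval (fun k => (INR k + 1) * c (S k)) (S n) t)
      with (plus (peval (fun k => (INR k + 1) * c (S k)) n t)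
                 ((INR (S n) + 1) * c (S (S n)) * t ^ S n)).
    apply (is_derive_plus (V := R_NormedModule)); [exact IH|].
    auto_derive; [easy|]; change (pred (S (S n))) with (S n).
    change (match n with O => 1 | S _ => INR n + 1 end) with (INR (S n)); simpl pow; ring.
Qed.

(** Extended by zero above the degree, so that polynomials of different degrees can be compared
    coefficient by coefficient at a common length. *)
Definition lagc (n : nat) (a : R) (k : nat) : R :=
  if le_dec k n then (-1) ^ k * gbinom (INR n + a) (n - k) / INR (fact k) else 0.

Lemma lagc_gt n a k : (n < k)%nat -> lagc n a k = 0.
Proof. intros H; unfold lagc; destruct (le_dec k n); [lia|easy]. Qed.

Lemma lagc_le n a k : (k <= n)%nat -> lagc n a k = (-1) ^ k * gbinom (INR n + a) (n - k) / INR (fact k).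
Proof. intros H; unfold lagc; destruct (le_dec k n); [easy|lia]. Qed.

Lemma Laguerre_peval n a t N : (n <= N)%nat -> Laguerre n a t = peval (lagc n a) N t.
Proof.
  intros H; rewrite (peval_extend _ n) by (auto using lagc_gt).
  unfold Laguerre, peval; apply sum_eq; intros k Hk; rewrite lagc_le by easy.
  field; apply INR_fact_neq_0.
Qed.

Lemma Laguerre_0 a t : Laguerre 0 a t = 1.
Proof. unfold Laguerre, gbinom; simpl; field. Qed.

Lemma is_derive_Laguerre_succ n a t :
  is_derive (Laguerre (S n) a) t (- Laguerre n (a + 1) t).
Proof.
  apply (is_derive_ext (peval (lagc (S n) a) (S n))).
  { intros x; now rewrite (Laguerre_peval (S n) a x (S n)). }
  replace (- Laguerre n (a + 1) t) with (peval (fun k => (INR k + 1) * lagc (S n) a (S k)) n t);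
    [apply is_derive_peval|].
  rewrite (Laguerre_peval n (a + 1) t n) by lia.
  replace (- peval (lagc n (a + 1)) n t) with (-1 * peval (lagc n (a + 1)) n t) by ring.
  rewrite peval_scal; apply peval_ext; intros k Hk; rewrite !lagc_le by lia.
  rewrite S_INR; replace (INR n + 1 + a) with (INR n + (a + 1)) by ring.
  change (fact (S k)) with (S k * fact k)%nat; rewrite mult_INR, S_INR; simpl pow; simpl Nat.sub.
  assert (h := pos_INR k); field; split; [apply INR_fact_neq_0|lra].
Qed.

Lemma is_derive_Laguerre_0 a t : is_derive (Laguerre 0 a) t 0.
Proof.
  apply (is_derive_ext (fun _ => 1)); [intros; now rewrite Laguerre_0|].
  apply (is_derive_const (V := R_NormedModule)).
Qed.

Lemma continuous_Laguerre n a t : continuous (Laguerre n a) t.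
Proof.
  apply (ex_derive_continuous (V := R_NormedModule)); destruct n as [|n]; eexists;
    [apply is_derive_Laguerre_0|apply is_derive_Laguerre_succ].
Qed.

Lemma Laguerre_param_succ n a t :
  Laguerre (S n) (a + 1) t = Laguerre (S n) a t + Laguerre n (a + 1) t.
Proof.
  rewrite !(Laguerre_peval _ _ t (S n)) by lia.
  rewrite peval_plus; apply peval_ext; intros k Hk.
  rewrite !(lagc_le (S n)) by lia.
  replace (INR (S n) + (a + 1)) with (INR (S n) + a + 1) by ring.
  destruct (Nat.eq_dec k (S n)) as [->|Hk'].
  - rewrite lagc_gt by lia; rewrite Nat.sub_diag; unfold gbinom; simpl falling.
    field; split; apply INR_fact_neq_0.
  - rewrite lagc_le by lia.
    replace (S n - k)%nat with (S (n - k)) by lia.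
    replace (INR n + (a + 1)) with (INR (S n) + a) by (rewrite S_INR; ring).
    rewrite gbinom_pascal; field; apply INR_fact_neq_0.
Qed.

Lemma Laguerre_step n a t :
  (INR n + 1) * Laguerre (S n) a t = (INR n + a + 1) * Laguerre n a t - t * Laguerre n (a + 1) t.
Proof.
  rewrite !(Laguerre_peval (S n) _ t (S n)), (Laguerre_peval n a t (S n)),
    (Laguerre_peval n (a + 1) t n) by lia.
  rewrite peval_shift.
  match goal with |- _ = _ - ?p => replace (_ - p) with ((INR n + a + 1) * peval (lagc n a) (S n) t + -1 * p) by ring end.
  rewrite !peval_scal, peval_plus; apply peval_ext; intros k Hk.
  rewrite (lagc_le (S n)) by easy.
  replace (INR (S n) + a) with (INR n + a + 1) by (rewrite S_INR; ring).
  destruct k as [|j].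
  - rewrite lagc_le, !Nat.sub_0_r by lia; simpl pow; simpl fact.
    assert (H := gbinom_absorb (INR n + a) n); simpl INR; lra.
  - rewrite (lagc_le n (a + 1)) by lia.
    replace (INR n + (a + 1)) with (INR n + a + 1) by ring.
    replace (S n - S j)%nat with (n - j)%nat by lia.
    change (fact (S j)) with (S j * fact j)%nat; rewrite mult_INR, S_INR.
    assert (h := pos_INR j).
    destruct (Nat.eq_dec j n) as [->|Hj].
    + rewrite lagc_gt by lia; rewrite Nat.sub_diag; unfold gbinom; simpl.
      field; split; [apply INR_fact_neq_0|lra].
    + rewrite lagc_le by lia.
      change (fact (S j)) with (S j * fact j)%nat; rewrite mult_INR, S_INR.
      assert (H := gbinom_absorb (INR n + a) (n - S j)).
      replace (S (n - S j)) with (n - j)%nat in H by lia.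
      rewrite minus_INR, S_INR in H by lia.
      replace (INR n - (INR j + 1) + 1) with (INR n - INR j) in H by ring.
      set (u := gbinom (INR n + a) (n - S j)) in *; set (v := gbinom (INR n + a + 1) (n - j)) in *.
      transitivity ((-1) ^ S j * ((INR n + a + 1) * u) / ((INR j + 1) * INR (fact j))
        + -1 * ((-1) ^ j * v / INR (fact j))).
      * rewrite <- H; simpl pow; field; split; [apply INR_fact_neq_0|lra].
      * field; split; [apply INR_fact_neq_0|lra].
Qed.

Lemma ex_derive_Laguerre n a t : ex_derive (Laguerre n a) t.
Proof.
  destruct n as [|n]; eexists; [apply is_derive_Laguerre_0|apply is_derive_Laguerre_succ].
Qed.

(** The operator [t d/dt] multiplies the coefficient of [t^k] by [k], and [(a + 1 + k) binom(n + a +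
    1, n - k) = (n + a + 1) binom(n + a, n - k)]. *)
Lemma Laguerre_euler n a t :
  (INR n + a + 1) * Laguerre n a t
  = (a + 1) * Laguerre n (a + 1) t + t * Derive (Laguerre n (a + 1)) t.
Proof.
  replace (Derive (Laguerre n (a + 1)) t)
    with (peval (fun k => (INR k + 1) * lagc n (a + 1) (S k)) n t).
  2: { symmetry; apply is_derive_unique.
       apply (is_derive_ext (peval (lagc n (a + 1)) (S n))).
       - intros x; symmetry; apply Laguerre_peval; lia.
       - apply is_derive_peval. }
  rewrite peval_shift, !(Laguerre_peval n _ t (S n)) by lia.
  rewrite !peval_scal, peval_plus; apply peval_ext; intros k Hk.
  replace (match k with O => 0 | S j => (INR j + 1) * lagc n (a + 1) (S j) end)
    with (INR k * lagc n (a + 1) k) by (destruct k; [simpl; ring|now rewrite S_INR]).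
  destruct (le_dec k n) as [Hkn|Hkn]; [|rewrite !lagc_gt by lia; ring].
  rewrite !lagc_le by easy.
  assert (H := gbinom_absorb_top (INR n + a) (n - k)); rewrite minus_INR in H by easy.
  replace (INR n + (a + 1)) with (INR n + a + 1) by ring.
  transitivity ((-1) ^ k * ((INR n + a + 1) * gbinom (INR n + a) (n - k)) / INR (fact k)).
  - field; apply INR_fact_neq_0.
  - rewrite <- H; field; apply INR_fact_neq_0.
Qed.

(** One step of Rodrigues' formula, obtained by combining [Laguerre_euler] with [Laguerre_step]. It
    drives the proof of orthogonality. *)
Lemma is_derive_weighted_Laguerre n b t : 0 < t ->
  is_derive (fun t => Rpower t (b + 1) * exp (- t) * Laguerre n (b + 1) t) t
    ((INR n + 1) * (Rpower t b * exp (- t) * Laguerre (S n) b t)).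
Proof.
  intros Ht.
  assert (H : is_derive (fun t => Rpower t (b + 1) * exp (- t) * Laguerre n (b + 1) t) t
    (((b + 1) * Rpower t (b + 1 - 1) * exp (- t) + Rpower t (b + 1) * (- exp (- t)))
       * Laguerre n (b + 1) t
     + Rpower t (b + 1) * exp (- t) * Derive (Laguerre n (b + 1)) t)).
  { apply (is_derive_mult (fun t => Rpower t (b + 1) * exp (- t)) (Laguerre n (b + 1)));
      [|apply Derive_correct, ex_derive_Laguerre|exact Rmult_comm].
    apply (is_derive_mult (fun t => Rpower t (b + 1)) (fun t => exp (- t)));
      [now apply is_derive_Rpower| |exact Rmult_comm].
    auto_derive; [easy|ring]. }
  refine (eq_ind _ (is_derive _ t) H _ _); eqR.
  assert (H1 := Laguerre_step n b t); assert (H2 := Laguerre_euler n b t).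
  rewrite Rpower_succ by easy; replace (b + 1 - 1) with b by ring.
  transitivity (Rpower t b * exp (- t) * ((INR n + 1) * Laguerre (S n) b t)); [|ring].
  rewrite H1, H2; ring.
Qed.

Lemma Laguerre_bound n a : exists C, 0 < C /\ forall t, 0 <= t -> Rabs (Laguerre n a t) <= C * (1 + t) ^ n.
Proof.
  assert (H : forall c N, exists C, 0 < C /\ forall t, 0 <= t -> Rabs (peval c N t) <= C * (1 + t) ^ N).
  { intros c; induction N as [|N [C [HC IH]]].
    - exists (Rabs (c O) + 1); split; [assert (h := Rabs_pos (c O)); lra|].
      intros t Ht; unfold peval; simpl; rewrite !Rmult_1_r; lra.
    - exists (C + Rabs (c (S N))); split; [assert (h := Rabs_pos (c (S N))); lra|].
      intros t Ht; change (peval c (S N) t) with (peval c N t + c (S N) * t ^ S N).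
      eapply Rle_trans; [apply Rabs_triang|]; rewrite Rmult_plus_distr_r.
      apply Rplus_le_compat.
      + eapply Rle_trans; [now apply IH|]; apply Rmult_le_compat_l; [lra|].
        apply Rle_pow; [lra|lia].
      + rewrite Rabs_mult; apply Rmult_le_compat_l; [apply Rabs_pos|].
        rewrite Rabs_pos_eq by (now apply pow_le); apply pow_incr; lra. }
  destruct (H (lagc n a) n) as [C [HC HH]]; exists C; split; [easy|]; intros t Ht.
  rewrite (Laguerre_peval n a t n) by lia; auto.
Qed.

(** The factor [n! / Gamma (n + a + 1)] is exactly what turns the weighted relation [Laguerre_step]
    into a pure difference. *)
Lemma ell_succ n a t : -1 < a -> 0 < t -> ell (S n) a t = ell n a t - ell n (a + 1) t.
Proof.
  intros Ha Ht; unfold ell.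
  assert (h := pos_INR n).
  rewrite S_INR, Rpower_succ by easy.
  replace (INR n + 1 + a + 1) with (INR n + a + 1 + 1) by ring.
  replace (INR n + (a + 1) + 1) with (INR n + a + 1 + 1) by ring.
  rewrite Gamma_succ by lra.
  assert (hG := Gamma_pos (INR n + a + 1) ltac:(lra)).
  change (fact (S n)) with (S n * fact n)%nat; rewrite mult_INR, S_INR.
  transitivity (INR (fact n) / ((INR n + a + 1) * Gamma (INR n + a + 1)) * Rpower t a * exp (- t)
    * ((INR n + 1) * Laguerre (S n) a t)); [field; lra|].
  rewrite Laguerre_step; field; lra.
Qed.

Lemma phi_succ n a t : 0 < t -> phi (S n) a t = phi n a t - phi n (a + 1) t.
Proof.
  intros Ht; unfold phi; rewrite S_INR.
  replace (INR n + 1 + a + 1) with (INR n + a + 1 + 1) by ring.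
  replace (INR n + (a + 1) + 1) with (INR n + a + 1 + 1) by ring.
  rewrite Rpower_succ by lra; simpl pow.
  field; repeat split; first [lra | apply Rgt_not_eq, exp_pos].
Qed.

(** Lets a factor [1 + t] on the orbit be exchanged for one unit of the parameter; this is how the
    expansion of the resolvent at parameter [a + 1] acquires the coefficients belonging to [a]. *)
Lemma phi_lower n a t : 0 < t -> phi n (a + 1) t * (1 + t) = phi n a t.
Proof.
  intros Ht; unfold phi; replace (INR n + (a + 1) + 1) with (INR n + a + 1 + 1) by ring.
  rewrite Rpower_succ by lra; field; repeat split; first [lra | apply Rgt_not_eq, exp_pos].
Qed.

(** * The semigroup and its generator *)

Section Derivative.
Context {V : NormedModule R_AbsRing}.

Lemma locally_R_iff (x : R) (P : R -> Prop) :
  locally x P <-> exists d, 0 < d /\ forall y, Rabs (y - x) < d -> P y.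
Proof.
  split.
  - intros [d Hd]; exists d; split; [apply cond_pos|exact Hd].
  - intros [d [Hd H]]; exists (mkposreal d Hd); exact H.
Qed.

Lemma is_derive_eps (f : R -> V) (t : R) (l : V) :
  is_derive f t l <->
  forall e, 0 < e -> exists d, 0 < d /\ forall s, Rabs (s - t) < d ->
    norm (minus (minus (f s) (f t)) (scal (s - t) l)) <= e * Rabs (s - t).
Proof.
  split.
  - intros [_ H] e He.
    specialize (H t (fun P HP => HP) (mkposreal e He)).
    apply locally_R_iff in H; exact H.
  - intros H; split; [apply is_linear_scal_l|].
    intros x Hx [e He].
    assert (E : t = x) by (apply (is_filter_lim_locally_unique t x), Hx); subst x.
    apply locally_R_iff; exact (H e He).
Qed.

Lemma continuous_eps (f : R -> V) (t : R) :
  continuous f t <->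
  forall e, 0 < e -> exists d, 0 < d /\ forall s, Rabs (s - t) < d -> norm (minus (f s) (f t)) < e.
Proof.
  unfold continuous; split.
  - intros H e He; apply locally_R_iff.
    exact (proj1 (filterlim_norm_eps (locally t) f (f t)) H e He).
  - intros H; apply (filterlim_norm_eps (locally t)); intros e He.
    now apply locally_R_iff, H.
Qed.

End Derivative.

Section ByParts.
Context {V0 : CompleteNormedModule R_AbsRing}.
Local Notation V := (CompleteNormedModule.NormedModule R_AbsRing V0).

Lemma is_Int0inf_by_parts (k k' : R -> R) (g g' : R -> V) (l0 l1 : V) :
  (forall t, 0 < t -> is_derive k t (k' t)) ->
  (forall t, 0 < t -> is_derive g t (g' t)) ->
  (forall t, 0 < t -> continuous k' t) ->
  (forall t, 0 < t -> continuous g' t) ->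
  filterlim (fun t => scal (k t) (g t)) (at_right 0) (locally l0) ->
  filterlim (fun t => scal (k t) (g t)) (Rbar_locally p_infty) (locally l1) ->
  is_Int0inf (fun t => plus (scal (k' t) (g t)) (scal (k t) (g' t))) (minus l1 l0).
Proof.
  intros Hk Hg Hk' Hg' H0 H1; apply is_Int0inf_iff; intros e He.
  assert (G0 := proj1 (filterlim_norm_eps (V := V) (at_right 0) _ l0) H0 (e / 2) ltac:(lra)).
  assert (G1 := proj1 (filterlim_norm_eps (V := V) (Rbar_locally p_infty) _ l1) H1 (e / 2) ltac:(lra)).
  apply at_right_0_iff in G0; destruct G0 as [d [Hd0 G0]]; destruct G1 as [N G1].
  exists d, (Rmax N d); split; [easy|]; intros a b Ha Hb.
  assert (h1 := Rmax_l N d); assert (h2 := Rmax_r N d).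
  exists (minus (scal (k b) (g b)) (scal (k a) (g a))); split.
  - apply (is_RInt_scal_derive (V := V0)); intros x; rewrite Rmin_left by lra; intros Hx;
      [apply Hk|apply Hg|apply Hk'|apply Hg']; lra.
  - norm_as (minus (minus (scal (k b) (g b)) l1) (minus (scal (k a) (g a)) l0)).
    eapply Rle_lt_trans; [apply norm_triangle|]; rewrite norm_opp.
    specialize (G0 a Ha); specialize (G1 b ltac:(lra)); lra.
Qed.

Lemma is_Int0inf_scal_l (k : R -> R) (l : R) (c : V) :
  is_Int0infR k l -> is_Int0inf (fun t => scal (k t) c) (scal l c).
Proof.
  apply (linmap_is_Int0inf (V0 := R_CompleteNormedModule) (W0 := V0)
    (fun r : R => scal r c) (norm c)).
  - intros x y; apply (scal_distr_r x y c).
  - intros x y; exact (eq_sym (scal_assoc x y c)).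
  - intros x; rewrite Rmult_comm; apply norm_scal_le.
Qed.

End ByParts.

Section Semigroup.
Context {X0 : CompleteNormedModule R_AbsRing}.
Local Notation X := (CompleteNormedModule.NormedModule R_AbsRing X0).
Variables (T : R -> X -> X) (M : R).
Hypothesis HT : bounded_C0_semigroup (X := X0) T M.

Lemma T_plus t x y : 0 <= t -> T t (plus x y) = plus (T t x) (T t y).
Proof. intros Ht; now apply (proj1 HT). Qed.

Lemma T_scal t (a : R) x : 0 <= t -> T t (scal a x) = scal a (T t x).
Proof. intros Ht; now apply (proj1 (proj2 HT)). Qed.

Lemma T_norm t x : 0 <= t -> norm (T t x) <= Rabs M * norm x.
Proof.
  intros Ht; eapply Rle_trans; [now apply (proj1 (proj2 (proj2 HT)))|].
  apply Rmult_le_compat_r; [apply norm_ge_0|apply Rle_abs].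
Qed.

Lemma T_0 x : T 0 x = x.
Proof. now apply (proj1 (proj2 (proj2 (proj2 HT)))). Qed.

Lemma T_add t s x : 0 <= t -> 0 <= s -> T (t + s) x = T t (T s x).
Proof. intros Ht Hs; now apply (proj1 (proj2 (proj2 (proj2 (proj2 HT))))). Qed.

Lemma T_minus t x y : 0 <= t -> T t (minus x y) = minus (T t x) (T t y).
Proof.
  intros Ht; apply (linmap_minus (V := X) (W := X) (T t)).
  - intros; now apply T_plus.
  - intros; now apply T_scal.
Qed.

Lemma T_lim_0 x e : 0 < e -> exists d, 0 < d /\ forall h, 0 <= h < d -> norm (minus (T h x) x) < e.
Proof.
  intros He.
  assert (H := proj2 (proj2 (proj2 (proj2 (proj2 HT)))) x).
  assert (G := proj1 (filterlim_norm_eps (V := X) (at_right 0) _ x) H e He).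
  apply at_right_0_iff in G; destruct G as [d [Hd G]].
  exists d; split; [easy|]; intros h [[Hh|Hh] Hhd]; [now apply G|].
  subst h; rewrite T_0; norm_as (zero : X).
  eapply Rle_lt_trans; [apply Req_le, norm_zero|easy].
Qed.

(** Frozen at [x] for negative times: the orbit is then continuous on the whole line, and its
    integral from 0 has a two-sided derivative at 0. *)
Definition orbit (x : X) (s : R) : X := T (Rmax 0 s) x.

Lemma orbit_pos x s : 0 <= s -> orbit x s = T s x.
Proof. intros Hs; unfold orbit; now rewrite Rmax_right. Qed.

(** Left and right continuity together: for [a <= b] the semigroup law bounds the increment from [a]
    to [b] by a constant times the norm of [T (b - a) x - x]. *)
Lemma continuous_orbit x s : continuous (orbit x) s.
Proof.
  apply continuous_eps; intros e He.
  assert (HM : 0 < Rabs M + 1) by (assert (h := Rabs_pos M); lra).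
  destruct (T_lim_0 x (e / (Rabs M + 1))) as [d [Hd H]].
  { apply Rdiv_lt_0_compat; lra. }
  exists d; split; [easy|].
  assert (K : forall a b, 0 <= a -> a <= b -> b - a < d -> norm (minus (T b x) (T a x)) < e).
  { intros a b Ha Hab Hd'.
    replace b with (a + (b - a)) by ring; rewrite T_add, <- T_minus by lra.
    eapply Rle_lt_trans; [apply T_norm; lra|].
    specialize (H (b - a) ltac:(lra)).
    apply (Rmult_lt_compat_l (Rabs M + 1)) in H; [|easy].
    replace ((Rabs M + 1) * (e / (Rabs M + 1))) with e in H by (field; lra).
    assert (h := norm_ge_0 (minus (T (b - a) x) x)); lra. }
  intros t Ht; unfold orbit; apply Rabs_def2 in Ht.
  assert (h1 := Rmax_l 0 s); assert (h2 := Rmax_l 0 t).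
  assert (Hmax : Rabs (Rmax 0 t - Rmax 0 s) < d).
  { unfold Rmax; destruct (Rle_dec 0 t), (Rle_dec 0 s); apply Rabs_def1; lra. }
  apply Rabs_def2 in Hmax.
  destruct (Rle_dec (Rmax 0 s) (Rmax 0 t)).
  - apply K; lra.
  - rewrite norm_minus_sym; apply K; lra.
Qed.

Lemma continuous_T x t : 0 < t -> continuous (fun s => T s x) t.
Proof.
  intros Ht; apply (continuous_ext_loc _ (orbit x)); [|apply continuous_orbit].
  apply locally_R_iff; exists t; split; [easy|]; intros y Hy; apply Rabs_def2 in Hy.
  apply orbit_pos; lra.
Qed.

(** The difference quotient of [gen] multiplied out: [T h x - x + h y = o(h)]. This form is linear
    in the pair [(x, y)] and can be pushed through [T r]. *)
Definition gen_eps (x y : X) : Prop :=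
  forall e, 0 < e -> exists d, 0 < d /\ forall h, 0 < h < d ->
    norm (plus (minus (T h x) x) (scal h y)) <= e * h.

Lemma gen_iff (x y : X) : gen (X := X0) T x y <-> gen_eps x y.
Proof.
  assert (E : forall h, 0 < h ->
    norm (minus (scal (/ h) (minus (T h x) x)) (opp y)) =
    / h * norm (plus (minus (T h x) x) (scal h y))).
  { intros h Hh.
    replace (minus (scal (/ h) (minus (T h x) x)) (opp y))
      with (scal (/ h) (plus (minus (T h x) x) (scal h y))) by (lincomb; field; lra).
    rewrite norm_scal_R.
    rewrite Rabs_pos_eq; [easy|left; now apply Rinv_0_lt_compat]. }
  split.
  - intros H e He.
    assert (G := proj1 (filterlim_norm_eps (V := X) (at_right 0) _ (opp y)) H e He).
    apply at_right_0_iff in G; destruct G as [d [Hd G]].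
    exists d; split; [easy|]; intros h Hh; specialize (G h Hh).
    nm; rewrite (E h) in G by lra.
    apply (Rmult_lt_compat_l h) in G; [|lra].
    rewrite <- Rmult_assoc, Rinv_r in G; lra.
  - intros H; apply (filterlim_norm_eps (V := X) (at_right 0)); intros e He.
    apply at_right_0_iff; destruct (H (e / 2) ltac:(lra)) as [d [Hd G]].
    exists d; split; [easy|]; intros h Hh; specialize (G h Hh).
    nm; rewrite (E h) by lra.
    apply Rmult_lt_reg_l with h; [lra|].
    rewrite <- Rmult_assoc, Rinv_r; nra.
Qed.

(** To the right of [t] the remainder is [T t] applied to the remainder of [gen_eps]. To the left it
    is [T s] applied to it, and then [T s y] has to be replaced by [T t y], which uses continuity of
    the orbit of [y]; hence two errors [e / 2]. *)
Lemma is_derive_T x y t : gen_eps x y -> 0 < t -> is_derive (fun s => T s x) t (opp (T t y)).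
Proof.
  intros Hg Ht; apply is_derive_eps; intros e He.
  assert (HM : 0 < Rabs M + 1) by (assert (h := Rabs_pos M); lra).
  destruct (Hg (e / (2 * (Rabs M + 1)))) as [d [Hd H]].
  { apply Rdiv_lt_0_compat; lra. }
  destruct (proj1 (continuous_eps _ t) (continuous_T y t Ht) (e / 2)) as [d' [Hd' H']]; [lra|].
  exists (Rmin t (Rmin d d')); split; [repeat apply Rmin_glb_lt; lra|].
  intros s Hs.
  assert (h1 := Rmin_l t (Rmin d d')); assert (h2 := Rmin_r t (Rmin d d')).
  assert (h3 := Rmin_l d d'); assert (h4 := Rmin_r d d').
  assert (B : forall h r, 0 < h < d -> 0 <= r ->
    norm (T r (plus (minus (T h x) x) (scal h y))) <= e / 2 * h).
  { intros h r Hh Hr; eapply Rle_trans; [now apply T_norm|].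
    apply Rle_trans with ((Rabs M + 1) * (e / (2 * (Rabs M + 1)) * h)).
    - apply Rmult_le_compat; [apply Rabs_pos|apply norm_ge_0|lra|now apply H].
    - right; field; lra. }
  destruct (Rtotal_order s t) as [h|[h|h]].
  - rewrite Rabs_left in Hs |- * by lra.
    specialize (B (t - s) s ltac:(lra) ltac:(lra)).
    rewrite T_plus, T_minus, T_scal, <- T_add in B by lra.
    replace (s + (t - s)) with t in B by ring.
    norm_as (plus (opp (plus (minus (T t x) (T s x)) (scal (t - s) (T s y))))
      (scal (t - s) (minus (T s y) (T t y)))).
    eapply Rle_trans; [apply norm_triangle|]; rewrite norm_opp.
    specialize (H' s ltac:(rewrite Rabs_left; lra)).
    assert (K := norm_scal_le (t - s) (minus (T s y) (T t y))).
    rewrite Rabs_pos_eq in K by lra.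
    assert (K' : (t - s) * norm (minus (T s y) (T t y)) <= (t - s) * (e / 2))
      by (apply Rmult_le_compat_l; [lra|left; exact H']).
    nm; lra.
  - subst s; rewrite Rminus_diag, Rabs_R0, Rmult_0_r.
    norm_as (zero : X); apply Req_le, norm_zero.
  - rewrite Rabs_pos_eq in Hs |- * by lra.
    specialize (B (s - t) t ltac:(lra) ltac:(lra)).
    rewrite T_plus, T_minus, T_scal, <- T_add in B by lra.
    replace (t + (s - t)) with s in B by ring.
    norm_as (plus (minus (T s x) (T t x)) (scal (s - t) (T t y))).
    nra.
Qed.

Definition orbit_int (x : X) (s : R) : X := RInt (orbit x) 0 s.

Lemma is_RInt_orbit x a b : is_RInt (orbit x) a b (RInt (orbit x) a b).
Proof. apply (RInt_correct (V := X0)), ex_RInt_continuous; intros; apply continuous_orbit. Qed.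

Lemma is_derive_orbit_int x s : is_derive (orbit_int x) s (orbit x s).
Proof.
  apply (is_derive_RInt _ _ 0); [|apply continuous_orbit].
  apply locally_R_iff; exists 1; split; [lra|]; intros; apply is_RInt_orbit.
Qed.

Lemma T_orbit_int x h s : 0 <= h -> 0 <= s ->
  T h (orbit_int x s) = minus (orbit_int x (s + h)) (orbit_int x h).
Proof.
  intros Hh Hs.
  assert (H1 : is_RInt (fun r => T h (orbit x r)) 0 s (T h (orbit_int x s))).
  { apply (linmap_is_RInt (V := X) (W := X) (T h) (Rabs M)); [| | |apply is_RInt_orbit].
    - intros; now apply T_plus.
    - intros; now apply T_scal.
    - intros; now apply T_norm. }
  assert (H2 : is_RInt (fun r => T h (orbit x r)) 0 s (RInt (orbit x) (1 * 0 + h) (1 * s + h))).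
  { apply (is_RInt_ext (fun r => scal 1 (orbit x (1 * r + h)))).
    - intros r; rewrite Rmin_left by easy; intros Hr.
      rewrite !orbit_pos, Rmult_1_l, (Rplus_comm r), T_add by lra.
      exact (scal_one (T h (T r x))).
    - apply is_RInt_comp_lin, is_RInt_orbit. }
  rewrite <- (is_RInt_unique (V := X0) _ _ _ _ H1), (is_RInt_unique (V := X0) _ _ _ _ H2).
  rewrite Rmult_0_r, Rplus_0_l, Rmult_1_l; unfold orbit_int.
  rewrite <- (RInt_Chasles (V := X0) (orbit x) 0 h (s + h));
    [|eexists; apply is_RInt_orbit|eexists; apply is_RInt_orbit].
  nm; module_eq.
Qed.

Lemma norm_orbit_int x s : 0 <= s -> norm (orbit_int x s) <= Rabs M * norm x * s.
Proof.
  intros Hs.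
  apply (norm_RInt_le (orbit x) (fun _ => Rabs M * norm x) 0 s); [easy| |apply is_RInt_orbit|].
  - intros r Hr; rewrite orbit_pos by lra; apply T_norm; lra.
  - replace (Rabs M * norm x * s) with (scal (s - 0) (Rabs M * norm x)).
    + apply (is_RInt_const (V := R_NormedModule)).
    + unfold scal; simpl; unfold mult; simpl; ring.
Qed.

Lemma loc_int_scal_T (k : R -> R) x :
  (forall t, 0 < t -> continuous k t) -> loc_int (V0 := X0) (fun t => scal (k t) (T t x)).
Proof.
  intros Hk; apply (loc_int_continuous (V0 := X0)); intros t Ht.
  apply (continuous_scal k (fun t => T t x)); [now apply Hk|now apply continuous_T].
Qed.

(* With [u s] the integral of the orbit over [[0, s]], integration by parts rewrites [w] as minus
   the integral of [k' u]; the increments of [u] reproduce orbits, so that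
   [(T h w - w) / h] is an integral of [k'] against [T s (u h / h)]. *)
Lemma gen_integral (k k' kb : R -> R) (k0 kappa C c : R) x (w v : X) :
  (forall t, 0 < t -> is_derive k t (k' t)) ->
  (forall t, 0 < t -> continuous k' t) ->
  filterlim k (at_right 0) (locally k0) ->
  0 < c -> (forall t, 1 < t -> Rabs (k t) * t <= C * exp (- c * t)) ->
  (forall t, 0 < t -> Rabs (k' t) <= kb t) -> is_Int0infR kb kappa ->
  is_Int0inf (fun t => scal (k t) (T t x)) w ->
  is_Int0inf (fun t => scal (k' t) (T t x)) v ->
  gen_eps w (plus (scal k0 x) v).
Proof.
  intros Hk Hk' Hk0 Hc Hinf Hkb Hkappa Hw Hv.
  set (u := orbit_int x).
  assert (Hkl : is_lim k p_infty 0).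
  { apply (filterlim_zero_at_infty (V := R_NormedModule) k (fun t => C * exp (- c * t)));
      [|now apply is_lim_exp_decay].
    intros t Ht; eapply Rle_trans; [|now apply Hinf].
    unfold norm; simpl; unfold abs; simpl; assert (h := Rabs_pos (k t)); nra. }
  assert (Hu : is_Int0inf (fun t => scal (k' t) (u t)) (opp w)).
  { assert (H : is_Int0inf (fun t => plus (scal (k' t) (u t)) (scal (k t) (orbit x t)))
                 (minus (zero : X) zero)).
    { apply is_Int0inf_by_parts; [easy| |easy| | |].
      - intros t _; apply is_derive_orbit_int.
      - intros t _; apply continuous_orbit.
      - apply (filterlim_norm_eps (V := X) (at_right 0)); intros e He.
        assert (H1 := proj1 (filterlim_norm_eps (V := R_NormedModule) (at_right 0) k k0) Hk0 1 Rlt_0_1).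
        apply at_right_0_iff in H1; destruct H1 as [d1 [Hd1 H1]].
        set (B := (Rabs k0 + 1) * (Rabs M * norm x) + 1).
        assert (HB : 0 < B).
        { unfold B; assert (h1 := Rabs_pos k0); assert (h2 := Rabs_pos M); assert (h3 := norm_ge_0 x).
          assert (0 <= (Rabs k0 + 1) * (Rabs M * norm x)); [|lra].
          apply Rmult_le_pos; [lra|now apply Rmult_le_pos]. }
        apply at_right_0_iff; exists (Rmin d1 (e / B)); split.
        { apply Rmin_glb_lt; [easy|now apply Rdiv_lt_0_compat]. }
        intros t [Ht1 Ht2].
        assert (h1 := Rmin_l d1 (e / B)); assert (h2 := Rmin_r d1 (e / B)).
        norm_as (scal (k t) (u t)).
        eapply Rle_lt_trans; [apply norm_scal_le|].
        specialize (H1 t ltac:(lra)).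
        assert (Hkt : Rabs (k t) <= Rabs k0 + 1).
        { assert (K := Rabs_triang_inv (k t) k0).
          unfold norm, minus, plus, opp in H1; simpl in H1; unfold abs in H1; simpl in H1.
          unfold Rminus in K; lra. }
        apply Rle_lt_trans with ((Rabs k0 + 1) * (Rabs M * norm x * t)).
        + apply Rmult_le_compat; [apply Rabs_pos|apply norm_ge_0|easy|].
          apply norm_orbit_int; lra.
        + apply Rle_lt_trans with ((B - 1) * t); [unfold B; right; ring|].
          apply Rlt_le_trans with (B * (e / B)); [|right; field; lra].
          apply Rlt_trans with (B * t); [lra|]; apply Rmult_lt_compat_l; lra.
      - apply (filterlim_zero_at_infty (V := X) _ (fun t => Rabs M * norm x * C * exp (- c * t)));
          [|now apply is_lim_exp_decay].
        intros t Ht; eapply Rle_trans; [apply norm_scal_le|].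
        specialize (Hinf t Ht).
        apply Rle_trans with (Rabs (k t) * (Rabs M * norm x * t)).
        + apply Rmult_le_compat_l; [apply Rabs_pos|apply norm_orbit_int; lra].
        + replace (Rabs (k t) * (Rabs M * norm x * t)) with (Rabs M * norm x * (Rabs (k t) * t)) by ring.
          rewrite (Rmult_assoc (Rabs M * norm x)); apply Rmult_le_compat_l; [|easy].
          apply Rmult_le_pos; [apply Rabs_pos|apply norm_ge_0]. }
    replace (opp w) with (minus (minus zero zero) w) by module_eq.
    apply (is_Int0inf_ext (fun t => minus (plus (scal (k' t) (u t)) (scal (k t) (orbit x t)))
                                          (scal (k t) (T t x)))).
    - intros t Ht; rewrite orbit_pos by lra; module_eq.
    - now apply is_Int0inf_minus. }
  assert (Hk'int : is_Int0infR k' (0 - k0)) by now apply (is_Int0infR_derive k).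
  (* The left side is the integral of [k'] against [T s z] with [z = u h / h - x], and [z] tends to
     0. Since [k] vanishes at infinity, [k'] has integral [- k0], which produces the term in
     [u h]. *)
  assert (key : forall h, 0 < h ->
    norm (minus (minus (scal (/ h) (minus w (T h w))) (scal (k0 / h) (u h))) v)
      <= kappa * (Rabs M * norm (minus (scal (/ h) (u h)) x))).
  { intros h Hh; set (z := minus (scal (/ h) (u h)) x).
    assert (HQ : is_Int0inf (fun t => scal (k' t) (T t z))
       (minus (minus (scal (/ h) (minus w (T h w))) (scal (k0 / h) (u h))) v)).
    { assert (HTu : is_Int0inf (fun t => T h (scal (k' t) (u t))) (T h (opp w))).
      { apply (linmap_is_Int0inf (V0 := X0) (W0 := X0) (T h) (Rabs M)); [| | |exact Hu].
        - intros; apply T_plus; lra.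
        - intros; apply T_scal; lra.
        - intros; apply T_norm; lra. }
      assert (HI := is_Int0inf_minus _ _ _ _
        (is_Int0inf_scal _ (/ h) _
          (is_Int0inf_plus _ _ _ _ (is_Int0inf_minus _ _ _ _ HTu Hu)
            (is_Int0inf_scal_l k' _ (u h) Hk'int))) Hv).
      cbv beta in HI.
      replace (T h (opp w)) with (opp (T h w)) in HI.
      2: { replace (opp w) with (scal (-1) w) by module_eq.
           rewrite T_scal by lra; module_eq. }
      match type of HI with is_Int0inf _ ?l =>
        replace (minus (minus (scal (/ h) (minus w (T h w))) (scal (k0 / h) (u h))) v) with l
          by (lincomb; field; lra) end.
      revert HI; apply is_Int0inf_ext; intros t Ht.
      unfold z; rewrite T_minus, !T_scal by lra.
      unfold u; rewrite !T_orbit_int by lra.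
      rewrite (Rplus_comm h t); module_eq. }
    destruct (is_Int0inf_dominated (V0 := X0) (fun t => scal (k' t) (T t z))
      (fun t => Rabs M * norm z * kb t) (Rabs M * norm z * kappa)) as [l [Hl Hn]].
    - now apply loc_int_scal_T.
    - intros t Ht; eapply Rle_trans; [apply norm_scal_le|]; rewrite Rmult_comm.
      apply Rmult_le_compat; [apply norm_ge_0|apply Rabs_pos|apply T_norm; lra|now apply Hkb].
    - now apply is_Int0infR_scal.
    - rewrite (is_Int0inf_inj (V0 := X0) _ _ _ HQ Hl); lra. }
  intros e He.
  (* The total factor of [h * norm z] in the final estimate, increased by 1 to make it positive. *)
  set (B := Rabs kappa * Rabs M + Rabs k0 + 1).
  assert (HB : 0 < B).
  { unfold B; assert (h1 := Rabs_pos k0); assert (h2 := Rmult_le_pos _ _ (Rabs_pos kappa) (Rabs_pos M)); lra. }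
  destruct (proj1 (is_derive_eps _ 0 _) (is_derive_orbit_int x 0) (e / B)) as [d [Hd H]].
  { now apply Rdiv_lt_0_compat. }
  exists d; split; [easy|]; intros h Hh.
  specialize (H h ltac:(rewrite Rabs_pos_eq; lra)).
  rewrite Rminus_0_r, Rabs_pos_eq in H by lra.
  assert (Hu0 : u 0 = zero) by apply (RInt_point (V := X0)).
  unfold u in Hu0; rewrite Hu0, orbit_pos, T_0 in H by lra; fold u in H.
  set (z := minus (scal (/ h) (u h)) x).
  assert (Hz : h * norm z <= e / B * h).
  { eapply Rle_trans; [|exact H]; right.
    rewrite <- (Rabs_pos_eq h) at 1 by lra.
    rewrite <- (norm_scal_R h z); f_equal; unfold z; lincomb; field; lra. }
  norm_as (plus (opp (scal h (minus (minus (scal (/ h) (minus w (T h w))) (scal (k0 / h) (u h))) v)))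
    (scal (- k0) (scal h (minus (scal (/ h) (u h)) x)))).
  fold z.
  eapply Rle_trans; [apply norm_triangle|].
  rewrite norm_opp, !norm_scal_R, Rabs_Ropp, (Rabs_pos_eq h) by lra.
  specialize (key h ltac:(lra)); fold z in key; nm.
  apply Rle_trans with (B * (h * norm z)).
  - apply Rle_trans with (h * (Rabs kappa * (Rabs M * norm z)) + Rabs k0 * (h * norm z)).
    + apply Rplus_le_compat_r, Rmult_le_compat_l; [lra|].
      eapply Rle_trans; [exact key|].
      apply Rmult_le_compat_r; [|apply Rle_abs].
      apply Rmult_le_pos; [apply Rabs_pos|apply norm_ge_0].
    + assert (0 <= h * norm z) by (apply Rmult_le_pos; [lra|apply norm_ge_0]).
      unfold B; nra.
  - apply (Rmult_le_compat_l B) in Hz; [|lra].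
    replace (B * (e / B * h)) with (e * h) in Hz by (field; lra); exact Hz.
Qed.

End Semigroup.

(** The kernel of [Res T g 1], with [- (1) * t] kept unsimplified so that it unfolds to the
    integrand of [Res]. *)
Definition gdens (g t : R) : R := Rpower t (g - 1) * exp (- (1) * t) / Gamma g.

Lemma continuous_gdens g t : 0 < t -> continuous (gdens g) t.
Proof.
  intros Ht; unfold gdens, Rdiv.
  apply (continuous_scal_l (V := R_NormedModule) (fun t => Rpower t (g - 1) * exp (- (1) * t))).
  now apply continuous_power_exp.
Qed.

Lemma gdens_pos g t : 0 < g -> 0 < gdens g t.
Proof.
  intros Hg; apply Rdiv_lt_0_compat; [|now apply Gamma_pos].
  apply Rmult_lt_0_compat; apply exp_pos.
Qed.

Lemma is_Int0inf_gdens g : 0 < g -> is_Int0infR (gdens g) 1.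
Proof.
  intros Hg; assert (h := Gamma_pos g Hg).
  replace 1 with (/ Gamma g * (Gamma g / Rpower 1 g)) by (rewrite Rpower_1_base; field; lra).
  apply (is_Int0infR_ext (fun t => / Gamma g * (Rpower t (g - 1) * exp (- (1) * t)))).
  - intros t _; unfold gdens; field; lra.
  - apply is_Int0infR_scal, is_Gamma_scaled; lra.
Qed.

Lemma is_derive_gdens g t :
  0 < g -> 0 < t -> is_derive (gdens (g + 1)) t (gdens g t - gdens (g + 1) t).
Proof.
  intros Hg Ht; assert (h := Gamma_pos g Hg); unfold gdens.
  apply (is_derive_ext (fun t => / Gamma (g + 1) * (Rpower t g * exp (- (1) * t)))).
  { intros s; unfold Rdiv; replace (g + 1 - 1) with g by ring; apply Rmult_comm. }
  assert (H : is_derive (fun t => / Gamma (g + 1) * (Rpower t g * exp (- (1) * t))) t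
    (/ Gamma (g + 1) * (g * Rpower t (g - 1) * exp (- (1) * t)
       + Rpower t g * (- (1) * exp (- (1) * t))))).
  { apply (is_derive_scal (fun t => Rpower t g * exp (- (1) * t))).
    apply (is_derive_mult (fun t => Rpower t g) (fun t => exp (- (1) * t)));
      [now apply is_derive_Rpower|apply is_derive_exp_lin|exact Rmult_comm]. }
  refine (eq_ind _ (is_derive _ t) H _ _); eqR.
  rewrite Gamma_succ by easy; replace (g + 1 - 1) with g by ring; field; lra.
Qed.

Lemma gdens_decay g : 0 < g ->
  exists C, 0 < C /\ forall t, 1 < t -> Rabs (gdens g t) * t <= C * exp (- / 2 * t).
Proof.
  intros Hg; assert (h := Gamma_pos g Hg).
  destruct (power_exp_decay g 1 Rlt_0_1) as [K [HK H]].
  exists (K / Gamma g); split; [now apply Rdiv_lt_0_compat|]; intros t Ht.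
  rewrite Rabs_pos_eq by (left; now apply gdens_pos).
  specialize (H t ltac:(lra) ltac:(lra)); rewrite (Rpower_pred t g) in H by lra.
  unfold gdens; replace (- / 2 * t) with (- (1 / 2) * t) by field.
  replace (Rpower t (g - 1) * exp (- (1) * t) / Gamma g * t)
    with (Rpower t (g - 1) * t * exp (- (1) * t) / Gamma g) by (field; lra).
  replace (K / Gamma g * exp (- (1 / 2) * t)) with (K * exp (- (1 / 2) * t) / Gamma g) by (field; lra).
  apply Rmult_le_compat_r; [left; now apply Rinv_0_lt_compat|exact H].
Qed.

Lemma gdens_lim_0 g : 0 < g -> filterlim (gdens (g + 1)) (at_right 0) (locally 0).
Proof.
  intros Hg; assert (h := Gamma_pos (g + 1) ltac:(lra)).
  assert (hi : 0 < / Gamma (g + 1)) by now apply Rinv_0_lt_compat.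
  apply (filterlim_zero_at_0 (V := R_NormedModule) _ (/ Gamma (g + 1)) g); [easy|lra|].
  intros t Ht; unfold norm; simpl; unfold abs; simpl.
  rewrite Rabs_pos_eq by (left; apply gdens_pos; lra).
  unfold gdens; replace (g + 1 - 1) with g by ring; unfold Rdiv; rewrite Rmult_comm.
  apply Rmult_le_compat_l; [lra|].
  rewrite <- (Rmult_1_r (Rpower t g)) at 2; apply Rmult_le_compat_l; [left; apply exp_pos|].
  apply exp_le_1; lra.
Qed.

Lemma gdens_1 t : 0 < t -> gdens 1 t = exp (- (1) * t).
Proof. intros Ht; unfold gdens; rewrite Rminus_diag, Rpower_O, Gamma_1 by easy; field. Qed.

(** * Fractional powers of the resolvent *)

Section Resolvent.
Context {X0 : CompleteNormedModule R_AbsRing}.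
Local Notation X := (CompleteNormedModule.NormedModule R_AbsRing X0).
Variables (T : R -> X -> X) (M : R).
Hypothesis HT : bounded_C0_semigroup (X := X0) T M.

Local Notation gen_eps := (gen_eps T).

Lemma is_Res g lam x : 0 < g -> 0 < lam ->
  is_Int0inf (fun t => scal (Rpower t (g - 1) * exp (- lam * t) / Gamma g) (T t x))
    (Res (X := X0) T g lam x).
Proof.
  intros Hg Hl; assert (h := Gamma_pos g Hg).
  assert (hi : 0 < / Gamma g) by now apply Rinv_0_lt_compat.
  destruct (ex_Int0inf_power_exp (V0 := X0)
    (fun t => scal (Rpower t (g - 1) * exp (- lam * t) / Gamma g) (T t x))
    (/ Gamma g * (Rabs M * norm x)) g 0 lam) as [l Hl'].
  - easy.
  - easy.
  - apply Rmult_le_pos; [lra|]; apply Rmult_le_pos; [apply Rabs_pos|apply norm_ge_0].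
  - apply (loc_int_scal_T T M HT); intros t Ht.
    apply (continuous_scal_l (V := R_NormedModule) (fun t => Rpower t (g - 1) * exp (- lam * t))).
    now apply continuous_power_exp.
  - intros t Ht; rewrite norm_scal_R, Rpower_O by lra.
    assert (hp : 0 < Rpower t (g - 1) * exp (- lam * t)) by (apply Rmult_lt_0_compat; apply exp_pos).
    rewrite Rabs_pos_eq by (left; now apply Rdiv_lt_0_compat).
    assert (K := T_norm T M HT t x ltac:(lra)).
    replace (/ Gamma g * (Rabs M * norm x) * (Rpower t (g - 1) * 1 * exp (- lam * t)))
      with (Rpower t (g - 1) * exp (- lam * t) / Gamma g * (Rabs M * norm x)) by (field; lra).
    apply Rmult_le_compat_l; [left; now apply Rdiv_lt_0_compat|exact K].
  - exact (eq_ind _ (is_Int0inf _) Hl' _ (eq_sym (Int0inf_unique (V0 := X0) _ _ Hl'))).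
Qed.

Local Notation Rs g x := (Res (X := X0) T g 1 x : X).

Lemma is_Res1 g x : 0 < g -> is_Int0inf (fun t => scal (gdens g t) (T t x)) (Rs g x).
Proof. intros Hg; apply is_Res; lra. Qed.

Lemma Res_minus g x y : 0 < g -> Rs g (minus x y) = minus (Rs g x) (Rs g y).
Proof.
  intros Hg; apply (is_Int0inf_inj (V0 := X0) (fun t => scal (gdens g t) (T t (minus x y))));
    [now apply is_Res1|].
  apply (is_Int0inf_ext (fun t => minus (scal (gdens g t) (T t x)) (scal (gdens g t) (T t y)))).
  - intros t Ht; rewrite (T_minus T M HT) by lra; module_eq.
  - apply is_Int0inf_minus; now apply is_Res1.
Qed.

Lemma gen_eps_minus x y x' y' : gen_eps x y -> gen_eps x' y' -> gen_eps (minus x x') (minus y y').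
Proof.
  intros H H' e He.
  destruct (H (e / 2) ltac:(lra)) as [d [Hd G]]; destruct (H' (e / 2) ltac:(lra)) as [d' [Hd' G']].
  exists (Rmin d d'); split; [now apply Rmin_glb_lt|]; intros h Hh.
  assert (h1 := Rmin_l d d'); assert (h2 := Rmin_r d d').
  specialize (G h ltac:(lra)); specialize (G' h ltac:(lra)).
  rewrite (T_minus T M HT) by lra.
  norm_as (plus (plus (minus (T h x) x) (scal h y))
    (opp (plus (minus (T h x') x') (scal h y')))).
  eapply Rle_trans; [apply norm_triangle|]; rewrite norm_opp; nm; lra.
Qed.

Lemma gen_Res g x : 0 < g -> gen_eps (Rs (g + 1) x) (minus (Rs g x) (Rs (g + 1) x)).
Proof.
  intros Hg; destruct (gdens_decay (g + 1) ltac:(lra)) as [C [HC HCt]].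
  replace (minus (Rs g x) (Rs (g + 1) x))
    with (plus (scal 0 x) (minus (Rs g x) (Rs (g + 1) x))) by module_eq.
  apply (gen_integral T M HT (gdens (g + 1)) (fun t => gdens g t - gdens (g + 1) t)
    (fun t => gdens g t + gdens (g + 1) t) 0 (1 + 1) C (/ 2)); try lra.
  - intros t Ht; now apply is_derive_gdens.
  - intros t Ht; apply (continuous_minus (V := R_NormedModule)); now apply continuous_gdens.
  - now apply gdens_lim_0.
  - exact HCt.
  - intros t Ht; assert (h1 := gdens_pos g t Hg); assert (h2 := gdens_pos (g + 1) t ltac:(lra)).
    apply Rabs_le; lra.
  - apply is_Int0infR_plus; apply is_Int0inf_gdens; lra.
  - apply is_Res1; lra.
  - apply (is_Int0inf_ext (V0 := X0) (fun t => minus (scal (gdens g t) (T t x)) (scal (gdens (g + 1) t) (T t x)))).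
    + intros t Ht; module_eq.
    + apply is_Int0inf_minus; apply is_Res1; lra.
Qed.

(** The limiting case of [gen_Res]: the kernel [e^(-t)] tends to 1 at 0 instead of vanishing, and
    this boundary value contributes the vector [x]. *)
Lemma gen_Res_one x : gen_eps (Rs 1 x) (minus x (Rs 1 x)).
Proof.
  assert (HE : is_Int0inf (fun t => scal (exp (- (1) * t)) (T t x)) (Rs 1 x)).
  { apply (is_Int0inf_ext (V0 := X0) (fun t => scal (gdens 1 t) (T t x))).
    - intros t Ht; now rewrite gdens_1.
    - apply is_Res1; lra. }
  destruct (power_exp_decay 1 1 Rlt_0_1) as [C [HC HCt]].
  replace (minus x (Rs 1 x)) with (plus (scal 1 x) (scal (- (1)) (Rs 1 x))) by module_eq.
  apply (gen_integral T M HT (fun t => exp (- (1) * t)) (fun t => - (1) * exp (- (1) * t))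
    (fun t => exp (- (1) * t)) 1 (/ 1) C (1 / 2)); try lra.
  - intros t Ht; apply is_derive_exp_lin.
  - intros t Ht; apply (continuous_scal_r (V := R_NormedModule)), continuous_exp_lin.
  - assert (H := filterlim_at_right_0_continuous (V := R_NormedModule) _ (continuous_exp_lin (- (1)) 0)).
    cbv beta in H; replace (exp (- (1) * 0)) with 1 in H by (rewrite Rmult_0_r, exp_0; easy); exact H.
  - intros t Ht; specialize (HCt t ltac:(lra) ltac:(lra)).
    rewrite Rabs_pos_eq by (left; apply exp_pos); rewrite Rpower_1 in HCt; lra.
  - intros t Ht; rewrite Rabs_mult, Rabs_Ropp, Rabs_R1, Rmult_1_l.
    apply Req_le, Rabs_pos_eq; left; apply exp_pos.
  - apply is_Int0inf_exp; lra.
  - exact HE.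
  - apply (is_Int0inf_ext (V0 := X0) (fun t => scal (- (1)) (scal (exp (- (1) * t)) (T t x)))).
    + intros t Ht; module_eq.
    + now apply is_Int0inf_scal.
Qed.

(** The derivative of [gdens (g + 1) t T(t) x] has integral zero, since its boundary values vanish.
    Here the generator falls on the orbit, and not on the resolvent as in [gen_Res]. *)
Lemma Res_domain g x y : 0 < g -> gen_eps x y -> Rs g x = Rs (g + 1) (plus x y).
Proof.
  intros Hg Hxy; destruct (gdens_decay (g + 1) ltac:(lra)) as [C [HC HCt]].
  assert (H1 : is_Int0inf (fun t => plus (scal (gdens g t - gdens (g + 1) t) (T t x))
                                         (scal (gdens (g + 1) t) (opp (T t y))))
                (minus (zero : X) zero)).
  { apply (is_Int0inf_by_parts (V0 := X0)).
    - intros t Ht; now apply is_derive_gdens.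
    - intros t Ht; now apply (is_derive_T T M HT).
    - intros t Ht; apply (continuous_minus (V := R_NormedModule)); now apply continuous_gdens.
    - intros t Ht; apply (continuous_opp (V := X)), (continuous_T T M HT); easy.
    - assert (h := Gamma_pos (g + 1) ltac:(lra)).
      assert (hi : 0 < / Gamma (g + 1)) by now apply Rinv_0_lt_compat.
      apply (filterlim_zero_at_0 (V := X) _ (/ Gamma (g + 1) * (Rabs M * norm x)) g); [easy| |].
      + apply Rmult_le_pos; [lra|]; apply Rmult_le_pos; [apply Rabs_pos|apply norm_ge_0].
      + intros t Ht; rewrite norm_scal_R, Rabs_pos_eq by (left; apply gdens_pos; lra).
        apply Rle_trans with (/ Gamma (g + 1) * Rpower t g * (Rabs M * norm x)); [|right; ring].
        apply Rmult_le_compat; [left; apply gdens_pos; lra|apply norm_ge_0| |apply (T_norm T M HT); lra].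
        unfold gdens; replace (g + 1 - 1) with g by ring; unfold Rdiv; rewrite Rmult_comm.
        apply Rmult_le_compat_l; [lra|].
        rewrite <- (Rmult_1_r (Rpower t g)) at 2; apply Rmult_le_compat_l; [left; apply exp_pos|].
        apply exp_le_1; lra.
    - apply (filterlim_zero_at_infty (V := X) _ (fun t => C * (Rabs M * norm x) * exp (- / 2 * t)));
        [|apply is_lim_exp_decay; lra].
      intros t Ht; rewrite norm_scal_R; specialize (HCt t Ht).
      apply Rle_trans with (C * exp (- / 2 * t) * (Rabs M * norm x)); [|right; ring].
      apply Rmult_le_compat; [apply Rabs_pos|apply norm_ge_0| |apply (T_norm T M HT); lra].
      assert (h := Rabs_pos (gdens (g + 1) t)); nra. }
  assert (H2 : is_Int0inf (fun t => plus (scal (gdens g t - gdens (g + 1) t) (T t x))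
                                         (scal (gdens (g + 1) t) (opp (T t y))))
                (minus (Rs g x) (Rs (g + 1) (plus x y)))).
  { apply (is_Int0inf_ext (V0 := X0) (fun t => minus (scal (gdens g t) (T t x))
                                               (scal (gdens (g + 1) t) (T t (plus x y))))).
    - intros t Ht; rewrite (T_plus T M HT) by lra; module_eq.
    - apply is_Int0inf_minus; apply is_Res1; lra. }
  assert (E := is_Int0inf_inj (V0 := X0) _ _ _ H1 H2).
  replace (Rs g x) with (plus (minus (Rs g x) (Rs (g + 1) (plus x y))) (Rs (g + 1) (plus x y)))
    by module_eq.
  rewrite <- E; module_eq.
Qed.

(** The one case needed of the exponent law, without a double integral: [Res_domain] at
    [z = (A+1)^(-1) x], where [z + A z = x]. *)
Lemma Res_Res_one g x : 0 < g -> Rs g (Rs 1 x) = Rs (g + 1) x.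
Proof.
  intros Hg; rewrite (Res_domain g _ _ Hg (gen_Res_one x)).
  replace (plus (Rs 1 x) (minus x (Rs 1 x))) with x by module_eq; easy.
Qed.

Lemma gen_eps_unique x y y' : gen_eps x y -> gen_eps x y' -> y = y'.
Proof.
  intros H H'; apply eq_of_norm_lt; intros e He.
  destruct (H (e / 3) ltac:(lra)) as [d [Hd G]]; destruct (H' (e / 3) ltac:(lra)) as [d' [Hd' G']].
  set (h := Rmin d d' / 2).
  assert (h1 := Rmin_l d d'); assert (h2 := Rmin_r d d').
  assert (h3 : 0 < Rmin d d') by now apply Rmin_glb_lt.
  assert (hh : 0 < h < Rmin d d') by (unfold h; lra).
  specialize (G h ltac:(lra)); specialize (G' h ltac:(lra)).
  apply Rmult_lt_reg_l with h; [lra|].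
  rewrite <- (Rabs_pos_eq h) at 1 by lra; rewrite <- norm_scal_R.
  norm_as (plus (plus (minus (T h x) x) (scal h y)) (opp (plus (minus (T h x) x) (scal h y')))).
  eapply Rle_lt_trans; [apply norm_triangle|]; rewrite norm_opp; nm; nra.
Qed.

Lemma Aop_eq x y : gen_eps x y -> Aop (X := X0) T x = y.
Proof.
  intros H; unfold Aop; apply gen_eps_unique with x; [|easy].
  apply (gen_iff T).
  apply (iota_correct (V := X0) (gen (X := X0) T x)); exists y; split; [now apply (gen_iff T)|].
  intros y' Hy'; apply gen_eps_unique with x; [easy|now apply (gen_iff T)].
Qed.

Lemma Vhalf_eq x : Vhalf (X := X0) T x = minus x (Rs 1 x).
Proof.
  unfold Vhalf, cogen; rewrite (Aop_eq _ _ (gen_Res_one x)); lincomb; field.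
Qed.

(* [lcoeff g n x] is [A^n (A+1)^(-n-g) x]. *)
Fixpoint lcoeff (g : R) (n : nat) (x : X) : X :=
  match n with
  | O => Rs g x
  | S m => minus (lcoeff g m x) (lcoeff (g + 1) m x)
  end.

(** Both sides carry the exponent [-n-g-1] of [A + 1] and differ by one factor [A]. The case [n = 0]
    is [gen_Res]; the differences that define [lcoeff] pass through [A] by linearity. *)
Lemma gen_lcoeff n x : forall g, 0 < g -> gen_eps (lcoeff (g + 1) n x) (lcoeff g (S n) x).
Proof.
  induction n as [|n IH]; intros g Hg; [now apply gen_Res|].
  change (gen_eps (minus (lcoeff (g + 1) n x) (lcoeff (g + 1 + 1) n x))
    (minus (lcoeff g (S n) x) (lcoeff (g + 1) (S n) x))).
  apply gen_eps_minus; apply IH; lra.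
Qed.

Lemma Apow_Res n x : forall g, 0 < g ->
  Apow (X := X0) T n (Res (X := X0) T (INR n + g) 1 x) (lcoeff g n x).
Proof.
  induction n as [|n IH]; intros g Hg.
  - simpl; now rewrite Rplus_0_l.
  - exists (lcoeff (g + 1) n x); split.
    + rewrite S_INR; replace (INR n + 1 + g) with (INR n + (g + 1)) by ring; apply IH; lra.
    + apply (gen_iff T); now apply gen_lcoeff.
Qed.

(** The outermost factor is [1 - (A+1)^(-1)], which turns [Res g] into [Res g] minus [Res (g + 1)]:
    the recursion of [lcoeff]. *)
Lemma Res_iter_Vhalf n x : forall g, 0 < g ->
  Res (X := X0) T g 1 (Nat.iter n (Vhalf (X := X0) T) x) = lcoeff g n x.
Proof.
  induction n as [|n IH]; intros g Hg; [easy|].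
  change (Nat.iter (S n) (Vhalf (X := X0) T) x)
    with (Vhalf (X := X0) T (Nat.iter n (Vhalf (X := X0) T) x)).
  rewrite Vhalf_eq, Res_minus, Res_Res_one by easy; simpl.
  rewrite <- !IH by lra; easy.
Qed.

Lemma is_Int0inf_ell_T n x : forall a, -1 < a ->
  is_Int0inf (fun t => scal (ell n a t) (T t x)) (lcoeff (a + 1) n x).
Proof.
  induction n as [|n IH]; intros a Ha.
  - apply (is_Int0inf_ext (V0 := X0) (fun t => scal (gdens (a + 1) t) (T t x)));
      [|apply is_Res1; lra].
    intros t Ht; f_equal; unfold ell, gdens; rewrite Laguerre_0; simpl INR; simpl fact.
    replace (0 + a + 1) with (a + 1) by ring; replace (a + 1 - 1) with a by ring.
    replace (- (1) * t) with (- t) by ring.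
    simpl INR; field; apply Rgt_not_eq, Gamma_pos; lra.
  - apply (is_Int0inf_ext (V0 := X0) (fun t => minus (scal (ell n a t) (T t x))
                                               (scal (ell n (a + 1) t) (T t x)))).
    + intros t Ht; rewrite ell_succ by easy; module_eq.
    + apply is_Int0inf_minus; apply IH; lra.
Qed.

(** The coefficients of [x] for [ell_n^a] are thus those of [x + A x] for [ell_n^(a+1)], which is
    the parameter and the vector of the integral representation of [T t x]. *)
Lemma lcoeff_domain n x y : gen_eps x y -> forall g, 0 < g -> lcoeff g n x = lcoeff (g + 1) n (plus x y).
Proof.
  intros H; induction n as [|n IH]; intros g Hg; simpl; [now apply Res_domain|].
  rewrite (IH g), (IH (g + 1)) by lra; easy.
Qed.

Lemma T_as_integral x y t : gen_eps x y -> 0 < t ->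
  is_Int0inf (step (V0 := X0) t (fun _ => zero) (fun s => scal (exp (t - s)) (T s (plus x y)))) (T t x).
Proof.
  intros H Ht.
  apply (is_Int0inf_step_zero (V0 := X0) t _
    (fun b => minus (T t x) (scal (exp (t - b)) (T b x)))); [easy| |].
  - intros b Hb.
    assert (Hp := is_RInt_scal_derive (V := X0) (fun s => - exp (t - s)) (fun s => T s x)
      (fun s => exp (t - s)) (fun s => opp (T s y)) t b).
    rewrite Rmin_left, Rmax_right in Hp by lra.
    assert (Hp' : is_RInt (fun s => plus (scal (exp (t - s)) (T s x)) (scal (- exp (t - s)) (opp (T s y))))
      t b (minus (scal (- exp (t - b)) (T b x)) (scal (- exp (t - t)) (T t x)))).
    { apply Hp; intros s Hs.
      - auto_derive; [easy|]; unfold Rminus; ring.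
      - apply (is_derive_T T M HT); [easy|lra].
      - apply (ex_derive_continuous (V := R_NormedModule)); auto_derive; easy.
      - apply (continuous_opp (V := X)), (continuous_T T M HT); lra. }
    replace (minus (T t x) (scal (exp (t - b)) (T b x)))
      with (minus (scal (- exp (t - b)) (T b x)) (scal (- exp (t - t)) (T t x)))
      by (rewrite Rminus_diag, exp_0; module_eq).
    revert Hp'; apply is_RInt_ext; rewrite Rmin_left by lra; intros s Hs.
    rewrite (T_plus T M HT) by lra; module_eq.
  - assert (Hz : filterlim (fun b => scal (exp (t - b)) (T b x)) (Rbar_locally p_infty) (locally (zero : X))).
    { apply (filterlim_zero_at_infty (V := X) _ (fun b => exp t * (Rabs M * norm x) * exp (- (1) * b)));
        [|apply is_lim_exp_decay; lra].
      intros b Hb; rewrite norm_scal_R, Rabs_pos_eq by (left; apply exp_pos).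
      replace (t - b) with (t + - (1) * b) by ring; rewrite exp_plus.
      replace (exp t * (Rabs M * norm x) * exp (- (1) * b))
        with (exp t * exp (- (1) * b) * (Rabs M * norm x)) by ring.
      apply Rmult_le_compat_l; [left; apply Rmult_lt_0_compat; apply exp_pos|].
      apply (T_norm T M HT); lra. }
    apply (filterlim_norm_eps (V := X) (Rbar_locally p_infty)); intros e He.
    generalize (proj1 (filterlim_norm_eps (V := X) (Rbar_locally p_infty) _ zero) Hz e He).
    apply filter_imp; intros b Hb.
    norm_as (opp (minus (scal (exp (t - b)) (T b x)) zero)); rewrite norm_opp; exact Hb.
Qed.

End Resolvent.

(** * Laplace transforms *)

Lemma exp_neg_lipschitz m x y : m <= x -> m <= y -> Rabs (exp (- x) - exp (- y)) <= Rabs (x - y) * exp (- m).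
Proof.
  assert (H : forall a b, m <= a -> a <= b -> Rabs (exp (- a) - exp (- b)) <= (b - a) * exp (- m)).
  { intros a b Ha Hab.
    assert (h1 : exp (- b) <= exp (- a)) by (apply exp_le; lra).
    assert (h2 : exp (- a) <= exp (- m)) by (apply exp_le; lra).
    rewrite Rabs_pos_eq by lra.
    assert (h3 : exp (- b) = exp (- a) * exp (- (b - a))) by (rewrite <- exp_plus; f_equal; ring).
    assert (h4 := exp_ineq1_le (- (b - a))); assert (h5 := exp_pos (- a)).
    apply Rle_trans with ((b - a) * exp (- a)); nra. }
  intros Hx Hy; destruct (Rle_dec x y) as [h|h].
  - rewrite (Rabs_minus_sym x y), (Rabs_pos_eq (y - x)) by lra; now apply H.
  - rewrite Rabs_minus_sym, (Rabs_pos_eq (x - y)) by lra; apply H; lra.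
Qed.

Lemma RInt_abs_const (f : R -> R) a b B :
  (forall t, Rmin a b <= t <= Rmax a b -> continuous f t) ->
  (forall t, Rmin a b <= t <= Rmax a b -> Rabs (f t) <= B) ->
  Rabs (RInt f a b) <= B * Rabs (b - a).
Proof.
  assert (H : forall a b, a <= b -> (forall t, a <= t <= b -> continuous f t) ->
    (forall t, a <= t <= b -> Rabs (f t) <= B) -> Rabs (RInt f a b) <= B * Rabs (b - a)).
  { intros x y Hxy Hc Hb; rewrite (Rabs_pos_eq (y - x)), Rmult_comm by lra.
    apply abs_RInt_le_const; [easy| |easy].
    apply (ex_RInt_continuous (V := R_CompleteNormedModule)).
    rewrite Rmin_left, Rmax_right by easy; exact Hc. }
  intros Hc Hb; destruct (Rle_dec a b) as [h|h].
  - rewrite Rmin_left, Rmax_right in Hc, Hb by easy; now apply H.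
  - rewrite Rmin_right, Rmax_left in Hc, Hb by lra.
    rewrite <- (opp_RInt_swap (V := R_CompleteNormedModule) f).
    + rewrite (Rabs_minus_sym b a); etransitivity; [apply Req_le, Rabs_Ropp|]; apply H; [lra|easy|easy].
    + apply (ex_RInt_continuous (V := R_CompleteNormedModule)).
      rewrite Rmin_left, Rmax_right by lra; exact Hc.
Qed.

(** Splits [x] as [x^th x^(1 - th)] and uses one bound on each factor. *)
Lemma min_le_interpolate x A B th :
  0 < A -> 0 < B -> 0 <= th <= 1 -> 0 <= x -> x <= A -> x <= B ->
  x <= Rpower A th * Rpower B (1 - th).
Proof.
  intros HA HB Hth [Hx|Hx] HxA HxB.
  - rewrite <- (Rpower_1 x Hx) at 1; replace 1 with (th + (1 - th)) at 1 by ring.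
    rewrite Rpower_plus; apply Rmult_le_compat; try (left; apply exp_pos);
      apply Rpower_le_base; lra.
  - subst x; left; apply Rmult_lt_0_compat; apply exp_pos.
Qed.

Lemma is_lim_power_tail s : 0 < s -> is_lim (fun v => Rpower (1 + v) (- s)) p_infty 0.
Proof.
  intros Hs; apply is_lim_spec; intros [e He]; simpl.
  exists (Rmax 0 (Rpower e (- / s))); intros v Hv.
  assert (h1 := Rmax_l 0 (Rpower e (- / s))); assert (h2 := Rmax_r 0 (Rpower e (- / s))).
  rewrite Rminus_0_r, Rabs_pos_eq, Rpower_Ropp by (left; apply exp_pos).
  apply Rlt_le_trans with (/ Rpower (Rpower e (- / s)) s).
  - apply Rinv_lt_contravar; [apply Rmult_lt_0_compat; apply exp_pos|].
    apply Rlt_Rpower_l; [lra|]; split; [apply exp_pos|lra].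
  - rewrite Rpower_mult; replace (- / s * s) with (- (1)) by (field; lra).
    rewrite Rpower_Ropp, Rinv_inv, Rpower_1 by easy; lra.
Qed.

Lemma is_Int0inf_power_tail s :
  1 < s -> is_Int0infR (fun v => Rpower (1 + v) (- s)) (/ (s - 1)).
Proof.
  intros Hs; replace (/ (s - 1)) with (0 - - / (s - 1) * Rpower (1 + 0) (1 - s))
    by (rewrite Rplus_0_r, Rpower_1_base; ring).
  assert (hp : 0 < / (s - 1)) by (apply Rinv_0_lt_compat; lra).
  apply (is_Int0infR_derive (fun v => - / (s - 1) * Rpower (1 + v) (1 - s))).
  - intros v Hv; unfold Rpower; auto_derive; [lra|].
    replace (- s * ln (1 + v)) with ((1 - s) * ln (1 + v) + - ln (1 + v)) by ring.
    rewrite exp_plus, exp_Ropp, exp_ln by lra; field; lra.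
  - intros v Hv; apply (ex_derive_continuous (V := R_NormedModule)); unfold Rpower; auto_derive; lra.
  - apply (filterlim_at_right_0_continuous (V := R_NormedModule)
      (fun v => - / (s - 1) * Rpower (1 + v) (1 - s))).
    apply (ex_derive_continuous (V := R_NormedModule)); unfold Rpower; auto_derive; lra.
  - apply (filterlim_ext (fun v => - / (s - 1) * Rpower (1 + v) (- (s - 1)))).
    { intros v; do 2 f_equal; ring. }
    assert (H := is_lim_scal_l _ (- / (s - 1)) _ _ (is_lim_power_tail (s - 1) ltac:(lra))).
    simpl in H; rewrite Rmult_0_r in H; exact H.
Qed.

Section Laplace.
Context {X0 : CompleteNormedModule R_AbsRing}.
Local Notation X := (CompleteNormedModule.NormedModule R_AbsRing X0).
Variables (g : R -> X) (K : R) (q : nat).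
Hypothesis Kpos : 0 < K.
Hypothesis gcont : forall v, 0 < v -> continuous g v.
Hypothesis gbound : forall v, 0 < v -> norm (g v) <= K * (1 + v) ^ q.

(** The degree [q] of the bound on [g] will be 0 for the orbit and 1 for [(1 + v) T(v) x]. *)
Definition laplace (t : R) : X := Int0inf (V := X0) (fun v => scal (exp (- t * v)) (g v)).

Lemma loc_int_scal_g (k : R -> R) :
  (forall v, 0 < v -> continuous k v) -> loc_int (V0 := X0) (fun v => scal (k v) (g v)).
Proof.
  intros Hk; apply (loc_int_continuous (V0 := X0)); intros t Ht.
  apply (continuous_scal k g); auto.
Qed.

Lemma Int0inf_g_exp (k : R -> R) B c :
  (forall v, 0 < v -> continuous k v) -> 0 < c -> 0 <= B ->
  (forall v, 0 < v -> Rabs (k v) <= B * exp (- c * v)) ->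
  exists l, is_Int0inf (fun v => scal (k v) (g v)) l.
Proof.
  intros Hk Hc HB H.
  apply (ex_Int0inf_power_exp (V0 := X0) _ (B * K) 1 (INR q) c); [lra|easy| | |].
  - apply Rmult_le_pos; lra.
  - now apply loc_int_scal_g.
  - intros v Hv; rewrite norm_scal_R, Rminus_diag, Rpower_O, Rpower_pow by lra.
    replace (B * K * (1 * (1 + v) ^ q * exp (- c * v)))
      with (B * exp (- c * v) * (K * (1 + v) ^ q)) by ring.
    apply Rmult_le_compat; [apply Rabs_pos|apply norm_ge_0|auto|auto].
Qed.

Lemma is_laplace t : 0 < t -> is_Int0inf (fun v => scal (exp (- t * v)) (g v)) (laplace t).
Proof.
  intros Ht.
  destruct (Int0inf_g_exp (fun v => exp (- t * v)) 1 t) as [l Hl]; [|easy|lra| |].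
  - intros v _; apply continuous_exp_lin.
  - intros v _; rewrite Rabs_pos_eq by (left; apply exp_pos); lra.
  - exact (eq_ind _ (is_Int0inf _) Hl _ (eq_sym (Int0inf_unique (V0 := X0) _ _ Hl))).
Qed.

(** Reduces vector estimates to pointwise bounds on the kernel. The factor [1 + v] pays for the
    Lipschitz constant of [e^(-tv)] in [t]. *)
Lemma norm_bound_g (k : R -> R) (l : X) B m (kap : R) :
  (forall v, 0 < v -> continuous k v) ->
  is_Int0infR (fun v => K * (1 + v) ^ q * (1 + v) * exp (- m * v)) kap ->
  (forall v, 0 < v -> Rabs (k v) <= B * ((1 + v) * exp (- m * v))) ->
  is_Int0inf (fun v => scal (k v) (g v)) l -> norm l <= B * kap.
Proof.
  intros Hk Hkap H Hl.
  destruct (is_Int0inf_dominated (V0 := X0) (fun v => scal (k v) (g v))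
    (fun v => B * (K * (1 + v) ^ q * (1 + v) * exp (- m * v))) (B * kap)) as [l' [Hl' Hn]].
  - now apply loc_int_scal_g.
  - intros v Hv; rewrite norm_scal_R.
    replace (B * (K * (1 + v) ^ q * (1 + v) * exp (- m * v)))
      with (B * ((1 + v) * exp (- m * v)) * (K * (1 + v) ^ q)) by ring.
    apply Rmult_le_compat; [apply Rabs_pos|apply norm_ge_0|auto|auto].
  - now apply is_Int0infR_scal.
  - now rewrite (is_Int0inf_inj (V0 := X0) _ _ _ Hl Hl').
Qed.

Lemma ex_kap m : 0 < m -> exists kap, 0 <= kap /\
  is_Int0infR (fun v => K * (1 + v) ^ q * (1 + v) * exp (- m * v)) kap.
Proof.
  intros Hm.
  assert (hpos : forall v, 0 < v -> 0 <= K * (1 + v) ^ q * (1 + v) * exp (- m * v)).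
  { intros v Hv; repeat apply Rmult_le_pos; try lra; [apply pow_le; lra|left; apply exp_pos]. }
  destruct (ex_Int0inf_power_exp (V0 := R_CompleteNormedModule)
    (fun v => K * (1 + v) ^ q * (1 + v) * exp (- m * v)) K 1 (INR (S q)) m) as [kap Hk]; try lra.
  - apply (loc_int_continuous (V0 := R_CompleteNormedModule)); intros v Hv.
    apply (ex_derive_continuous (V := R_NormedModule)); auto_derive; easy.
  - intros v Hv; unfold norm; simpl; unfold abs; simpl.
    rewrite Rabs_pos_eq by auto.
    change (match q with O => 1 | S _ => INR q + 1 end) with (INR (S q)).
    rewrite Rminus_diag, Rpower_O, Rpower_pow by lra; simpl; right; ring.
  - exists kap; split; [|easy]; revert Hk; now apply is_Int0infR_ge0.
Qed.

Lemma continuous_laplace t : 0 < t -> continuous laplace t.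
Proof.
  intros Ht; apply continuous_eps; intros e He.
  destruct (ex_kap (t / 2) ltac:(lra)) as [kap [Hk0 Hk]].
  exists (Rmin (t / 2) (e / (kap + 1))); split.
  { apply Rmin_glb_lt; [lra|apply Rdiv_lt_0_compat; lra]. }
  intros s Hs.
  assert (h1 := Rmin_l (t / 2) (e / (kap + 1))); assert (h2 := Rmin_r (t / 2) (e / (kap + 1))).
  assert (Hst : Rabs (s - t) < t / 2) by lra; apply Rabs_def2 in Hst.
  apply Rle_lt_trans with (Rabs (s - t) * kap).
  - apply (norm_bound_g (fun v => exp (- s * v) - exp (- t * v)) _ _ (t / 2)); [|exact Hk| |].
    + intros v _; apply (continuous_minus (V := R_NormedModule)); apply continuous_exp_lin.
    + intros v Hv; assert (L := exp_neg_lipschitz (t / 2 * v) (s * v) (t * v) ltac:(nra) ltac:(nra)).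
      replace (- (s * v)) with (- s * v) in L by ring; replace (- (t * v)) with (- t * v) in L by ring.
      eapply Rle_trans; [exact L|].
      replace (s * v - t * v) with ((s - t) * v) by ring.
      rewrite Rabs_mult, (Rabs_pos_eq v), Rmult_assoc by lra.
      apply Rmult_le_compat_l; [apply Rabs_pos|].
      replace (- (t / 2 * v)) with (- (t / 2) * v) by ring.
      apply Rmult_le_compat_r; [left; apply exp_pos|lra].
    + apply (is_Int0inf_ext (V0 := X0) (fun v => minus (scal (exp (- s * v)) (g v)) (scal (exp (- t * v)) (g v)))).
      * intros v Hv; module_eq.
      * apply is_Int0inf_minus; apply is_laplace; lra.
  - apply Rle_lt_trans with (Rabs (s - t) * (kap + 1)).
    + apply Rmult_le_compat_l; [apply Rabs_pos|lra].
    + apply Rlt_le_trans with (e / (kap + 1) * (kap + 1)); [|right; field; lra].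
      apply Rmult_lt_compat_r; lra.
Qed.

(** * Fubini's theorem for the kernel [e^(-tv)] *)

Section Fubini.
Variables (f : R -> R) (m : R).
Hypothesis mpos : 0 < m.
Hypothesis fcont : forall t, 0 < t -> continuous f t.

Let inner (a b v : R) : R := RInt (fun t => f t * exp (- t * v)) a b.

Lemma continuous_f_exp v t : 0 < t -> continuous (fun t => f t * exp (- t * v)) t.
Proof.
  intros Ht; apply (continuous_mult f (fun t => exp (- t * v))); [auto|].
  apply (ex_derive_continuous (V := R_NormedModule)); auto_derive; easy.
Qed.

Lemma ex_RInt_f_exp v a b : 0 < a -> 0 < b -> ex_RInt (fun t => f t * exp (- t * v)) a b.
Proof.
  intros Ha Hb; apply (ex_RInt_continuous (V := R_CompleteNormedModule)); intros t Ht.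
  apply continuous_f_exp; assert (0 < Rmin a b) by (now apply Rmin_glb_lt); lra.
Qed.

Lemma f_bounded a b : 0 < a -> a <= b -> exists F, 0 < F /\ forall t, a <= t <= b -> Rabs (f t) <= F.
Proof.
  intros Ha Hab; destruct (bounded_continuity (V := R_NormedModule) f a b) as [F HF].
  - intros t Ht; apply fcont; lra.
  - exists F; split.
    + eapply Rle_lt_trans; [apply (norm_ge_0 (f a : R_NormedModule))|apply (HF a); lra].
    + intros t Ht; left; exact (HF t Ht).
Qed.

Lemma inner_bound a b : m <= a -> a <= b -> exists B, 0 <= B /\
  forall v, 0 < v -> Rabs (inner a b v) <= B * exp (- m * v).
Proof.
  intros Ha Hab; destruct (f_bounded a b ltac:(lra) Hab) as [F [HF Hf]].
  exists (F * (b - a)); split; [apply Rmult_le_pos; lra|]; intros v Hv.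
  rewrite <- (Rabs_pos_eq (b - a)) by lra.
  replace (F * Rabs (b - a) * exp (- m * v)) with (F * exp (- m * v) * Rabs (b - a)) by ring.
  apply RInt_abs_const; rewrite Rmin_left, Rmax_right by easy; intros t Ht.
  - apply continuous_f_exp; lra.
  - rewrite Rabs_mult, (Rabs_pos_eq (exp _)) by (left; apply exp_pos).
    apply Rmult_le_compat; [apply Rabs_pos|left; apply exp_pos|now apply Hf|apply exp_le; nra].
Qed.

Lemma continuous_inner a b v : m <= a -> a <= b -> 0 < v -> continuous (inner a b) v.
Proof.
  intros Ha Hab Hv; apply (continuous_eps (V := R_NormedModule)); intros e He.
  destruct (f_bounded a b ltac:(lra) Hab) as [F [HF Hf]].
  set (B := F * b * (b - a) + 1).
  assert (HB : 0 < B).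
  { unfold B; assert (0 <= F * b * (b - a)); [|lra]; repeat apply Rmult_le_pos; lra. }
  exists (Rmin v (e / B)); split; [apply Rmin_glb_lt; [easy|now apply Rdiv_lt_0_compat]|].
  intros s Hs; assert (h1 := Rmin_l v (e / B)); assert (h2 := Rmin_r v (e / B)).
  assert (Hsv : Rabs (s - v) < v) by lra; apply Rabs_def2 in Hsv.
  unfold inner.
  change (Rabs (RInt (fun t => f t * exp (- t * s)) a b - RInt (fun t => f t * exp (- t * v)) a b) < e).
  replace (RInt (fun t => f t * exp (- t * s)) a b - RInt (fun t => f t * exp (- t * v)) a b)
    with (RInt (fun t => f t * exp (- t * s) - f t * exp (- t * v)) a b)
    by (apply (RInt_minus (V := R_CompleteNormedModule)); apply ex_RInt_f_exp; lra).
  apply Rle_lt_trans with (F * (b * Rabs (s - v)) * Rabs (b - a)).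
  - apply RInt_abs_const; rewrite Rmin_left, Rmax_right by easy; intros t Ht.
    + apply (continuous_minus (V := R_NormedModule)); apply continuous_f_exp; lra.
    + rewrite <- Rmult_minus_distr_l, Rabs_mult.
      apply Rmult_le_compat; [apply Rabs_pos|apply Rabs_pos|now apply Hf|].
      assert (L := exp_neg_lipschitz 0 (t * s) (t * v) ltac:(nra) ltac:(nra)).
      rewrite Ropp_0, exp_0, Rmult_1_r in L.
      replace (- (t * s)) with (- t * s) in L by ring; replace (- (t * v)) with (- t * v) in L by ring.
      eapply Rle_trans; [exact L|].
      rewrite <- Rmult_minus_distr_l, Rabs_mult, (Rabs_pos_eq t) by lra.
      apply Rmult_le_compat_r; [apply Rabs_pos|lra].
  - rewrite (Rabs_pos_eq (b - a)) by lra.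
    replace (F * (b * Rabs (s - v)) * (b - a)) with ((B - 1) * Rabs (s - v)) by (unfold B; ring).
    apply Rle_lt_trans with (B * Rabs (s - v)).
    + apply Rmult_le_compat_r; [apply Rabs_pos|lra].
    + apply Rlt_le_trans with (B * (e / B)); [|right; field; lra].
      apply Rmult_lt_compat_l; lra.
Qed.

(** The iterated integral with [t] innermost, over [m < t < c]. The cutoff [m > 0] makes the inner
    integral decay like [e^(-mv)]. *)
Let Z (c : R) : X := Int0inf (V := X0) (fun v => scal (inner m c v) (g v)).

Lemma is_Z c : m <= c -> is_Int0inf (fun v => scal (inner m c v) (g v)) (Z c).
Proof.
  intros Hc; destruct (inner_bound m c ltac:(lra) Hc) as [B [HB Hb]].
  destruct (Int0inf_g_exp (inner m c) B m) as [l Hl]; try easy.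
  - intros v Hv; apply continuous_inner; lra.
  - exact (eq_ind _ (is_Int0inf _) Hl _ (eq_sym (Int0inf_unique (V0 := X0) _ _ Hl))).
Qed.

(** Fubini by differentiation: the other iterated integral has the same derivative in [c]. The
    first-order remainder is the integral against [g] of [J], where [J v] integrates the increment
    of [f(t) e^(-tv)] between [c] and [s]. *)
Lemma is_derive_Z c : m < c -> is_derive Z c (scal (f c) (laplace c)).
Proof.
  intros Hc; apply is_derive_eps; intros e He.
  destruct (ex_kap m mpos) as [kap [Hk0 Hk]].
  (* One [e'] is spent on the increment of [f] and one on that of the exponential; [kap] is the
     integral of the dominating kernel. *)
  set (e' := e / (2 * (kap + 1))).
  assert (He' : 0 < e') by (apply Rdiv_lt_0_compat; lra).
  destruct (proj1 (continuous_eps (V := R_NormedModule) f c) (fcont c ltac:(lra)) e' He')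
    as [d [Hd Hf]].
  assert (hfc := Rabs_pos (f c)).
  assert (Hq : 0 < e' / (Rabs (f c) + 1)) by (apply Rdiv_lt_0_compat; lra).
  exists (Rmin (c - m) (Rmin d (e' / (Rabs (f c) + 1)))); split.
  { repeat apply Rmin_glb_lt; lra. }
  intros s Hs.
  assert (h1 := Rmin_l (c - m) (Rmin d (e' / (Rabs (f c) + 1)))).
  assert (h2 := Rmin_r (c - m) (Rmin d (e' / (Rabs (f c) + 1)))).
  assert (h3 := Rmin_l d (e' / (Rabs (f c) + 1))); assert (h4 := Rmin_r d (e' / (Rabs (f c) + 1))).
  assert (Hsc : Rabs (s - c) < c - m) by lra; apply Rabs_def2 in Hsc.
  apply Rle_trans with (Rabs (s - c) * (2 * e') * kap).
  2: { apply Rle_trans with (Rabs (s - c) * (2 * e') * (kap + 1)).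
       - apply Rmult_le_compat_l; [|lra]; apply Rmult_le_pos; [apply Rabs_pos|lra].
       - unfold e'; right; field; lra. }
  set (J := fun v => RInt (fun t => f t * exp (- t * v) - f c * exp (- c * v)) c s).
  assert (HJ : forall v, J v = inner m s v - inner m c v - (s - c) * (f c * exp (- c * v))).
  { intros v; unfold J, inner.
    rewrite (RInt_minus (V := R_CompleteNormedModule));
      [|apply ex_RInt_f_exp; lra|apply ex_RInt_const].
    rewrite (RInt_const (V := R_CompleteNormedModule)).
    rewrite <- (RInt_Chasles (V := R_CompleteNormedModule) (fun t => f t * exp (- t * v)) m c s)
      by (apply ex_RInt_f_exp; lra).
    unfold minus, plus, opp, scal; simpl; unfold mult; simpl; ring. }
  apply (norm_bound_g J _ _ m); [|exact Hk| |].
  - intros v Hv; apply (continuous_ext (fun v => inner m s v - inner m c v - (s - c) * (f c * exp (- c * v)))).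
    { intros; now rewrite HJ. }
    apply (continuous_minus (V := R_NormedModule)); [apply (continuous_minus (V := R_NormedModule))|].
    + apply continuous_inner; lra.
    + apply continuous_inner; lra.
    + apply (continuous_scal_r (V := R_NormedModule)), (continuous_scal_r (V := R_NormedModule)).
      apply continuous_exp_lin.
  - intros v Hv.
    replace (Rabs (s - c) * (2 * e') * ((1 + v) * exp (- m * v)))
      with (2 * e' * ((1 + v) * exp (- m * v)) * Rabs (s - c)) by ring.
    assert (Hbetween : forall t, Rmin c s <= t <= Rmax c s -> m <= t /\ Rabs (t - c) <= Rabs (s - c)).
    { intros t Ht; destruct (Rle_dec c s) as [h|h].
      - rewrite Rmin_left, Rmax_right in Ht by easy; rewrite !Rabs_pos_eq by lra; lra.
      - rewrite Rmin_right, Rmax_left in Ht by lra; rewrite !Rabs_left1 by lra; lra. }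
    apply RInt_abs_const; intros t Ht; destruct (Hbetween t Ht) as [Htm Htc].
    + apply (continuous_minus (V := R_NormedModule)); [apply continuous_f_exp; lra|apply continuous_const].
    + replace (f t * exp (- t * v) - f c * exp (- c * v))
        with ((f t - f c) * exp (- t * v) + f c * (exp (- t * v) - exp (- c * v))) by ring.
      eapply Rle_trans; [apply Rabs_triang|]; rewrite !Rabs_mult.
      assert (E1 : Rabs (f t - f c) <= e') by (left; apply Hf; lra).
      assert (E2 : Rabs (exp (- t * v)) <= exp (- m * v)).
      { rewrite Rabs_pos_eq by (left; apply exp_pos); apply exp_le; nra. }
      assert (E3 : Rabs (exp (- t * v) - exp (- c * v)) <= Rabs (t - c) * v * exp (- m * v)).
      { assert (L := exp_neg_lipschitz (m * v) (t * v) (c * v) ltac:(nra) ltac:(nra)).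
        replace (- (t * v)) with (- t * v) in L by ring; replace (- (c * v)) with (- c * v) in L by ring.
        replace (- (m * v)) with (- m * v) in L by ring.
        rewrite <- Rmult_minus_distr_r, Rabs_mult, (Rabs_pos_eq v) in L by lra; exact L. }
      assert (E4 : Rabs (f c) * Rabs (t - c) <= e').
      { apply Rle_trans with ((Rabs (f c) + 1) * (e' / (Rabs (f c) + 1))); [|right; field; lra].
        apply Rmult_le_compat; [lra|apply Rabs_pos|lra|lra]. }
      assert (hexp := exp_pos (- m * v)).
      apply Rle_trans with (e' * exp (- m * v) + e' * (v * exp (- m * v))).
      * apply Rplus_le_compat.
        -- apply Rmult_le_compat; [apply Rabs_pos|apply Rabs_pos|easy|easy].
        -- apply Rle_trans with (Rabs (f c) * (Rabs (t - c) * v * exp (- m * v))).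
           ++ apply Rmult_le_compat_l; easy.
           ++ rewrite <- !Rmult_assoc, (Rmult_assoc (Rabs (f c) * Rabs (t - c))), (Rmult_assoc e').
              apply Rmult_le_compat_r; [|easy]; apply Rmult_le_pos; lra.
      * assert (0 <= e' * (v * exp (- m * v))) by (apply Rmult_le_pos; [lra|apply Rmult_le_pos; lra]).
        assert (0 <= e' * exp (- m * v)) by (apply Rmult_le_pos; lra).
        replace (2 * e' * ((1 + v) * exp (- m * v)))
          with (2 * (e' * exp (- m * v)) + 2 * (e' * (v * exp (- m * v)))) by ring; lra.
  - apply (is_Int0inf_ext (V0 := X0) (fun v => minus (minus (scal (inner m s v) (g v)) (scal (inner m c v) (g v)))
      (scal (s - c) (scal (f c) (scal (exp (- c * v)) (g v)))))).
    + intros v Hv; rewrite HJ; module_eq.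
    + apply is_Int0inf_minus; [apply is_Int0inf_minus; apply is_Z; lra|].
      apply is_Int0inf_scal, is_Int0inf_scal, is_laplace; lra.
Qed.

Lemma fubini_laplace b c : m < b -> b <= c ->
  exists l, is_RInt (fun t => scal (f t) (laplace t)) b c l /\
    is_Int0inf (fun v => scal (RInt (fun t => f t * exp (- t * v)) b c) (g v)) l.
Proof.
  intros Hb Hbc; exists (minus (Z c) (Z b)); split.
  - apply (is_RInt_derive (V := X0) Z); rewrite Rmin_left, Rmax_right by easy; intros t Ht.
    + apply is_derive_Z; lra.
    + apply (continuous_scal f laplace); [apply fcont; lra|apply continuous_laplace; lra].
  - apply (is_Int0inf_ext (V0 := X0) (fun v => minus (scal (inner m c v) (g v)) (scal (inner m b v) (g v)))).
    + intros v Hv; unfold inner.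
      rewrite <- (RInt_Chasles (V := R_CompleteNormedModule) (fun t => f t * exp (- t * v)) m b c)
        by (apply ex_RInt_f_exp; lra).
      unfold plus at 1; simpl; module_eq.
    + apply is_Int0inf_minus; apply is_Z; lra.
Qed.

End Fubini.

Lemma gdens_laplace_transform a v : 0 < a -> 0 < v ->
  is_Int0infR (fun t => gdens a t * exp (- t * v)) (Rpower (1 + v) (- a)).
Proof.
  intros Ha Hv; assert (h := Gamma_pos a Ha).
  replace (Rpower (1 + v) (- a)) with (/ Gamma a * (Gamma a / Rpower (1 + v) a))
    by (rewrite Rpower_Ropp; field; split; first [lra | apply Rgt_not_eq, exp_pos]).
  apply (is_Int0infR_ext (fun t => / Gamma a * (Rpower t (a - 1) * exp (- (1 + v) * t)))).
  - intros t _; unfold gdens.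
    replace (- (1 + v) * t) with (- (1) * t + - t * v) by ring.
    rewrite exp_plus; field; lra.
  - apply is_Int0infR_scal, is_Gamma_scaled; lra.
Qed.

(* The truncation error [(1+v)^(-a) - RInt] is at most [(1+v)^(-a)], and at most its value at
   [v = 0], which is small; interpolating between the two bounds gives integrable decay. *)
Lemma laplace_gdens a : INR q + 1 < a ->
  exists l, is_Int0inf (fun t => scal (gdens a t) (laplace t)) l /\
    is_Int0inf (fun v => scal (Rpower (1 + v) (- a)) (g v)) l.
Proof.
  intros Ha; assert (hq := pos_INR q); assert (Ha0 : 0 < a) by lra.
  assert (cont : forall s v, 0 < v -> continuous (fun v => Rpower (1 + v) s) v).
  { intros s v Hv; apply (ex_derive_continuous (V := R_NormedModule)); unfold Rpower; auto_derive; lra. }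
  assert (tail : forall (k : R -> R) B s, (forall v, 0 < v -> continuous k v) -> 0 <= B ->
    INR q + 1 < s -> (forall v, 0 < v -> Rabs (k v) <= B * Rpower (1 + v) (- s)) ->
    exists l, is_Int0inf (fun v => scal (k v) (g v)) l /\ norm l <= B * K * / (s - INR q - 1)).
  { intros k B s Hk HB Hs Hb.
    apply (is_Int0inf_dominated (V0 := X0) _ (fun v => B * K * Rpower (1 + v) (- (s - INR q)))).
    - now apply loc_int_scal_g.
    - intros v Hv; rewrite norm_scal_R.
      replace (- (s - INR q)) with (- s + INR q) by ring; rewrite Rpower_plus, Rpower_pow by lra.
      replace (B * K * (Rpower (1 + v) (- s) * (1 + v) ^ q))
        with (B * Rpower (1 + v) (- s) * (K * (1 + v) ^ q)) by ring.
      apply Rmult_le_compat; [apply Rabs_pos|apply norm_ge_0|auto|auto].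
    - apply is_Int0infR_scal, is_Int0inf_power_tail; lra. }
  destruct (tail (fun v => Rpower (1 + v) (- a)) 1 a) as [l [Hl _]]; [|lra|easy| |].
  { intros v Hv; now apply cont. }
  { intros v Hv; rewrite Rabs_pos_eq by (left; apply exp_pos); lra. }
  exists l; split; [|easy].
  (* With this [th] the interpolated exponent [s] is the midpoint of [a] and [q + 1], so
     [(1 + v)^(-s)] still beats the growth of [g]. *)
  set (th := (a - INR q - 1) / (2 * a)); set (s := a * (1 - th)).
  assert (Hth : 0 < th <= 1).
  { unfold th; split; [apply Rdiv_lt_0_compat; lra|].
    apply Rle_div_l; lra. }
  assert (Hs : INR q + 1 < s).
  { unfold s, th; replace (a * (1 - (a - INR q - 1) / (2 * a))) with ((a + INR q + 1) / 2)
      by (field; lra); lra. }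
  apply is_Int0inf_iff; intros e He.
  set (C := K * / (s - INR q - 1)).
  assert (HC : 0 < C) by (apply Rmult_lt_0_compat; [easy|apply Rinv_0_lt_compat; lra]).
  set (eps := Rpower (e / (2 * C)) (/ th)).
  assert (Heps : 0 < eps) by apply exp_pos.
  assert (Hepsth : Rpower eps th = e / (2 * C)).
  { unfold eps; rewrite Rpower_mult, Rinv_l by lra; apply Rpower_1, Rdiv_lt_0_compat; lra. }
  assert (Hg1 := is_Int0inf_gdens a Ha0).
  assert (Lg := is_Int0inf_loc (V0 := R_CompleteNormedModule) _ _ Hg1).
  destruct (proj1 (is_Int0inf_RInt (V0 := R_CompleteNormedModule) _ _ Lg) Hg1 eps Heps)
    as [d [N [Hd HN]]].
  exists d, (Rmax N d); split; [easy|]; intros b c Hb Hc.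
  assert (hm1 := Rmax_l N d); assert (hm2 := Rmax_r N d).
  destruct (fubini_laplace (gdens a) (b / 2) ltac:(lra)
    ltac:(intros; now apply continuous_gdens) b c ltac:(lra) ltac:(lra)) as [J [HJ1 HJ2]].
  exists J; split; [exact HJ1|].
  set (I := fun v => RInt (fun t => gdens a t * exp (- t * v)) b c) in *.
  assert (Hcont : forall v, 0 < v -> continuous I v).
  { intros v Hv; unfold I.
    apply (continuous_inner (gdens a) (b / 2)); try lra; intros; now apply continuous_gdens. }
  assert (Hfi : forall v, ex_RInt (fun t => gdens a t * exp (- t * v)) b c).
  { intros v; apply (ex_RInt_f_exp (gdens a)); try lra; intros; now apply continuous_gdens. }
  destruct (tail (fun v => Rpower (1 + v) (- a) - I v) (Rpower eps th) s) as [D [HD HDn]].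
  - intros v Hv; apply (continuous_minus (V := R_NormedModule)); [now apply cont|auto].
  - left; apply exp_pos.
  - easy.
  - intros v Hv.
    assert (Hgp : forall t, 0 < gdens a t) by (intros; now apply gdens_pos).
    assert (E0 : I v <= Rpower (1 + v) (- a)).
    { apply RInt_le_Int0infR; [|now apply gdens_laplace_transform|lra|lra].
      intros t Ht; left; apply Rmult_lt_0_compat; [auto|apply exp_pos]. }
    assert (E1 : 0 <= I v).
    { apply RInt_ge_0; [lra|apply Hfi|].
      intros t Ht; left; apply Rmult_lt_0_compat; [auto|apply exp_pos]. }
    (* Truncating the integral of the nonnegative function [gdens a t (1 - e^(-tv))] can only
       decrease it; rearranged, this bounds the error at [v] by the error at 0. *)
    assert (E2 : RInt (gdens a) b c - I v <= 1 - Rpower (1 + v) (- a)).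
    { replace (RInt (gdens a) b c - I v)
        with (RInt (fun t => gdens a t - gdens a t * exp (- t * v)) b c).
      - apply RInt_le_Int0infR; [| |lra|lra].
        + intros t Ht; assert (exp (- t * v) <= 1) by (apply exp_le_1; nra).
          specialize (Hgp t); nra.
        + apply is_Int0infR_minus; [easy|now apply gdens_laplace_transform].
      - apply (RInt_minus (V := R_CompleteNormedModule)); [apply Lg; lra|apply Hfi]. }
    assert (E3 : 1 - RInt (gdens a) b c < eps).
    { specialize (HN b c ltac:(lra) ltac:(lra) ltac:(lra)).
      unfold norm, minus, plus, opp in HN; simpl in HN; unfold abs in HN; simpl in HN.
      apply Rabs_def2 in HN; lra. }
    rewrite Rabs_pos_eq by lra.
    replace (- s) with (- a * (1 - th)) by (unfold s; ring).
    rewrite <- Rpower_mult.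
    apply min_le_interpolate; try lra; apply exp_pos.
  - assert (ED : D = minus l J).
    { apply (is_Int0inf_inj (V0 := X0) (fun v => scal (Rpower (1 + v) (- a) - I v) (g v))); [easy|].
      apply (is_Int0inf_ext (V0 := X0) (fun v => minus (scal (Rpower (1 + v) (- a)) (g v)) (scal (I v) (g v)))).
      - intros v Hv; module_eq.
      - now apply is_Int0inf_minus. }
    rewrite norm_minus_sym, <- ED.
    eapply Rle_lt_trans; [exact HDn|].
    rewrite Rmult_assoc; fold C; rewrite Hepsth.
    replace (e / (2 * C) * C) with (e / 2) by (field; lra); lra.
Qed.

(** Used with [q = 0] for (ii), and with [q = 1] at parameter [a + 1] for (v). *)
Lemma ell_laplace n : forall a, INR q < a ->
  exists l, is_Int0inf (fun t => scal (ell n a t) (laplace t)) l /\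
    is_Int0inf (fun v => scal (phi n a v) (g v)) l.
Proof.
  assert (hq := pos_INR q).
  induction n as [|n IH]; intros a Ha.
  - destruct (laplace_gdens (a + 1) ltac:(lra)) as [l [H1 H2]].
    exists l; split; [revert H1|revert H2]; apply (is_Int0inf_ext (V0 := X0)); intros t Ht; f_equal.
    + unfold ell, gdens; rewrite Laguerre_0; simpl INR; simpl fact.
      replace (0 + a + 1) with (a + 1) by ring; replace (a + 1 - 1) with a by ring.
      replace (- (1) * t) with (- t) by ring.
      simpl INR; field; apply Rgt_not_eq, Gamma_pos; lra.
    + unfold phi; simpl INR; replace (0 + a + 1) with (a + 1) by ring.
      rewrite Rpower_Ropp, (Rplus_comm 1 t); simpl; field; apply Rgt_not_eq, exp_pos.
  - destruct (IH a Ha) as [l [H1 H2]]; destruct (IH (a + 1) ltac:(lra)) as [l' [H1' H2']].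
    exists (minus l l'); split.
    + apply (is_Int0inf_ext (V0 := X0) (fun t => minus (scal (ell n a t) (laplace t)) (scal (ell n (a + 1) t) (laplace t)))).
      * intros t Ht; rewrite ell_succ by lra; module_eq.
      * now apply is_Int0inf_minus.
    + apply (is_Int0inf_ext (V0 := X0) (fun t => minus (scal (phi n a t) (g t)) (scal (phi n (a + 1) t) (g t)))).
      * intros t Ht; rewrite phi_succ by lra; module_eq.
      * now apply is_Int0inf_minus.
Qed.

End Laplace.

(** * Orthogonality and the expansion theorem *)

Definition weight (b t : R) : R := Rpower t b * exp (- t).

Lemma weight_pos b t : 0 < weight b t.
Proof. apply Rmult_lt_0_compat; apply exp_pos. Qed.

Lemma continuous_weight b t : 0 < t -> continuous (weight b) t.
Proof.
  intros Ht; apply (continuous_mult (fun t => Rpower t b) (fun t => exp (- t)));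
    [now apply continuous_Rpower|].
  apply (ex_derive_continuous (V := R_NormedModule)); auto_derive; easy.
Qed.

Lemma weight_succ b t : 0 < t -> weight (b + 1) t = t * weight b t.
Proof. intros Ht; unfold weight; rewrite Rpower_succ by easy; ring. Qed.

Lemma is_Int0inf_weight b : -1 < b -> is_Int0infR (weight b) (Gamma (b + 1)).
Proof.
  intros Hb; generalize (is_Gamma (b + 1) ltac:(lra)); apply is_Int0infR_ext; intros t Ht.
  unfold weight; replace (b + 1 - 1) with b by ring; easy.
Qed.

Lemma ex_Int0inf_weight b (f : R -> R) C N :
  -1 < b -> 0 <= C -> loc_intR (fun t => weight b t * f t) ->
  (forall t, 0 < t -> Rabs (f t) <= C * (1 + t) ^ N) ->
  exists l : R, is_Int0infR (fun t => weight b t * f t) l.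
Proof.
  intros Hb HC Hf Hbd.
  apply (ex_Int0inf_power_exp (V0 := R_CompleteNormedModule) _ C (b + 1) (INR N) 1); try lra; [easy|].
  intros t Ht; unfold norm; simpl; unfold abs; simpl.
  rewrite Rabs_mult, (Rabs_pos_eq (weight b t)) by (left; apply weight_pos).
  rewrite Rpower_pow by lra; unfold weight.
  replace (b + 1 - 1) with b by ring; replace (- (1) * t) with (- t) by ring.
  replace (C * (Rpower t b * (1 + t) ^ N * exp (- t)))
    with (Rpower t b * exp (- t) * (C * (1 + t) ^ N)) by ring.
  apply Rmult_le_compat_l; [left; apply weight_pos|now apply Hbd].
Qed.

Lemma weight_lim_0 b (f : R -> R) C N :
  0 < b -> 0 <= C -> (forall t, 0 < t -> Rabs (f t) <= C * (1 + t) ^ N) ->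
  filterlim (fun t => weight b t * f t) (at_right 0) (locally 0).
Proof.
  intros Hb HC Hf.
  apply (filterlim_zero_at_0 (V := R_NormedModule) _ (C * 2 ^ N) b); [easy| |].
  { apply Rmult_le_pos; [easy|apply pow_le; lra]. }
  intros t Ht; unfold norm; simpl; unfold abs; simpl.
  rewrite Rabs_mult, (Rabs_pos_eq (weight b t)), Rmult_comm by (left; apply weight_pos).
  apply Rmult_le_compat; [apply Rabs_pos|left; apply weight_pos| |].
  - eapply Rle_trans; [apply Hf; lra|]; apply Rmult_le_compat_l; [easy|apply pow_incr; lra].
  - unfold weight; rewrite <- (Rmult_1_r (Rpower t b)) at 2.
    apply Rmult_le_compat_l; [left; apply exp_pos|apply exp_le_1; lra].
Qed.

Lemma weight_lim_infty b (f : R -> R) C N :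
  0 <= C -> (forall t, 0 < t -> Rabs (f t) <= C * (1 + t) ^ N) ->
  filterlim (fun t => weight b t * f t) (Rbar_locally p_infty) (locally 0).
Proof.
  intros HC Hf; destruct (power_exp_decay (b + INR N) 1 Rlt_0_1) as [K [HK H]].
  apply (filterlim_zero_at_infty (V := R_NormedModule) _ (fun t => C * 2 ^ N * K * exp (- (1 / 2) * t)));
    [|apply is_lim_exp_decay; lra].
  intros t Ht; unfold norm; simpl; unfold abs; simpl.
  rewrite Rabs_mult, (Rabs_pos_eq (weight b t)) by (left; apply weight_pos).
  specialize (H t ltac:(lra) ltac:(lra)); rewrite Rpower_plus, Rpower_pow in H by lra.
  replace (- (1) * t) with (- t) in H by ring.
  apply Rle_trans with (weight b t * (C * (2 ^ N * t ^ N))).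
  - apply Rmult_le_compat_l; [left; apply weight_pos|].
    eapply Rle_trans; [apply Hf; lra|]; apply Rmult_le_compat_l; [easy|].
    rewrite <- Rpow_mult_distr; apply pow_incr; lra.
  - unfold weight.
    replace (Rpower t b * exp (- t) * (C * (2 ^ N * t ^ N)))
      with (C * 2 ^ N * (Rpower t b * t ^ N * exp (- t))) by ring.
    rewrite (Rmult_assoc (C * 2 ^ N)); apply Rmult_le_compat_l; [|exact H].
    apply Rmult_le_pos; [easy|apply pow_le; lra].
Qed.

Lemma Laguerre_prod_bound n m a c : exists C, 0 <= C /\
  forall t, 0 < t -> Rabs (Laguerre n a t * Laguerre m c t) <= C * (1 + t) ^ (n + m).
Proof.
  destruct (Laguerre_bound n a) as [C1 [HC1 H1]]; destruct (Laguerre_bound m c) as [C2 [HC2 H2]].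
  exists (C1 * C2); split; [apply Rmult_le_pos; lra|]; intros t Ht.
  rewrite Rabs_mult, pow_add.
  replace (C1 * C2 * ((1 + t) ^ n * (1 + t) ^ m)) with (C1 * (1 + t) ^ n * (C2 * (1 + t) ^ m)) by ring.
  apply Rmult_le_compat; [apply Rabs_pos|apply Rabs_pos|apply H1; lra|apply H2; lra].
Qed.

(** The square of the norm of [L_n^b] in [L^2(w_b)]. *)
Definition lag_norm (b : R) (n : nat) : R := Gamma (INR n + b + 1) / INR (fact n).

Lemma lag_norm_pos b n : -1 < b -> 0 < lag_norm b n.
Proof.
  intros Hb; assert (h := pos_INR n); apply Rdiv_lt_0_compat; [apply Gamma_pos; lra|apply INR_fact_lt_0].
Qed.

Lemma continuous_weight_Laguerre b n m a c t : 0 < t ->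
  continuous (fun t => weight b t * (Laguerre n a t * Laguerre m c t)) t.
Proof.
  intros Ht; apply (continuous_mult (weight b) (fun t => Laguerre n a t * Laguerre m c t));
    [now apply continuous_weight|].
  apply (continuous_mult (Laguerre n a) (Laguerre m c)); apply continuous_Laguerre.
Qed.

(** Both degrees drop together while [b] rises: the derivative of [w_(b+1) L_n^(b+1) L_(m+1)^b] is
    [(n+1) w_b L_(n+1)^b L_(m+1)^b - w_(b+1) L_n^(b+1) L_m^(b+1)] and integrates to zero. When one
    degree reaches 0, Rodrigues' step finishes. *)
Lemma Laguerre_orthogonal n : forall m b, -1 < b ->
  is_Int0infR (fun t => weight b t * (Laguerre n b t * Laguerre m b t))
    (if Nat.eq_dec n m then lag_norm b n else 0).
Proof.
  assert (H0 : forall n b, -1 < b -> is_Int0infR (fun t => weight b t * Laguerre (S n) b t) 0).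
  { clear n; intros n b Hb; destruct (Laguerre_bound n (b + 1)) as [C [HC HL]].
    assert (h := pos_INR n).
    assert (H : is_Int0infR (fun t => (INR n + 1) * (weight b t * Laguerre (S n) b t)) (0 - 0)).
    { apply (is_Int0infR_derive (fun t => weight (b + 1) t * Laguerre n (b + 1) t)).
      - intros t Ht; now apply is_derive_weighted_Laguerre.
      - intros t Ht; apply (continuous_scal_r (V := R_NormedModule)).
        apply (continuous_mult (weight b) (Laguerre (S n) b));
          [now apply continuous_weight|apply continuous_Laguerre].
      - apply (weight_lim_0 _ _ C n); [lra|lra|]; intros; apply HL; lra.
      - apply (weight_lim_infty _ _ C n); [lra|]; intros; apply HL; lra. }
    apply (is_Int0infR_scal (/ (INR n + 1))) in H; rewrite Rminus_0_r, Rmult_0_r in H.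
    revert H; apply is_Int0infR_ext; intros t Ht; field; lra. }
  induction n as [|n IH]; intros [|m] b Hb; [simpl|simpl|simpl|].
  - replace (lag_norm b 0) with (Gamma (b + 1))
      by (unfold lag_norm; simpl; rewrite Rplus_0_l; field).
    generalize (is_Int0inf_weight b Hb); apply is_Int0infR_ext; intros t Ht; rewrite Laguerre_0; ring.
  - generalize (H0 m b Hb); apply is_Int0infR_ext; intros t Ht; rewrite Laguerre_0; ring.
  - generalize (H0 n b Hb); apply is_Int0infR_ext; intros t Ht; rewrite Laguerre_0; ring.
  - assert (h := pos_INR n).
    destruct (Laguerre_prod_bound n (S m) (b + 1) b) as [C [HC HL]].
    assert (H : is_Int0infR (fun t => (INR n + 1) * (weight b t * (Laguerre (S n) b t * Laguerre (S m) b t))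
        - weight (b + 1) t * (Laguerre n (b + 1) t * Laguerre m (b + 1) t)) (0 - 0)).
    { apply (is_Int0infR_derive (fun t => weight (b + 1) t * (Laguerre n (b + 1) t * Laguerre (S m) b t))).
      - intros t Ht.
        apply (is_derive_ext (fun t => weight (b + 1) t * Laguerre n (b + 1) t * Laguerre (S m) b t)).
        { intros s; eqR; ring. }
        assert (D := is_derive_mult (fun t => weight (b + 1) t * Laguerre n (b + 1) t) (Laguerre (S m) b) t
          _ _ (is_derive_weighted_Laguerre n b t Ht) (is_derive_Laguerre_succ m b t) Rmult_comm).
        refine (eq_ind _ (is_derive _ t) D _ _).
        unfold plus, mult, weight; simpl; eqR; ring.
      - intros t Ht; apply (continuous_minus (V := R_NormedModule));
          [apply (continuous_scal_r (V := R_NormedModule))|]; now apply continuous_weight_Laguerre.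
      - apply (weight_lim_0 _ _ C (n + S m)); [lra|lra|exact HL].
      - apply (weight_lim_infty _ _ C (n + S m)); [lra|exact HL]. }
    assert (H' := is_Int0infR_scal (/ (INR n + 1)) _ _ (is_Int0infR_plus _ _ _ _ H (IH m (b + 1) ltac:(lra)))).
    refine (eq_ind (/ (INR n + 1) * (0 - 0 + (if Nat.eq_dec n m then lag_norm (b + 1) n else 0)))
      (is_Int0infR _) _ _ _).
    + revert H'; apply is_Int0infR_ext; intros t Ht; field; lra.
    + destruct (Nat.eq_dec n m) as [E|E]; destruct (Nat.eq_dec (S n) (S m)); try lia; eqR; [|ring].
      unfold lag_norm; change (fact (S n)) with (S n * fact n)%nat; rewrite mult_INR, S_INR.
      replace (INR n + 1 + b + 1) with (INR n + (b + 1) + 1) by ring.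
      field; split; [apply INR_fact_neq_0|lra].
Qed.

(** * Laguerre partial sums as least-squares approximations *)

Section Expansion.
Variables (b lam : R).
Hypothesis bpos : 0 < b.
Hypothesis lampos : 0 < lam.

Definition stepR (c : R) (f g : R -> R) (t : R) : R := if Rlt_dec t c then f t else g t.

Definition pw_continuous (f : R -> R) : Prop :=
  exists f1 f2, (forall t, 0 < t -> continuous f1 t) /\ (forall t, 0 < t -> continuous f2 t) /\
    forall t, 0 < t -> f t = stepR lam f1 f2 t.

Lemma pw_continuous_loc_int f : pw_continuous f -> loc_intR f.
Proof.
  intros [f1 [f2 [H1 [H2 H]]]].
  apply (loc_int_ext (V0 := R_CompleteNormedModule) (step (V0 := R_CompleteNormedModule) lam f1 f2)).
  - intros t Ht; rewrite H by easy; reflexivity.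
  - apply loc_int_step; now apply (loc_int_continuous (V0 := R_CompleteNormedModule)).
Qed.

Lemma pw_continuous_cont f : (forall t, 0 < t -> continuous f t) -> pw_continuous f.
Proof.
  intros H; exists f, f; repeat split; auto; intros t _; unfold stepR; now destruct (Rlt_dec t lam).
Qed.

Lemma pw_continuous_minus f g : pw_continuous f -> pw_continuous g -> pw_continuous (fun t => f t - g t).
Proof.
  intros [f1 [f2 [H1 [H2 H]]]] [g1 [g2 [G1 [G2 G]]]].
  exists (fun t => f1 t - g1 t), (fun t => f2 t - g2 t); repeat split.
  - intros t Ht; apply (continuous_minus (V := R_NormedModule)); auto.
  - intros t Ht; apply (continuous_minus (V := R_NormedModule)); auto.
  - intros t Ht; rewrite H, G by easy; unfold stepR; now destruct (Rlt_dec t lam).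
Qed.

Lemma pw_continuous_mult f g : pw_continuous f -> pw_continuous g -> pw_continuous (fun t => f t * g t).
Proof.
  intros [f1 [f2 [H1 [H2 H]]]] [g1 [g2 [G1 [G2 G]]]].
  exists (fun t => f1 t * g1 t), (fun t => f2 t * g2 t); repeat split.
  - intros t Ht; apply (continuous_mult f1 g1); auto.
  - intros t Ht; apply (continuous_mult f2 g2); auto.
  - intros t Ht; rewrite H, G by easy; unfold stepR; now destruct (Rlt_dec t lam).
Qed.

(* The density of [e^(lam - t) 1_(t >= lam)] with respect to [weight b]. *)
Definition tail_density (t : R) : R := stepR lam (fun _ => 0) (fun t => exp lam * Rpower t (- b)) t.

Lemma tail_density_pw : pw_continuous tail_density.
Proof.
  exists (fun _ => 0), (fun t => exp lam * Rpower t (- b)); repeat split.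
  - intros; apply continuous_const.
  - intros t Ht; apply (continuous_scal_r (V := R_NormedModule)); now apply continuous_Rpower.
Qed.

Lemma weight_tail_density t : 0 < t ->
  weight b t * tail_density t = stepR lam (fun _ => 0) (fun t => exp (lam - t)) t.
Proof.
  intros Ht; unfold tail_density, stepR, weight; destruct (Rlt_dec t lam); [ring|].
  rewrite Rpower_Ropp; unfold Rminus; rewrite exp_plus; field; apply Rgt_not_eq, exp_pos.
Qed.

Lemma tail_density_bound t : 0 < t -> 0 <= tail_density t <= exp lam * Rpower lam (- b).
Proof.
  intros Ht; unfold tail_density, stepR.
  assert (h := exp_pos lam); assert (h1 := Rpower_pos lam (- b)); assert (h2 := Rpower_pos t (- b)).
  destruct (Rlt_dec t lam) as [H|H]; [split; [lra|left; now apply Rmult_lt_0_compat]|].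
  split; [left; now apply Rmult_lt_0_compat|].
  apply Rmult_le_compat_l; [lra|]; rewrite !Rpower_Ropp.
  apply Rinv_le_contravar; [apply exp_pos|]; apply Rpower_le_base; lra.
Qed.

(** Since [L_n^b = L_n^(b-1) - (L_n^(b-1))'], the function [e^(lam - t) L_n^b(t)] has the
    antiderivative [- e^(lam - t) L_n^(b-1)(t)]; only its value at [lam] remains. *)
Lemma tail_coefficient n :
  is_Int0infR (fun t => weight b t * (Laguerre n b t * tail_density t)) (Laguerre n (b - 1) lam).
Proof.
  apply (is_Int0infR_ext (step (V0 := R_CompleteNormedModule) lam (fun _ => zero)
    (fun t => exp (lam - t) * Laguerre n b t))).
  { intros t Ht; transitivity (Laguerre n b t * (weight b t * tail_density t)); [|ring].
    rewrite weight_tail_density by easy; unfold step, stepR, zero; simpl.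
    destruct (Rlt_dec t lam); ring. }
  destruct (Laguerre_bound n (b - 1)) as [C [HC HL]].
  apply (is_Int0inf_step_zero (V0 := R_CompleteNormedModule) lam _
    (fun c => Laguerre n (b - 1) lam - exp (lam - c) * Laguerre n (b - 1) c)); [easy| |].
  - intros c Hc.
    replace (Laguerre n (b - 1) lam - exp (lam - c) * Laguerre n (b - 1) c)
      with (minus (- exp (lam - c) * Laguerre n (b - 1) c) (- exp (lam - lam) * Laguerre n (b - 1) lam)).
    2: { rewrite Rminus_diag, exp_0; unfold minus, plus, opp; simpl; ring. }
    apply (is_RInt_derive (V := R_CompleteNormedModule) (fun t => - exp (lam - t) * Laguerre n (b - 1) t)).
    + intros t _.
      assert (E : is_derive (fun t => - exp (lam - t)) t (exp (lam - t))).
      { auto_derive; [easy|]; unfold Rminus; ring. }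
      assert (L : Laguerre n b t = Laguerre n (b - 1) t - Derive (Laguerre n (b - 1)) t).
      { destruct n as [|n].
        - rewrite !Laguerre_0, (is_derive_unique _ _ _ (is_derive_Laguerre_0 (b - 1) t)); ring.
        - rewrite (is_derive_unique _ _ _ (is_derive_Laguerre_succ n (b - 1) t)).
          assert (P := Laguerre_param_succ n (b - 1) t); replace (b - 1 + 1) with b in * by ring; lra. }
      assert (D := is_derive_mult (fun t => - exp (lam - t)) (Laguerre n (b - 1)) t _ _ E
        (Derive_correct _ _ (ex_derive_Laguerre n (b - 1) t)) Rmult_comm).
      refine (eq_ind _ (is_derive _ t) D _ _); rewrite L; unfold plus, mult; simpl; eqR; ring.
    + intros t _; apply (continuous_mult (fun t => exp (lam - t)) (Laguerre n b)); [|apply continuous_Laguerre].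
      apply (ex_derive_continuous (V := R_NormedModule)); auto_derive; easy.
  - assert (Z := weight_lim_infty 0 (Laguerre n (b - 1)) C n ltac:(lra) ltac:(intros; apply HL; lra)).
    assert (Z' : is_lim (fun c => Laguerre n (b - 1) lam - exp lam * (weight 0 c * Laguerre n (b - 1) c))
      p_infty (Laguerre n (b - 1) lam - exp lam * 0)).
    { apply is_lim_minus'; [apply is_lim_const|].
      apply (is_lim_scal_l (fun c => weight 0 c * Laguerre n (b - 1) c) (exp lam) p_infty 0 Z). }
    rewrite Rmult_0_r, Rminus_0_r in Z'; revert Z'; apply filterlim_ext_loc.
    exists 0; intros c Hc; unfold weight; rewrite Rpower_O by easy; unfold Rminus at 4.
    unfold Rminus; rewrite exp_plus; ring.
Qed.

Fixpoint lag_sum (c : nat -> R) (N : nat) (t : R) : R :=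
  match N with
  | O => 0
  | S n => lag_sum c n t + c n * Laguerre n b t
  end.

Lemma continuous_lag_sum c N t : continuous (lag_sum c N) t.
Proof.
  induction N as [|N IH]; simpl; [apply continuous_const|].
  apply (continuous_plus (V := R_NormedModule)); [exact IH|].
  apply (continuous_scal_r (V := R_NormedModule)), continuous_Laguerre.
Qed.

(** The squared distance in [L^2(w_b)] from [tail_density] to [lag_sum b c N], when [E0] is the
    squared norm of [tail_density]. Orthogonality makes it a sum of separate quadratics in the
    coefficients. *)
Fixpoint lag_energy (E0 : R) (c : nat -> R) (N : nat) : R :=
  match N with
  | O => E0
  | S n => lag_energy E0 c n - 2 * c n * Laguerre n (b - 1) lam + c n * c n * lag_norm b n
  end.

Lemma ex_tail_energy : exists E0 : R,
  is_Int0infR (fun t => weight b t * (tail_density t * tail_density t)) E0.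
Proof.
  set (B := exp lam * Rpower lam (- b)).
  assert (HB : 0 < B) by (apply Rmult_lt_0_compat; apply exp_pos).
  apply (ex_Int0inf_weight b _ (B * B) 0); [lra|apply Rmult_le_pos; lra| |].
  - apply pw_continuous_loc_int, pw_continuous_mult.
    + apply pw_continuous_cont; intros; now apply continuous_weight.
    + apply pw_continuous_mult; apply tail_density_pw.
  - intros t Ht; simpl; assert (h := tail_density_bound t Ht); fold B in h.
    rewrite Rmult_1_r, Rabs_pos_eq by (apply Rmult_le_pos; lra).
    apply Rmult_le_compat; lra.
Qed.

Lemma lag_residual_orthogonal c N : forall k, (N <= k)%nat ->
  is_Int0infR (fun t => weight b t * (Laguerre k b t * (tail_density t - lag_sum c N t)))
    (Laguerre k (b - 1) lam).
Proof.
  induction N as [|N IH]; intros k Hk; simpl.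
  - generalize (tail_coefficient k); apply is_Int0infR_ext; intros t Ht; ring.
  - assert (O := Laguerre_orthogonal k N b ltac:(lra)).
    destruct (Nat.eq_dec k N); [lia|].
    replace (Laguerre k (b - 1) lam) with (Laguerre k (b - 1) lam - c N * 0) by ring.
    apply (is_Int0infR_ext (fun t => weight b t * (Laguerre k b t * (tail_density t - lag_sum c N t))
      - c N * (weight b t * (Laguerre k b t * Laguerre N b t)))).
    + intros t Ht; ring.
    + apply is_Int0infR_minus; [apply IH; lia|now apply is_Int0infR_scal].
Qed.

Lemma lag_residual_energy E0 c N :
  is_Int0infR (fun t => weight b t * (tail_density t * tail_density t)) E0 ->
  is_Int0infR (fun t => weight b t * (tail_density t - lag_sum c N t) ^ 2) (lag_energy E0 c N).
Proof.
  intros H0; induction N as [|N IH]; simpl lag_energy.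
  - revert H0; apply is_Int0infR_ext; intros t Ht; simpl; ring.
  - assert (HO := Laguerre_orthogonal N N b ltac:(lra)).
    destruct (Nat.eq_dec N N) as [_|?]; [|lia].
    assert (HR := lag_residual_orthogonal c N N (le_n N)).
    apply (is_Int0infR_ext (fun t => weight b t * (tail_density t - lag_sum c N t) ^ 2
      - 2 * c N * (weight b t * (Laguerre N b t * (tail_density t - lag_sum c N t)))
      + c N * c N * (weight b t * (Laguerre N b t * Laguerre N b t)))).
    + intros t Ht; simpl; ring.
    + apply is_Int0infR_plus; [apply is_Int0infR_minus|]; [exact IH| |];
        now apply is_Int0infR_scal.
Qed.

Definition lag_coef (n : nat) : R := Laguerre n (b - 1) lam / lag_norm b n.

(** Completing the square: the quadratic in [c n] is least at [lag_coef n]. *)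
Lemma lag_energy_min E0 c N : lag_energy E0 lag_coef N <= lag_energy E0 c N.
Proof.
  induction N as [|N IH]; simpl; [lra|].
  assert (h := lag_norm_pos b N ltac:(lra)).
  assert (E : c N * c N * lag_norm b N - 2 * c N * Laguerre N (b - 1) lam
    = lag_norm b N * (c N - lag_coef N) ^ 2
      + (lag_coef N * lag_coef N * lag_norm b N - 2 * lag_coef N * Laguerre N (b - 1) lam)).
  { unfold lag_coef; field; lra. }
  assert (0 <= lag_norm b N * (c N - lag_coef N) ^ 2) by (apply Rmult_le_pos; [lra|apply pow2_ge_0]).
  lra.
Qed.

Lemma lag_energy_decr E0 n N : (n <= N)%nat -> lag_energy E0 lag_coef N <= lag_energy E0 lag_coef n.
Proof.
  intros H; induction H as [|N H IH]; [lra|]; simpl.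
  assert (h := lag_norm_pos b N ltac:(lra)).
  assert (E : lag_coef N * lag_coef N * lag_norm b N - 2 * lag_coef N * Laguerre N (b - 1) lam
    = - (lag_norm b N * lag_coef N ^ 2)) by (unfold lag_coef; field; lra).
  assert (0 <= lag_norm b N * lag_coef N ^ 2) by (apply Rmult_le_pos; [lra|apply pow2_ge_0]).
  lra.
Qed.

(** Asks for approximation by arbitrary Laguerre combinations; [lag_energy_min] transfers it to the
    partial sums of the expansion. *)
Definition tail_approximable : Prop :=
  forall e, 0 < e -> exists N c (l : R),
    is_Int0infR (fun t => weight b t * (tail_density t - lag_sum c N t) ^ 2) l /\ l < e.

Lemma lag_energy_lim E0 :
  is_Int0infR (fun t => weight b t * (tail_density t * tail_density t)) E0 ->
  tail_approximable ->
  forall e, 0 < e -> exists N0, forall N, (N0 <= N)%nat -> lag_energy E0 lag_coef N < e.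
Proof.
  intros H0 H e He; destruct (H e He) as [N0 [c [l [Hl Hle]]]].
  exists N0; intros N HN.
  apply Rle_lt_trans with (lag_energy E0 lag_coef N0); [now apply lag_energy_decr|].
  apply Rle_lt_trans with (lag_energy E0 c N0); [apply lag_energy_min|].
  now rewrite (is_Int0infR_inj _ _ _ (lag_residual_energy E0 c N0 H0) Hl).
Qed.

(** The two normalisations meet here: the [n]-th term of the series is the integral of [y] against
    [w_b] times the [n]-th Laguerre term of [tail_density]. *)
Lemma ell_lag_coef n t : 0 < t ->
  Laguerre n (b - 1) lam * ell n b t = weight b t * (lag_coef n * Laguerre n b t).
Proof.
  intros Ht; unfold ell, lag_coef, lag_norm, weight; assert (h := pos_INR n).
  assert (hG := Gamma_pos (INR n + b + 1) ltac:(lra)).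
  field; split; [apply INR_fact_neq_0|lra].
Qed.

End Expansion.

Section VectorExpansion.
Context {X0 : CompleteNormedModule R_AbsRing}.
Local Notation X := (CompleteNormedModule.NormedModule R_AbsRing X0).

(* The error after [N] terms is the integral of [y] against the residual of the Laguerre
   expansion of [tail_density], which is small in the weighted [L^2] norm. *)
Lemma laguerre_expansion (b lam : R) (y : R -> X) (Y : R -> R) (ly : R) (c : nat -> X) (u : X) :
  0 < b -> 0 < lam -> tail_approximable b lam ->
  (forall t, 0 < t -> norm (y t) <= Y t) ->
  is_Int0infR (fun t => weight b t * Y t ^ 2) ly ->
  (forall n, is_Int0inf (fun t => scal (ell n b t) (y t)) (c n)) ->
  is_Int0inf (step (V0 := X0) lam (fun _ => zero) (fun s => scal (exp (lam - s)) (y s))) u ->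
  is_series (fun n => scal (Laguerre n (b - 1) lam) (c n)) u.
Proof.
  intros Hb Hlam Happ HY Hly Hc Hu.
  destruct (ex_tail_energy b lam Hb Hlam) as [E0 HE0].
  assert (Hly0 : 0 <= ly).
  { revert Hly; apply is_Int0infR_ge0; intros t Ht.
    apply Rmult_le_pos; [left; apply weight_pos|apply pow2_ge_0]. }
  set (a := fun n => scal (Laguerre n (b - 1) lam) (c n)).
  (* The index shifts by one: [sum_n a n] includes the term [n], whereas [lag_sum] at [S n] runs
     over the indices below [S n]. *)
  assert (HS : forall n, is_Int0inf
    (fun t => scal (weight b t * lag_sum b (lag_coef b lam) (S n) t) (y t)) (sum_n a n)).
  { assert (H1 : forall n, is_Int0inf (fun t => scal (weight b t * (lag_coef b lam n * Laguerre n b t)) (y t)) (a n)).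
    { intros n; apply (is_Int0inf_ext (V0 := X0) (fun t => scal (Laguerre n (b - 1) lam) (scal (ell n b t) (y t)))).
      - intros t Ht; rewrite <- (ell_lag_coef b lam Hb) by easy; module_eq.
      - apply is_Int0inf_scal, Hc. }
    induction n as [|n IH].
    - rewrite sum_O; generalize (H1 O); apply (is_Int0inf_ext (V0 := X0)); intros t Ht.
      f_equal; simpl; ring.
    - rewrite sum_Sn; assert (HP := is_Int0inf_plus _ _ _ _ IH (H1 (S n))).
      revert HP; apply (is_Int0inf_ext (V0 := X0)); intros t Ht.
      change (lag_sum b (lag_coef b lam) (S (S n)) t)
        with (lag_sum b (lag_coef b lam) (S n) t + lag_coef b lam (S n) * Laguerre (S n) b t).
      module_eq. }
  (* Cauchy-Schwarz with a free parameter: [k/2 D^2 + Y^2/(2k) - D Y] is [(k D - Y)^2 / (2k)].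
     Pointwise domination by this sum suffices, so no integral of [D Y] has to be factored. *)
  assert (bound : forall n k, 0 < k -> norm (minus u (sum_n a n)) <=
    k / 2 * lag_energy b lam E0 (lag_coef b lam) (S n) + / (2 * k) * ly).
  { intros n k Hk.
    assert (HD : is_Int0inf (fun t => scal (weight b t * (tail_density b lam t
        - lag_sum b (lag_coef b lam) (S n) t)) (y t)) (minus u (sum_n a n))).
    { assert (HM := is_Int0inf_minus _ _ _ _ Hu (HS n)).
      revert HM; apply (is_Int0inf_ext (V0 := X0)); intros t Ht.
      rewrite Rmult_minus_distr_l, (weight_tail_density b lam) by easy.
      unfold step, stepR; destruct (Rlt_dec t lam); module_eq. }
    destruct (is_Int0inf_dominated (V0 := X0) _
      (fun t => k / 2 * (weight b t * (tail_density b lam t - lag_sum b (lag_coef b lam) (S n) t) ^ 2)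
                + / (2 * k) * (weight b t * Y t ^ 2))
      (k / 2 * lag_energy b lam E0 (lag_coef b lam) (S n) + / (2 * k) * ly)
      (is_Int0inf_loc (V0 := X0) _ _ HD)) as [l [Hl Hn]].
    - intros t Ht; rewrite norm_scal_R, Rabs_mult, (Rabs_pos_eq (weight b t)) by (left; apply weight_pos).
      assert (hw := weight_pos b t); specialize (HY t Ht).
      set (D := tail_density b lam t - lag_sum b (lag_coef b lam) (S n) t).
      apply Rle_trans with (weight b t * (Rabs D * Y t)).
      + rewrite Rmult_assoc; apply Rmult_le_compat_l; [lra|].
        apply Rmult_le_compat_l; [apply Rabs_pos|easy].
      + rewrite <- (Rmult_assoc (k / 2)), (Rmult_comm (k / 2)), (Rmult_assoc (weight b t)),
          <- (Rmult_assoc (/ (2 * k))), (Rmult_comm (/ (2 * k))), (Rmult_assoc (weight b t)),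
          <- Rmult_plus_distr_l.
        apply Rmult_le_compat_l; [lra|].
        assert (Q : k / 2 * D ^ 2 + / (2 * k) * Y t ^ 2 - Rabs D * Y t
          = / (2 * k) * (k * Rabs D - Y t) ^ 2).
        { rewrite <- (pow2_abs D); field; lra. }
        assert (0 <= / (2 * k) * (k * Rabs D - Y t) ^ 2).
        { apply Rmult_le_pos; [left; apply Rinv_0_lt_compat; lra|apply pow2_ge_0]. }
        lra.
    - apply is_Int0infR_plus; apply is_Int0infR_scal; [|easy].
      now apply lag_residual_energy.
    - now rewrite (is_Int0inf_inj (V0 := X0) _ _ _ HD Hl). }
  apply (filterlim_norm_eps (V := X) eventually); intros e He.
  (* This [k] keeps the contribution of [Y] below [e / 2] for every [n]; it is fixed before the
     energy is made smaller than [e / k]. *)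
  set (k := (ly + 1) / e).
  assert (Hk : 0 < k) by (apply Rdiv_lt_0_compat; lra).
  destruct (lag_energy_lim b lam Hb Hlam E0 HE0 Happ (e / k)) as [N0 HN].
  { now apply Rdiv_lt_0_compat. }
  exists N0; intros n Hn; rewrite norm_minus_sym.
  eapply Rle_lt_trans; [now apply (bound n k)|].
  specialize (HN (S n) ltac:(lia)).
  assert (B1 : k / 2 * lag_energy b lam E0 (lag_coef b lam) (S n) < e / 2).
  { apply Rlt_le_trans with (k / 2 * (e / k)); [apply Rmult_lt_compat_l; lra|right; field; lra]. }
  assert (B2 : / (2 * k) * ly <= e / 2).
  { unfold k; replace (/ (2 * ((ly + 1) / e)) * ly) with (e / 2 * (ly / (ly + 1))) by (field; lra).
    rewrite <- (Rmult_1_r (e / 2)) at 2; apply Rmult_le_compat_l; [lra|].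
    apply Rle_div_l; lra. }
  lra.
Qed.

End VectorExpansion.

(** * Completeness *)

Lemma nonneg_of_derive (f f' : R -> R) x :
  0 <= x -> (forall t, is_derive f t (f' t)) -> f 0 = 0 ->
  (forall t, 0 <= t -> 0 <= f' t) -> 0 <= f x.
Proof.
  intros [Hx|Hx] Hd H0 Hp; [|subst; lra].
  destruct (MVT_gen f 0 x f') as [c [Hc E]].
  - intros t _; apply Hd.
  - intros t _; apply continuity_pt_filterlim.
    apply (ex_derive_continuous (V := R_NormedModule)); eexists; apply Hd.
  - rewrite Rmin_left in Hc by lra.
    specialize (Hp c ltac:(lra)); rewrite H0 in E.
    assert (0 <= f' c * (x - 0)) by (apply Rmult_le_pos; lra); lra.
Qed.

(** The first [J] terms of the series of [e^(-x)], hence degree below [J]; differentiation then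
    lowers [J] by one and changes the sign. *)
Fixpoint exp_taylor (J : nat) (x : R) : R :=
  match J with
  | O => 0
  | S j => exp_taylor j x + (- x) ^ j / INR (fact j)
  end.

Lemma exp_taylor_0 J : exp_taylor (S J) 0 = 1.
Proof.
  induction J as [|J IH]; [simpl; field|].
  change (exp_taylor (S (S J)) 0) with (exp_taylor (S J) 0 + (- 0) ^ S J / INR (fact (S J))).
  rewrite IH; replace ((- 0) ^ S J) with 0 by (simpl; ring); field; apply INR_fact_neq_0.
Qed.

Lemma is_derive_exp_taylor J x : is_derive (exp_taylor (S J)) x (- exp_taylor J x).
Proof.
  induction J as [|J IH].
  - simpl; apply (is_derive_ext (fun _ => 0 + 1 / 1)); [easy|].
    rewrite Ropp_0; apply (is_derive_const (V := R_NormedModule)).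
  - apply (is_derive_ext (fun x => exp_taylor (S J) x + (- x) ^ S J / INR (fact (S J)))); [easy|].
    replace (- exp_taylor (S J) x)
      with (plus (- exp_taylor J x) (- ((- x) ^ J / INR (fact J)))).
    2: { simpl; unfold plus; simpl; ring. }
    apply (is_derive_plus (V := R_NormedModule)); [exact IH|].
    auto_derive; [easy|].
    change (match J with O => 1 | S _ => INR J + 1 end) with (INR (S J)).
    rewrite S_INR, plus_INR, mult_INR.
    assert (h := pos_INR J); assert (hf := INR_fact_lt_0 J); field; split; nra.
Qed.

(** The signed remainder of order [S J] vanishes at 0 and has the one of order [J] as derivative, so
    both bounds pass on by monotonicity. *)
Lemma exp_taylor_remainder J : forall x, 0 <= x ->
  0 <= (-1) ^ J * (exp (- x) - exp_taylor J x) <= x ^ J / INR (fact J).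
Proof.
  induction J as [|J IH]; intros x Hx.
  - simpl; rewrite Rminus_0_r, Rmult_1_l; split; [left; apply exp_pos|].
    replace (1 / 1) with 1 by field; apply exp_le_1; lra.
  - assert (D : forall t, is_derive (fun x => (-1) ^ S J * (exp (- x) - exp_taylor (S J) x)) t
      ((-1) ^ J * (exp (- t) - exp_taylor J t))).
    { intros t; replace ((-1) ^ J * (exp (- t) - exp_taylor J t))
        with ((-1) ^ S J * (- exp (- t) - - exp_taylor J t)) by (simpl; ring).
      apply (is_derive_scal (fun x => exp (- x) - exp_taylor (S J) x)).
      apply (is_derive_minus (V := R_NormedModule)); [auto_derive; [easy|ring]|apply is_derive_exp_taylor]. }
    assert (Z : (-1) ^ S J * (exp (- 0) - exp_taylor (S J) 0) = 0).
    { rewrite exp_taylor_0, Ropp_0, exp_0; ring. }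
    split.
    + apply (nonneg_of_derive (fun x => (-1) ^ S J * (exp (- x) - exp_taylor (S J) x)) _ x Hx D Z).
      intros t Ht; now apply IH.
    + assert (P : 0 <= x ^ S J / INR (fact (S J)) - (-1) ^ S J * (exp (- x) - exp_taylor (S J) x)); [|lra].
      apply (nonneg_of_derive (fun x => x ^ S J / INR (fact (S J)) - (-1) ^ S J * (exp (- x) - exp_taylor (S J) x))
        (fun t => t ^ J / INR (fact J) - (-1) ^ J * (exp (- t) - exp_taylor J t)) x Hx).
      * intros t; apply (is_derive_minus (V := R_NormedModule)); [|apply D].
        auto_derive; [easy|].
        change (match J with O => 1 | S _ => INR J + 1 end) with (INR (S J)).
        rewrite S_INR, plus_INR, mult_INR.
        assert (h := pos_INR J); assert (hf := INR_fact_lt_0 J); field; split; nra.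
      * rewrite Z; simpl; field; apply (INR_fact_neq_0 (S J)).
      * intros t Ht; specialize (IH t Ht); lra.
Qed.

Lemma exp_taylor_error J x : 0 <= x -> (exp (- x) - exp_taylor J x) ^ 2 <= (x ^ J / INR (fact J)) ^ 2.
Proof.
  intros Hx; assert (H := exp_taylor_remainder J x Hx).
  replace ((exp (- x) - exp_taylor J x) ^ 2) with (((-1) ^ J * (exp (- x) - exp_taylor J x)) ^ 2).
  - apply pow_incr; exact H.
  - rewrite Rpow_mult_distr, <- pow_mult, Nat.mul_comm, pow_mult.
    replace ((-1) ^ 2) with 1 by ring; rewrite pow1; ring.
Qed.

(* The expectation of [phi] under the binomial law of parameters [n] and [v]; applied to
   [phi k = H (k / n)] it is the [n]-th Bernstein polynomial of [H]. *)
Fixpoint bernstein (n : nat) (phi : nat -> R) (v : R) : R :=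
  match n with
  | O => phi O
  | S m => v * bernstein m (fun k => phi (S k)) v + (1 - v) * bernstein m phi v
  end.

Lemma bernstein_le n v : 0 <= v <= 1 -> forall phi psi,
  (forall k, (k <= n)%nat -> phi k <= psi k) -> bernstein n phi v <= bernstein n psi v.
Proof.
  intros Hv; induction n as [|n IH]; intros phi psi H; simpl; [now apply H|].
  apply Rplus_le_compat; apply Rmult_le_compat_l; try lra; apply IH; intros; apply H; lia.
Qed.

Lemma bernstein_affine n v r s : forall phi,
  bernstein n (fun k => r + s * phi k) v = r + s * bernstein n phi v.
Proof.
  induction n as [|n IH]; intros phi; simpl; [easy|].
  rewrite (IH phi), (IH (fun k => phi (S k))); ring.
Qed.

(** The second moment about an arbitrary point [c]: the shift [k -> S k] in the recursion replaces
    [c] by [c - 1]. *)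
Lemma bernstein_variance n v : forall c,
  bernstein n (fun k => (INR k - c) ^ 2) v = INR n * v * (1 - v) + (INR n * v - c) ^ 2.
Proof.
  induction n as [|n IH]; intros c; [simpl; ring|].
  change (v * bernstein n (fun k => (INR (S k) - c) ^ 2) v
    + (1 - v) * bernstein n (fun k => (INR k - c) ^ 2) v
    = INR (S n) * v * (1 - v) + (INR (S n) * v - c) ^ 2).
  replace (bernstein n (fun k => (INR (S k) - c) ^ 2) v)
    with (bernstein n (fun k => (INR k - (c - 1)) ^ 2) v).
  - rewrite !IH, S_INR; ring.
  - assert (E : forall m (f g : nat -> R), (forall k, f k = g k) -> bernstein m f v = bernstein m g v).
    { induction m as [|m IHm]; intros f g H; simpl; [apply H|].
      now rewrite (IHm f g), (IHm (fun k => f (S k)) (fun k => g (S k))). }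
    apply E; intros k; rewrite S_INR; f_equal; ring.
Qed.

(** Bernstein's argument by Chebyshev's inequality. With [A = 2 B / d^2] the quadratic
    [A (k/n - v)^2] exceeds the oscillation of [H] at distance at least [d], and uniform continuity
    covers smaller distances. The quadratic has mean [A v (1 - v) / n], small once [n > A / e]. *)
Lemma bernstein_uniform (H : R -> R) e :
  (forall v, 0 <= v <= 1 -> continuous H v) -> 0 < e ->
  exists n, forall v, 0 <= v <= 1 -> Rabs (bernstein n (fun k => H (INR k / INR n)) v - H v) <= e.
Proof.
  intros Hc He.
  destruct (bounded_continuity (V := R_NormedModule) H 0 1 Hc) as [B HB].
  assert (HB' : forall v, 0 <= v <= 1 -> Rabs (H v) < B) by exact HB.
  assert (B0 : 0 < B).
  { eapply Rle_lt_trans; [apply Rabs_pos|apply (HB' 0); lra]. }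
  assert (Hc' : forall v, 0 <= v <= 1 -> continuity_pt H v).
  { intros v Hv; apply continuity_pt_filterlim; now apply Hc. }
  destruct (Heine_cor2 Hc' (mkposreal (e / 2) ltac:(lra))) as [d Hd].
  simpl in Hd; destruct d as [d dpos]; simpl in Hd.
  assert (Hd2 : 0 < d ^ 2) by (apply pow_lt; lra).
  set (A := 2 * B / d ^ 2); assert (HA : 0 < A) by (apply Rdiv_lt_0_compat; lra).
  destruct (INR_unbounded (A / e)) as [n Hn].
  exists n; intros v Hv.
  assert (n0 : 0 < INR n) by (assert (0 < A / e) by (apply Rdiv_lt_0_compat; lra); lra).
  assert (point : forall k, (k <= n)%nat -> Rabs (H (INR k / INR n) - H v)
      <= e / 2 + A / INR n ^ 2 * (INR k - INR n * v) ^ 2).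
  { intros k Hk; apply le_INR in Hk; assert (hk := pos_INR k).
    assert (Hkn : 0 <= INR k / INR n <= 1).
    { split; [apply Rmult_le_pos; [lra|left; now apply Rinv_0_lt_compat]|].
      apply Rle_div_l; lra. }
    replace (A / INR n ^ 2 * (INR k - INR n * v) ^ 2) with (A * (INR k / INR n - v) ^ 2) by (field; lra).
    destruct (Rlt_dec (Rabs (INR k / INR n - v)) d) as [h|h].
    - specialize (Hd (INR k / INR n) v Hkn Hv h).
      assert (0 <= A * (INR k / INR n - v) ^ 2) by (apply Rmult_le_pos; [lra|apply pow2_ge_0]); lra.
    - assert (h2 : d ^ 2 <= (INR k / INR n - v) ^ 2).
      { rewrite <- (pow2_abs (INR k / INR n - v)); apply pow_incr; lra. }
      assert (Q : 2 * B <= A * (INR k / INR n - v) ^ 2).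
      { apply Rle_trans with (A * d ^ 2); [right; unfold A; field; lra|].
        apply Rmult_le_compat_l; lra. }
      assert (T := Rabs_triang (H (INR k / INR n)) (- H v)); rewrite Rabs_Ropp in T.
      assert (h3 := HB' _ Hkn); assert (h4 := HB' v Hv); unfold Rminus; lra. }
  assert (small : A / INR n ^ 2 * (INR n * v * (1 - v) + (INR n * v - INR n * v) ^ 2) <= e / 2).
  { replace (A / INR n ^ 2 * (INR n * v * (1 - v) + (INR n * v - INR n * v) ^ 2))
      with (A / INR n * (v * (1 - v))) by (field; lra).
    assert (A / INR n <= e).
    { apply Rle_div_l; [lra|]; apply (Rmult_lt_compat_l e) in Hn; [|lra].
      replace (e * (A / e)) with A in Hn by (field; lra); lra. }
    assert (0 < A / INR n) by (now apply Rdiv_lt_0_compat).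
    assert (0 <= v * (1 - v) <= / 2) by nra.
    apply Rle_trans with (A / INR n * / 2); [apply Rmult_le_compat_l|]; lra. }
  set (psi := fun k => (INR k - INR n * v) ^ 2).
  assert (V := bernstein_variance n v (INR n * v)).
  apply Rabs_le; split.
  - apply Rle_trans with (H v - (e / 2 + A / INR n ^ 2 * bernstein n psi v) - H v).
    + unfold psi; rewrite V; lra.
    + apply Rplus_le_compat_r.
      replace (H v - (e / 2 + A / INR n ^ 2 * bernstein n psi v))
        with (H v - e / 2 + - (A / INR n ^ 2) * bernstein n psi v) by ring.
      rewrite <- bernstein_affine; apply bernstein_le; [easy|]; intros k Hk.
      specialize (point k Hk); fold (psi k) in point.
      assert (P := Rle_abs (- (H (INR k / INR n) - H v))); rewrite Rabs_Ropp in P; lra.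
  - apply Rle_trans with (H v + e / 2 + A / INR n ^ 2 * bernstein n psi v - H v).
    + apply Rplus_le_compat_r.
      rewrite <- bernstein_affine; apply bernstein_le; [easy|]; intros k Hk.
      specialize (point k Hk); fold (psi k) in point.
      assert (P := Rle_abs (H (INR k / INR n) - H v)); lra.
    + unfold psi; rewrite V; lra.
Qed.

(** * The closure of the polynomials in the weighted [L^2] space *)

Section Density.
Variables (b lam : R).
Hypothesis bpos : 0 < b.
Hypothesis lampos : 0 < lam.

Local Notation pwc := (pw_continuous lam).

Definition lag_span (p : R -> R) : Prop := exists N c, forall t, p t = lag_sum b c N t.

(** Zero padding brings two combinations to a common length before they are added. *)
Lemma lag_sum_pad c N M t : (N <= M)%nat ->
  lag_sum b (fun k => if lt_dec k N then c k else 0) M t = lag_sum b c N t.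
Proof.
  assert (E : forall n, (n <= N)%nat -> lag_sum b (fun k => if lt_dec k N then c k else 0) n t = lag_sum b c n t).
  { induction n as [|n IH]; intros Hn; simpl; [easy|].
    rewrite IH by lia; destruct (lt_dec n N); [easy|lia]. }
  intros H; induction H as [|M H IH]; [now apply E|].
  simpl; rewrite IH; destruct (lt_dec M N); [lia|ring].
Qed.

Lemma lag_span_plus p q : lag_span p -> lag_span q -> lag_span (fun t => p t + q t).
Proof.
  intros [N [c Hp]] [N' [c' Hq]].
  exists (max N N'), (fun k => (if lt_dec k N then c k else 0) + (if lt_dec k N' then c' k else 0)).
  intros t; rewrite Hp, Hq.
  rewrite <- (lag_sum_pad c N (max N N')), <- (lag_sum_pad c' N' (max N N')) by lia.
  generalize (max N N'); induction n as [|n IH]; simpl; [ring|]; rewrite <- IH; ring.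
Qed.

Lemma lag_span_scal r p : lag_span p -> lag_span (fun t => r * p t).
Proof.
  intros [N [c Hp]]; exists N, (fun k => r * c k); intros t; rewrite Hp.
  clear Hp; induction N as [|N IH]; simpl; [ring|]; rewrite <- IH; ring.
Qed.

Lemma lag_span_ext p q : (forall t, p t = q t) -> lag_span p -> lag_span q.
Proof. intros H [N [c Hp]]; exists N, c; intros t; now rewrite <- H. Qed.

Lemma lag_span_Laguerre n : lag_span (Laguerre n b).
Proof.
  exists (S n), (fun k => if Nat.eq_dec k n then 1 else 0); intros t; simpl.
  assert (E : forall m, (m <= n)%nat -> lag_sum b (fun k => if Nat.eq_dec k n then 1 else 0) m t = 0).
  { induction m as [|m IH]; intros Hm; simpl; [easy|].
    rewrite IH by lia; destruct (Nat.eq_dec m n); [lia|ring]. }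
  rewrite E by lia; destruct (Nat.eq_dec n n); [ring|lia].
Qed.

(** From [t L_n^b = (n + b) L_n^(b-1) - (n + 1) L_(n+1)^(b-1)] and
    [L_(m+1)^(b-1) = L_(m+1)^b - L_m^b]. Monomials are thus reached without inverting the triangular
    change of basis. *)
Lemma lag_span_mult_t p : lag_span p -> lag_span (fun t => t * p t).
Proof.
  assert (HL : forall n, lag_span (fun t => t * Laguerre n b t)).
  { intros n.
    assert (E : forall t, t * Laguerre n b t
      = (INR n + b) * Laguerre n (b - 1) t - (INR n + 1) * Laguerre (S n) (b - 1) t).
    { intros t; assert (H := Laguerre_step n (b - 1) t).
      replace (b - 1 + 1) with b in H by ring; lra. }
    assert (E1 : forall m t, Laguerre (S m) (b - 1) t = Laguerre (S m) b t + -1 * Laguerre m b t).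
    { intros m t; assert (H := Laguerre_param_succ m (b - 1) t).
      replace (b - 1 + 1) with b in H by ring; lra. }
    assert (D : forall m, lag_span (Laguerre (S m) (b - 1))).
    { intros m; apply (lag_span_ext (fun t => Laguerre (S m) b t + -1 * Laguerre m b t)); [intros; now rewrite E1|].
      apply lag_span_plus; [apply lag_span_Laguerre|apply lag_span_scal, lag_span_Laguerre]. }
    apply (lag_span_ext (fun t => (INR n + b) * Laguerre n (b - 1) t + - (INR n + 1) * Laguerre (S n) (b - 1) t)).
    { intros t; rewrite E; ring. }
    apply lag_span_plus; apply lag_span_scal; [|apply D].
    destruct n as [|n]; [|apply D].
    apply (lag_span_ext (Laguerre 0 b)); [intros; now rewrite !Laguerre_0|apply lag_span_Laguerre]. }
  intros [N [c Hp]]; apply (lag_span_ext (fun t => t * lag_sum b c N t)); [intros; now rewrite Hp|].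
  clear Hp p; induction N as [|N IH].
  - apply (lag_span_ext (fun t => 0 * Laguerre 0 b t)); [intros; simpl; ring|].
    apply lag_span_scal, lag_span_Laguerre.
  - apply (lag_span_ext (fun t => t * lag_sum b c N t + c N * (t * Laguerre N b t))); [intros; simpl; ring|].
    apply lag_span_plus; [exact IH|apply lag_span_scal, HL].
Qed.

Lemma lag_span_pow m : lag_span (fun t => t ^ m).
Proof.
  induction m as [|m IH]; [|now apply (lag_span_mult_t (fun t => t ^ m))].
  apply (lag_span_ext (Laguerre 0 b)); [intros; now rewrite Laguerre_0|apply lag_span_Laguerre].
Qed.

Lemma pw_span p : lag_span p -> pwc p.
Proof.
  intros [N [c Hp]]; apply pw_continuous_cont; intros t Ht.
  apply (continuous_ext (lag_sum b c N)); [intros; now rewrite Hp|apply continuous_lag_sum].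
Qed.

(** Here [e] bounds the squared distance, so the triangle inequality takes the form
    [(u + v)^2 <= 2 u^2 + 2 v^2]. *)
Definition L2_close (f g : R -> R) (e : R) : Prop :=
  exists l : R, is_Int0infR (fun t => weight b t * (f t - g t) ^ 2) l /\ l < e.

Lemma pw_weight_sq f g : pwc f -> pwc g -> loc_intR (fun t => weight b t * (f t - g t) ^ 2).
Proof.
  intros Hf Hg; apply (pw_continuous_loc_int lam).
  apply (pw_continuous_mult lam (weight b)).
  - apply pw_continuous_cont; intros; now apply continuous_weight.
  - destruct (pw_continuous_mult lam _ _ (pw_continuous_minus lam f g Hf Hg) (pw_continuous_minus lam f g Hf Hg))
      as [u1 [u2 [H1 [H2 H]]]].
    exists u1, u2; repeat split; auto; intros t Ht; rewrite <- H by easy; ring.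
Qed.

Lemma L2_close_dominated f g (h : R -> R) lh e : pwc f -> pwc g ->
  is_Int0infR h lh -> lh < e -> (forall t, 0 < t -> weight b t * (f t - g t) ^ 2 <= h t) -> L2_close f g e.
Proof.
  intros Hf Hg Hh Hl H.
  destruct (is_Int0infR_dominated _ h lh (pw_weight_sq f g Hf Hg)) as [l [Hl1 Hl2]]; [|easy|].
  - intros t Ht; rewrite Rabs_pos_eq; [now apply H|].
    apply Rmult_le_pos; [left; apply weight_pos|apply pow2_ge_0].
  - exists l; split; [easy|]; assert (h0 := Rle_abs l); lra.
Qed.

Lemma L2_close_trans f g k e1 e2 : pwc f -> pwc k -> L2_close f g e1 -> L2_close g k e2 -> L2_close f k (2 * e1 + 2 * e2).
Proof.
  intros Hf Hk [l1 [H1 L1]] [l2 [H2 L2]].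
  apply (L2_close_dominated f k (fun t => 2 * (weight b t * (f t - g t) ^ 2) + 2 * (weight b t * (g t - k t) ^ 2))
    (2 * l1 + 2 * l2)); try easy; [|lra|].
  - apply is_Int0infR_plus; now apply is_Int0infR_scal.
  - intros t Ht; assert (hw := weight_pos b t).
    replace (2 * (weight b t * (f t - g t) ^ 2) + 2 * (weight b t * (g t - k t) ^ 2))
      with (weight b t * (2 * (f t - g t) ^ 2 + 2 * (g t - k t) ^ 2)) by ring.
    apply Rmult_le_compat_l; [lra|].
    assert (0 <= ((f t - g t) - (g t - k t)) ^ 2) by apply pow2_ge_0; nra.
Qed.

(** Membership in the closure. Piecewise continuity is carried along because the comparison test
    needs local integrability of the squared differences. *)
Definition approx (f : R -> R) : Prop :=
  pwc f /\ forall e, 0 < e -> exists p, lag_span p /\ L2_close f p e.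

Lemma approx_limit f : pwc f -> (forall e, 0 < e -> exists g, approx g /\ L2_close f g e) -> approx f.
Proof.
  intros Hf H; split; [easy|]; intros e He.
  destruct (H (e / 4) ltac:(lra)) as [g [[Hg Hgp] Hfg]].
  destruct (Hgp (e / 4) ltac:(lra)) as [p [Hp Hpc]].
  exists p; split; [easy|].
  replace e with (2 * (e / 4) + 2 * (e / 4)) by field.
  apply L2_close_trans with g; auto using pw_span.
Qed.

Lemma approx_ext f g : (forall t, 0 < t -> f t = g t) -> approx f -> approx g.
Proof.
  intros E [[f1 [f2 [H1 [H2 H]]]] Ha]; split.
  - exists f1, f2; repeat split; auto; intros t Ht; now rewrite <- E, H.
  - intros e He; destruct (Ha e He) as [p [Hp [l [Hl Hle]]]].
    exists p; split; [easy|]; exists l; split; [|easy].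
    revert Hl; apply is_Int0infR_ext; intros t Ht; now rewrite E.
Qed.

Lemma approx_span p : lag_span p -> approx p.
Proof.
  intros Hp; split; [now apply pw_span|]; intros e He; exists p; split; [easy|].
  apply (L2_close_dominated p p (fun t => 0 * weight b t) (0 * Gamma (b + 1))); try (now apply pw_span).
  - apply is_Int0infR_scal, is_Int0inf_weight; lra.
  - lra.
  - intros t Ht; right; ring.
Qed.

Lemma approx_lin r f s g : approx f -> approx g -> approx (fun t => r * f t + s * g t).
Proof.
  intros [Hf Ha] [Hg Hb].
  assert (P : pwc (fun t => r * f t + s * g t)).
  { destruct Hf as [f1 [f2 [H1 [H2 H]]]]; destruct Hg as [g1 [g2 [G1 [G2 G]]]].
    exists (fun t => r * f1 t + s * g1 t), (fun t => r * f2 t + s * g2 t); repeat split.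
    - intros t Ht; apply (continuous_plus (V := R_NormedModule)); apply (continuous_scal_r (V := R_NormedModule)); auto.
    - intros t Ht; apply (continuous_plus (V := R_NormedModule)); apply (continuous_scal_r (V := R_NormedModule)); auto.
    - intros t Ht; rewrite H, G by easy; unfold stepR; now destruct (Rlt_dec t lam). }
  split; [easy|]; intros e He.
  set (k := 2 * (r ^ 2 + s ^ 2) + 1).
  assert (Hk : 0 < k) by (unfold k; assert (h1 := pow2_ge_0 r); assert (h2 := pow2_ge_0 s); lra).
  assert (Hek : 0 < e / k) by now apply Rdiv_lt_0_compat.
  destruct (Ha (e / k) Hek) as [p [Hp [l1 [L1 E1]]]]; destruct (Hb (e / k) Hek) as [q [Hq [l2 [L2 E2]]]].
  assert (Hs : lag_span (fun t => r * p t + s * q t)) by (apply lag_span_plus; now apply lag_span_scal).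
  exists (fun t => r * p t + s * q t); split; [easy|].
  apply (L2_close_dominated _ _ (fun t => 2 * r ^ 2 * (weight b t * (f t - p t) ^ 2)
      + 2 * s ^ 2 * (weight b t * (g t - q t) ^ 2)) (2 * r ^ 2 * l1 + 2 * s ^ 2 * l2)); auto using pw_span.
  - apply is_Int0infR_plus; now apply is_Int0infR_scal.
  - apply Rle_lt_trans with ((k - 1) * (e / k)).
    + unfold k; replace ((2 * (r ^ 2 + s ^ 2) + 1 - 1) * (e / (2 * (r ^ 2 + s ^ 2) + 1)))
        with (2 * r ^ 2 * (e / k) + 2 * s ^ 2 * (e / k)) by (unfold k; ring).
      assert (h1 := pow2_ge_0 r); assert (h2 := pow2_ge_0 s).
      apply Rplus_le_compat; apply Rmult_le_compat_l; lra.
    + apply Rlt_le_trans with (k * (e / k)); [apply Rmult_lt_compat_r; lra|right; field; lra].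
  - intros t Ht; assert (hw := weight_pos b t).
    replace (2 * r ^ 2 * (weight b t * (f t - p t) ^ 2) + 2 * s ^ 2 * (weight b t * (g t - q t) ^ 2))
      with (weight b t * (2 * (r * (f t - p t)) ^ 2 + 2 * (s * (g t - q t)) ^ 2)) by ring.
    apply Rmult_le_compat_l; [lra|].
    assert (0 <= (r * (f t - p t) - s * (g t - q t)) ^ 2) by apply pow2_ge_0.
    replace (r * f t + s * g t - (r * p t + s * q t)) with (r * (f t - p t) + s * (g t - q t)) by ring.
    nra.
Qed.

(** The integral of [w_b(t) t^(2m) ((t/4)^J / J!)^2], a bound for the squared error of the [J]-term
    Taylor polynomial. *)
Definition taylor_moment (m J : nat) : R :=
  (/ 4) ^ (2 * J) / INR (fact J) ^ 2 * Gamma (b + INR (2 * m + 2 * J) + 1).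

Lemma is_Int0inf_weight_pow k : is_Int0infR (fun t => weight b t * t ^ k) (Gamma (b + INR k + 1)).
Proof.
  assert (h := pos_INR k).
  generalize (is_Int0inf_weight (b + INR k) ltac:(lra)); apply is_Int0infR_ext; intros t Ht.
  unfold weight; rewrite Rpower_plus, Rpower_pow by easy; ring.
Qed.

Lemma taylor_moment_lim m e : 0 < e -> exists J, taylor_moment m J < e.
Proof.
  intros He; set (x := b + INR (2 * m)).
  assert (hx : 0 < x) by (unfold x; assert (h := pos_INR (2 * m)); lra).
  destruct (INR_unbounded x) as [J0 HJ0].
  assert (Gp : forall J, 0 < Gamma (b + INR (2 * m + 2 * J) + 1)).
  { intros J; apply Gamma_pos; assert (h := pos_INR (2 * m + 2 * J)); lra. }
  assert (pos : forall J, 0 < taylor_moment m J).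
  { intros J; unfold taylor_moment; apply Rmult_lt_0_compat; [|apply Gp].
    apply Rdiv_lt_0_compat; apply pow_lt; [lra|apply INR_fact_lt_0]. }
  (* The quotient is [(y + 1) y / (16 (J + 1)^2)] with [y = x + 2 J + 1]. Once [J > x],
     [y < 3 J + 1], which gives [9 / 16]. *)
  assert (ratio : forall J, (J0 <= J)%nat -> taylor_moment m (S J) <= 9 / 16 * taylor_moment m J).
  { intros J HJ; apply le_INR in HJ.
    set (y := b + INR (2 * m + 2 * J) + 1).
    assert (Ey : y = x + 2 * INR J + 1) by (unfold y, x; rewrite plus_INR, (mult_INR 2 J); simpl; ring).
    assert (hJ := pos_INR J).
    unfold taylor_moment.
    replace (b + INR (2 * m + 2 * S J) + 1) with (y + 1 + 1)
      by (unfold y; replace (2 * m + 2 * S J)%nat with (S (S (2 * m + 2 * J))) by lia;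
          rewrite !S_INR; ring).
    fold y; rewrite !Gamma_succ by lra.
    replace (2 * S J)%nat with (S (S (2 * J))) by lia.
    change (fact (S J)) with (S J * fact J)%nat; rewrite mult_INR, S_INR.
    change ((/ 4) ^ S (S (2 * J))) with (/ 4 * (/ 4 * (/ 4) ^ (2 * J))).
    set (P := (/ 4) ^ (2 * J)); set (F := INR (fact J)).
    assert (hF : 0 < F) by apply INR_fact_lt_0.
    assert (hP : 0 < P) by (apply pow_lt; lra).
    assert (hG : 0 < Gamma y) by apply Gp.
    replace (/ 4 * (/ 4 * P) / ((INR J + 1) * F) ^ 2 * ((y + 1) * (y * Gamma y)))
      with ((y + 1) * y / (16 * (INR J + 1) ^ 2) * (P / F ^ 2 * Gamma y)) by (field; lra).
    apply Rmult_le_compat_r; [left; apply Rmult_lt_0_compat; [apply Rdiv_lt_0_compat; [easy|now apply pow_lt]|easy]|].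
    apply Rle_div_l; [apply Rmult_lt_0_compat; [lra|apply pow_lt; lra]|].
    rewrite Ey; nra. }
  assert (geo : forall i, taylor_moment m (J0 + i) <= taylor_moment m J0 * (9 / 16) ^ i).
  { induction i as [|i IH]; [rewrite Nat.add_0_r; simpl; lra|].
    replace (J0 + S i)%nat with (S (J0 + i)) by lia.
    eapply Rle_trans; [apply ratio; lia|]; simpl; nra. }
  destruct (pow_lt_1_zero (9 / 16)) with (y := e / taylor_moment m J0) as [i Hi].
  - rewrite Rabs_pos_eq; lra.
  - now apply Rdiv_lt_0_compat.
  - exists (J0 + i)%nat; specialize (Hi i (le_n i)).
    rewrite Rabs_pos_eq in Hi by (apply pow_le; lra).
    eapply Rle_lt_trans; [apply geo|].
    apply (Rmult_lt_compat_l (taylor_moment m J0)) in Hi; [|apply pos].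
    replace (taylor_moment m J0 * (e / taylor_moment m J0)) with e in Hi
      by (field; apply Rgt_not_eq, pos); exact Hi.
Qed.

(* Multiplying by one more factor [e^(-t/4)] and expanding it in a Taylor series converges in
   the weighted [L^2] norm because [1/4 < 1/2]. *)
Lemma approx_pow_exp k : forall m, approx (fun t => t ^ m * exp (- (t / 4)) ^ k).
Proof.
  induction k as [|k IH]; intros m.
  - apply (approx_ext (fun t => t ^ m)); [intros; simpl; ring|]; apply approx_span, lag_span_pow.
  - assert (P : forall j, pwc (fun t => t ^ m * exp (- (t / 4)) ^ j)).
    { intros j; apply pw_continuous_cont; intros t Ht.
      apply (ex_derive_continuous (V := R_NormedModule)); auto_derive; easy. }
    apply approx_limit; [apply P|]; intros e He.
    assert (A : forall J, approx (fun t => t ^ m * exp (- (t / 4)) ^ k * exp_taylor J (t / 4))).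
    { induction J as [|J IHJ]; simpl.
      - apply (approx_ext (fun t => 0 * (t ^ m * exp (- (t / 4)) ^ k) + 0 * (t ^ m * exp (- (t / 4)) ^ k)));
          [intros; ring|apply approx_lin; apply IH].
      - apply (approx_ext (fun t => 1 * (t ^ m * exp (- (t / 4)) ^ k * exp_taylor J (t / 4))
          + (- / 4) ^ J / INR (fact J) * (t ^ (m + J) * exp (- (t / 4)) ^ k))).
        + intros t Ht; rewrite pow_add; replace (- (t / 4)) with (- / 4 * t) by field.
          rewrite (Rpow_mult_distr (- / 4)); field; apply INR_fact_neq_0.
        + apply approx_lin; [exact IHJ|apply IH]. }
    destruct (taylor_moment_lim m e He) as [J HJ].
    exists (fun t => t ^ m * exp (- (t / 4)) ^ k * exp_taylor J (t / 4)); split; [apply A|].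
    apply (L2_close_dominated _ _ (fun t => (/ 4) ^ (2 * J) / INR (fact J) ^ 2 * (weight b t * t ^ (2 * m + 2 * J)))
      (taylor_moment m J)); [apply P|apply A| |easy|].
    + apply is_Int0infR_scal, is_Int0inf_weight_pow.
    + intros t Ht; assert (hw := weight_pos b t).
      replace (t ^ m * exp (- (t / 4)) ^ S k - t ^ m * exp (- (t / 4)) ^ k * exp_taylor J (t / 4))
        with (t ^ m * exp (- (t / 4)) ^ k * (exp (- (t / 4)) - exp_taylor J (t / 4))) by (simpl; ring).
      replace ((/ 4) ^ (2 * J) / INR (fact J) ^ 2 * (weight b t * t ^ (2 * m + 2 * J)))
        with (weight b t * ((t ^ m * 1) ^ 2 * ((t / 4) ^ J / INR (fact J)) ^ 2)).
      2: { replace ((t / 4) ^ J) with (t ^ J * (/ 4) ^ J) by (rewrite <- Rpow_mult_distr; easy).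
           rewrite pow_add, (Nat.mul_comm 2 J), (Nat.mul_comm 2 m), !pow_mult.
           field; apply INR_fact_neq_0. }
      apply Rmult_le_compat_l; [lra|]; rewrite (Rpow_mult_distr _ (exp (- (t / 4)) - exp_taylor J (t / 4))).
      apply Rmult_le_compat; [apply pow2_ge_0|apply pow2_ge_0| |apply exp_taylor_error; lra].
      apply pow_incr; split.
      * apply Rmult_le_pos; apply pow_le; [lra|left; apply exp_pos].
      * apply Rmult_le_compat_l; [apply pow_le; lra|].
        rewrite <- (pow1 k); apply pow_incr; split; [left; apply exp_pos|apply exp_le_1; lra].
Qed.

(** The free power [j] absorbs the factor [v = e^(-t/4)] that the recursion of [bernstein]
    produces. *)
Lemma approx_bernstein n : forall phi j,
  approx (fun t => exp (- (t / 4)) ^ j * bernstein n phi (exp (- (t / 4)))).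
Proof.
  induction n as [|n IH]; intros phi j; simpl.
  - apply (approx_ext (fun t => phi O * (t ^ 0 * exp (- (t / 4)) ^ j) + 0 * (t ^ 0 * exp (- (t / 4)) ^ j)));
      [intros; simpl; ring|apply approx_lin; apply approx_pow_exp].
  - apply (approx_ext (fun t => 1 * (1 * (exp (- (t / 4)) ^ S j * bernstein n (fun k => phi (S k)) (exp (- (t / 4))))
        + -1 * (exp (- (t / 4)) ^ S j * bernstein n phi (exp (- (t / 4)))))
      + 1 * (exp (- (t / 4)) ^ j * bernstein n phi (exp (- (t / 4)))))).
    + intros t Ht; simpl; ring.
    + apply approx_lin; [apply approx_lin|]; apply IH.
Qed.

Lemma approx_continuous (H : R -> R) :
  (forall v, continuous H v) -> approx (fun t => H (exp (- (t / 4)))).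
Proof.
  intros Hc.
  assert (P : pwc (fun t => H (exp (- (t / 4))))).
  { apply pw_continuous_cont; intros t Ht.
    apply (continuous_comp (fun t => exp (- (t / 4))) H); [|apply Hc].
    apply (ex_derive_continuous (V := R_NormedModule)); auto_derive; easy. }
  apply approx_limit; [exact P|]; intros e He.
  assert (hG := Gamma_pos (b + 1) ltac:(lra)).
  (* A uniform error [d <= 1] satisfies [d^2 <= d], so the squared distance is at most
     [d Gamma (b + 1) <= e / 2]. *)
  set (d := Rmin 1 (e / (2 * Gamma (b + 1)))).
  assert (hd : 0 < d) by (apply Rmin_glb_lt; [lra|apply Rdiv_lt_0_compat; lra]).
  assert (hd1 : d <= 1) by apply Rmin_l; assert (hd2 : d <= e / (2 * Gamma (b + 1))) by apply Rmin_r.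
  destruct (bernstein_uniform H d (fun v _ => Hc v) hd) as [n Hn].
  assert (A := approx_bernstein n (fun k => H (INR k / INR n)) 0).
  apply (approx_ext _ (fun t => bernstein n (fun k => H (INR k / INR n)) (exp (- (t / 4))))) in A;
    [|intros; simpl; ring].
  eexists; split; [exact A|].
  apply (L2_close_dominated _ _ (fun t => d * weight b t) (d * Gamma (b + 1))); [exact P|apply A| | |].
  - apply is_Int0infR_scal, is_Int0inf_weight; lra.
  - apply Rle_lt_trans with (e / (2 * Gamma (b + 1)) * Gamma (b + 1)); [apply Rmult_le_compat_r; lra|].
    replace (e / (2 * Gamma (b + 1)) * Gamma (b + 1)) with (e / 2) by (field; lra); lra.
  - intros t Ht; assert (hw := weight_pos b t); rewrite (Rmult_comm d); apply Rmult_le_compat_l; [lra|].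
    specialize (Hn (exp (- (t / 4))) ltac:(split; [left; apply exp_pos|apply exp_le_1; lra])).
    rewrite Rabs_minus_sym in Hn.
    rewrite <- pow2_abs; assert (h := Rabs_pos (H (exp (- (t / 4))) - bernstein n (fun k => H (INR k / INR n)) (exp (- (t / 4))))).
    simpl; rewrite Rmult_1_r; nra.
Qed.

End Density.

Lemma continuous_Rmax_const c x : continuous (fun x => Rmax c x) x.
Proof.
  apply (continuous_eps (V := R_NormedModule)); intros e He; exists e; split; [easy|]; intros s Hs.
  eapply Rle_lt_trans; [|exact Hs].
  change (Rabs (Rmax c s - Rmax c x) <= Rabs (s - x)).
  unfold Rmax; destruct (Rle_dec c s), (Rle_dec c x); unfold Rabs; repeat destruct Rcase_abs; lra.
Qed.

Lemma continuous_Rmin_const c x : continuous (fun x => Rmin c x) x.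
Proof.
  apply (continuous_eps (V := R_NormedModule)); intros e He; exists e; split; [easy|]; intros s Hs.
  eapply Rle_lt_trans; [|exact Hs].
  change (Rabs (Rmin c s - Rmin c x) <= Rabs (s - x)).
  unfold Rmin; destruct (Rle_dec c s), (Rle_dec c x); unfold Rabs; repeat destruct Rcase_abs; lra.
Qed.

Lemma is_Int0inf_interval (w : R -> R) a c :
  0 < a -> a < c -> (forall t, 0 < t -> continuous w t) ->
  is_Int0infR (stepR a (fun _ => 0) (stepR c w (fun _ => 0))) (RInt w a c).
Proof.
  intros Ha Hac Hw.
  assert (L : loc_intR (stepR c w (fun _ => 0))).
  { apply (loc_int_step (V0 := R_CompleteNormedModule) c w (fun _ => 0));
      apply (loc_int_continuous (V0 := R_CompleteNormedModule)); [easy|intros; apply continuous_const]. }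
  apply (is_Int0inf_step_zero (V0 := R_CompleteNormedModule) a (stepR c w (fun _ => 0))
    (RInt (stepR c w (fun _ => 0)) a)); [easy| |].
  - intros d Hd; apply (RInt_correct (V := R_CompleteNormedModule)), L; lra.
  - apply (filterlim_ext_loc (fun _ => RInt w a c)); [|apply filterlim_const].
    exists c; intros d Hd.
    rewrite <- (RInt_Chasles (V := R_CompleteNormedModule) (stepR c w (fun _ => 0)) a c d) by (apply L; lra).
    rewrite (RInt_ext (V := R_CompleteNormedModule) (stepR c w (fun _ => 0)) w a c).
    2: { intros t; rewrite Rmax_right by lra; intros Ht; unfold stepR; destruct (Rlt_dec t c); [easy|lra]. }
    rewrite (RInt_ext (V := R_CompleteNormedModule) (stepR c w (fun _ => 0)) (fun _ => 0) c d).
    2: { intros t; rewrite Rmin_left by lra; intros Ht; unfold stepR; destruct (Rlt_dec t c); [lra|easy]. }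
    rewrite (RInt_const (V := R_CompleteNormedModule)).
    unfold plus, scal; simpl; unfold mult; simpl; rewrite Rmult_0_r, Rplus_0_r; reflexivity.
Qed.

(* [tail_density] is smoothed by a linear ramp at [lam] and frozen beyond [N]; as a function of
   [v = e^(-t/4)] it is then continuous on [0, 1]. *)
Lemma tail_density_approximable b lam : 0 < b -> 0 < lam -> tail_approximable b lam.
Proof.
  intros Hb Hlam.
  assert (A : approx b lam (tail_density b lam)).
  2: { intros e He; destruct (proj2 A e He) as [p [[N [c Hp]] [l [Hl Hle]]]].
       exists N, c, l; split; [|easy]; revert Hl; apply is_Int0infR_ext; intros t Ht; now rewrite Hp. }
  apply approx_limit; [apply tail_density_pw|]; intros e He.
  set (B := exp lam * Rpower lam (- b)).
  assert (HB : 0 < B) by (apply Rmult_lt_0_compat; apply exp_pos).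
  assert (HB2 : 0 < B * B) by now apply Rmult_lt_0_compat.
  destruct (bounded_continuity (V := R_NormedModule) (weight b) lam (lam + 1)) as [F HF].
  { intros t Ht; apply continuous_weight; lra. }
  assert (HF' : forall t, lam <= t <= lam + 1 -> weight b t <= F).
  { intros t Ht; left; eapply Rle_lt_trans; [apply Rle_abs|apply (HF t Ht)]. }
  assert (F0 : 0 < F) by (assert (h := weight_pos b lam); specialize (HF' lam ltac:(lra)); lra).
  assert (G0 := Gamma_pos (b + 1 + 1) ltac:(lra)).
  (* The width of the ramp: there the squared error is at most [B^2] and the weight at most [F], so
     this stretch costs at most [e / 4]. *)
  set (eta := Rmin 1 (e / (4 * (B * B) * F))).
  assert (hq : 0 < e / (4 * (B * B) * F)) by (apply Rdiv_lt_0_compat; [lra|apply Rmult_lt_0_compat; lra]).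
  assert (eta0 : 0 < eta) by (apply Rmin_glb_lt; lra).
  assert (eta1 : eta <= 1) by apply Rmin_l; assert (eta2 : eta <= e / (4 * (B * B) * F)) by apply Rmin_r.
  (* Beyond [N] the weight [w_b] is at most [w_(b+1) / N], so the tail costs at most
     [B^2 Gamma (b + 2) / N <= e / 4]. The summand [lam + 1] places the ramp before [N]. *)
  set (N := lam + 1 + 4 * (B * B) * Gamma (b + 1 + 1) / e).
  assert (hN : 0 < 4 * (B * B) * Gamma (b + 1 + 1) / e).
  { apply Rdiv_lt_0_compat; [apply Rmult_lt_0_compat; lra|easy]. }
  assert (HN : lam + 1 < N) by (unfold N; lra).
  set (ramp := fun s => Rmax 0 (Rmin 1 ((s - lam) / eta))).
  set (hr := fun s => exp lam * ramp s * Rpower (Rmax lam s) (- b)).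
  (* Bounding [v] below by [th] keeps the logarithm continuous at [v = 0]; it changes nothing for
     [t <= N]. *)
  set (th := exp (- (N / 4))); assert (hth : 0 < th) by apply exp_pos.
  set (H := fun v => hr (- 4 * ln (Rmax th v))).
  assert (hr_bound : forall s, 0 <= hr s <= B).
  { intros s; unfold hr, ramp.
    assert (h1 := Rmax_l 0 (Rmin 1 ((s - lam) / eta))).
    assert (h2 : Rmax 0 (Rmin 1 ((s - lam) / eta)) <= 1) by (apply Rmax_lub; [lra|apply Rmin_l]).
    assert (h3 := exp_pos lam); assert (h4 := Rpower_pos (Rmax lam s) (- b)).
    assert (h5 : Rpower (Rmax lam s) (- b) <= Rpower lam (- b)).
    { rewrite !Rpower_Ropp; apply Rinv_le_contravar; [apply exp_pos|].
      apply Rpower_le_base; [lra|lra|apply Rmax_l]. }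
    split; [repeat apply Rmult_le_pos; lra|].
    unfold B; rewrite <- (Rmult_1_r (exp lam)) at 2.
    apply Rmult_le_compat; [apply Rmult_le_pos; lra|lra|apply Rmult_le_compat_l; lra|easy]. }
  assert (cont_hr : forall s, continuous hr s).
  { intros s; unfold hr.
    apply (continuous_mult (fun s => exp lam * ramp s) (fun s => Rpower (Rmax lam s) (- b))).
    - apply (continuous_scal_r (V := R_NormedModule) (exp lam)).
      apply (continuous_comp (fun s => Rmin 1 ((s - lam) / eta)) (fun x => Rmax 0 x)); [|apply continuous_Rmax_const].
      apply (continuous_comp (fun s => (s - lam) / eta) (fun x => Rmin 1 x)); [|apply continuous_Rmin_const].
      apply (ex_derive_continuous (V := R_NormedModule)); auto_derive; easy.
    - apply (continuous_comp (fun s => Rmax lam s) (fun x => Rpower x (- b))); [apply continuous_Rmax_const|].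
      apply continuous_Rpower; assert (h := Rmax_l lam s); lra. }
  assert (cont_H : forall v, continuous H v).
  { intros v; apply (continuous_comp (fun v => - 4 * ln (Rmax th v)) hr); [|apply cont_hr].
    apply (continuous_comp (fun v => Rmax th v) (fun x => - 4 * ln x)); [apply continuous_Rmax_const|].
    apply (ex_derive_continuous (V := R_NormedModule)); auto_derive.
    assert (h := Rmax_l th v); lra. }
  assert (H_lt : forall t, t <= N -> H (exp (- (t / 4))) = hr t).
  { intros t Ht; unfold H; rewrite Rmax_right by (apply exp_le; lra).
    rewrite ln_exp; f_equal; field. }
  assert (HA := approx_continuous b lam Hb H cont_H).
  eexists; split; [exact HA|].
  apply (L2_close_dominated b lam _ _ (fun t => B * B * (stepR lam (fun _ => 0) (stepR (lam + eta) (weight b) (fun _ => 0)) t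
      + / N * weight (b + 1) t)) (B * B * (RInt (weight b) lam (lam + eta) + / N * Gamma (b + 1 + 1)))).
  - apply tail_density_pw.
  - apply HA.
  - apply is_Int0infR_scal, is_Int0infR_plus.
    + apply is_Int0inf_interval; [easy|lra|]; intros; now apply continuous_weight.
    + apply is_Int0infR_scal, is_Int0inf_weight; lra.
  - assert (E1 : RInt (weight b) lam (lam + eta) <= F * eta).
    { eapply Rle_trans; [apply Rle_abs|].
      rewrite <- (Rabs_pos_eq eta) at 2 by lra; replace eta with (lam + eta - lam) at 2 by ring.
      eapply Rle_trans; [apply abs_RInt_le_const with (M := F); [lra| |]|].
      - apply (ex_RInt_continuous (V := R_CompleteNormedModule)); intros t; rewrite Rmin_left by lra; intros Ht.
        apply continuous_weight; lra.
      - intros t Ht; rewrite Rabs_pos_eq by (left; apply weight_pos); apply HF'; lra.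
      - rewrite Rabs_pos_eq; lra. }
    assert (E2 : B * B * (F * eta) <= e / 4).
    { apply Rle_trans with (B * B * (F * (e / (4 * (B * B) * F)))); [|right; field; lra].
      apply Rmult_le_compat_l; [lra|]; apply Rmult_le_compat_l; lra. }
    assert (E3 : B * B * (/ N * Gamma (b + 1 + 1)) <= e / 4).
    { replace (B * B * (/ N * Gamma (b + 1 + 1))) with (B * B * Gamma (b + 1 + 1) / N) by (field; lra).
      apply Rle_div_l; [lra|].
      apply Rle_trans with (e / 4 * (4 * (B * B) * Gamma (b + 1 + 1) / e)); [right; field; lra|].
      apply Rmult_le_compat_l; [lra|unfold N; lra]. }
    rewrite Rmult_plus_distr_l.
    assert (B * B * RInt (weight b) lam (lam + eta) <= B * B * (F * eta)) by (apply Rmult_le_compat_l; lra).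
    lra.
  - intros t Ht; assert (hw := weight_pos b t).
    assert (hN' : 0 < / N) by (apply Rinv_0_lt_compat; lra).
    assert (htail := tail_density_bound b lam Hb Hlam t Ht); fold B in htail.
    assert (hH : 0 <= H (exp (- (t / 4))) <= B) by apply hr_bound.
    (* Both functions take values in [[0, B]]. This estimate is used only on the ramp and beyond
       [N]; elsewhere the two functions coincide. *)
    assert (crude : weight b t * (tail_density b lam t - H (exp (- (t / 4)))) ^ 2 <= B * B * weight b t).
    { rewrite (Rmult_comm (B * B)); apply Rmult_le_compat_l; [lra|].
      rewrite <- pow2_abs; assert (h : Rabs (tail_density b lam t - H (exp (- (t / 4)))) <= B) by (apply Rabs_le; lra).
      assert (h0 := Rabs_pos (tail_density b lam t - H (exp (- (t / 4))))); simpl; rewrite Rmult_1_r.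
      apply Rmult_le_compat; lra. }
    rewrite weight_succ by easy.
    assert (hp1 : 0 <= / N * (t * weight b t)).
    { apply Rmult_le_pos; [lra|apply Rmult_le_pos; lra]. }
    assert (hs : 0 <= stepR lam (fun _ => 0) (stepR (lam + eta) (weight b) (fun _ => 0)) t).
    { unfold stepR; destruct (Rlt_dec t lam); [lra|]; destruct (Rlt_dec t (lam + eta)); lra. }
    assert (hrhs : 0 <= B * B * (stepR lam (fun _ => 0) (stepR (lam + eta) (weight b) (fun _ => 0)) t
      + / N * (t * weight b t))) by (apply Rmult_le_pos; lra).
    destruct (Rlt_dec N t) as [h|h].
    + eapply Rle_trans; [exact crude|]; apply Rmult_le_compat_l; [lra|].
      assert (weight b t <= / N * (t * weight b t)); [|lra].
      apply (Rmult_le_reg_l N); [lra|]; rewrite <- Rmult_assoc, Rinv_r, Rmult_1_l by lra.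
      apply Rmult_le_compat_r; lra.
    + destruct (Rlt_dec t lam) as [h1|h1].
      * replace (tail_density b lam t - H (exp (- (t / 4)))) with 0; [lra|].
        rewrite H_lt by lra; unfold tail_density, stepR, hr, ramp; destruct (Rlt_dec t lam); [|lra].
        rewrite Rmax_left; [ring|].
        eapply Rle_trans; [apply Rmin_r|]; apply Rle_div_l; lra.
      * destruct (Rlt_dec t (lam + eta)) as [h2|h2].
        -- eapply Rle_trans; [exact crude|]; apply Rmult_le_compat_l; [lra|].
           unfold stepR; destruct (Rlt_dec t lam); [lra|]; destruct (Rlt_dec t (lam + eta)); [lra|lra].
        -- replace (tail_density b lam t - H (exp (- (t / 4)))) with 0; [lra|].
           rewrite H_lt by lra; unfold tail_density, stepR, hr, ramp; destruct (Rlt_dec t lam); [lra|].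
           rewrite Rmin_left by (apply Rle_div_r; lra).
           rewrite Rmax_right, Rmax_right by lra; ring.
Qed.

(** * Growth of Laguerre polynomials in the degree *)

(** The Beta value [n! Gamma(a) / Gamma(n + a + 1)], the integral of [phi_n^a]. The recursive form
    exposes the ratio that cancels the growth factor of [lag_sonin]. *)
Fixpoint phi_mass (a : R) (n : nat) : R :=
  match n with
  | O => / a
  | S m => phi_mass a m * ((INR m + 1) / (INR m + 1 + a))
  end.

Lemma phi_mass_pos a n : 0 < a -> 0 < phi_mass a n.
Proof.
  intros Ha; induction n as [|n IH]; simpl; [now apply Rinv_0_lt_compat|].
  assert (h := pos_INR n); apply Rmult_lt_0_compat; [easy|apply Rdiv_lt_0_compat; lra].
Qed.

Lemma phi_mass_decr a n : 0 < a -> phi_mass a (S n) <= phi_mass a n.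
Proof.
  intros Ha; assert (h := pos_INR n); assert (hp := phi_mass_pos a n Ha); simpl.
  rewrite <- (Rmult_1_r (phi_mass a n)) at 2; apply Rmult_le_compat_l; [lra|].
  apply Rle_div_l; lra.
Qed.

Lemma continuous_phi n a t : 0 < t -> continuous (phi n a) t.
Proof.
  intros Ht; apply (ex_derive_continuous (V := R_NormedModule)); unfold phi, Rpower; auto_derive.
  repeat split; try lra; apply Rgt_not_eq, exp_pos.
Qed.

Lemma phi_pos n a t : 0 < t -> 0 < phi n a t.
Proof. intros Ht; apply Rdiv_lt_0_compat; [now apply pow_lt|apply exp_pos]. Qed.

(** The function [t^(n+1) / (t+1)^(n+1+a)] vanishes at both ends and has derivative
    [(n+1) phi_n^a - (n+1+a) phi_(n+1)^a]. *)
Lemma is_Int0inf_phi a n : 0 < a -> is_Int0infR (phi n a) (phi_mass a n).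
Proof.
  intros Ha; induction n as [|n IH].
  - simpl; replace (/ a) with (/ (1 + a - 1)) by (f_equal; ring).
    generalize (is_Int0inf_power_tail (1 + a) ltac:(lra)); apply is_Int0infR_ext; intros t Ht.
    unfold phi; simpl; rewrite Rpower_Ropp, (Rplus_comm t 1); replace (0 + a + 1) with (1 + a) by ring.
    field; apply Rgt_not_eq, exp_pos.
  - assert (h := pos_INR n).
    assert (H : is_Int0infR (fun t => (INR n + 1) * phi n a t - (INR n + 1 + a) * phi (S n) a t) (0 - 0)).
    { apply (is_Int0infR_derive (fun t => t ^ S n / Rpower (t + 1) (INR n + 1 + a))).
      - intros t Ht; unfold phi.
        assert (D1 : is_derive (fun t => t ^ S n) t ((INR n + 1) * t ^ n)).
        { auto_derive; [easy|].
          change (match n with O => 1 | S _ => INR n + 1 end) with (INR (S n)); rewrite S_INR; ring. }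
        assert (D2 : is_derive (fun t => / Rpower (t + 1) (INR n + 1 + a)) t
          (- (INR n + 1 + a) / Rpower (t + 1) (INR n + 1 + a + 1))).
        { unfold Rpower; auto_derive.
          - split; [lra|]; split; [apply Rgt_not_eq, exp_pos|easy].
          - replace ((INR n + 1 + a + 1) * ln (t + 1)) with ((INR n + 1 + a) * ln (t + 1) + ln (t + 1)) by ring.
            rewrite exp_plus, exp_ln by lra; field.
            split; first [lra | apply Rgt_not_eq, exp_pos]. }
        assert (D := is_derive_mult _ _ t _ _ D1 D2 Rmult_comm).
        refine (eq_ind _ (is_derive _ t) D _ _).
        rewrite S_INR; replace (INR n + a + 1) with (INR n + 1 + a) by ring.
        unfold plus, mult, Rdiv; simpl; eqR; ring.
      - intros t Ht; apply (continuous_minus (V := R_NormedModule));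
          apply (continuous_scal_r (V := R_NormedModule)); now apply continuous_phi.
      - apply (filterlim_zero_at_0 (V := R_NormedModule) _ 1 1); [lra|lra|].
        intros t Ht; rewrite Rpower_1, Rmult_1_l by lra.
        change (Rabs (t ^ S n / Rpower (t + 1) (INR n + 1 + a)) <= t).
        assert (hr : 1 <= Rpower (t + 1) (INR n + 1 + a)) by (apply Rpower_ge_1; lra).
        assert (hp : 0 < t ^ S n) by (apply pow_lt; lra).
        rewrite Rabs_pos_eq by (apply Rmult_le_pos; [lra|left; apply Rinv_0_lt_compat; lra]).
        apply Rle_div_l; [lra|].
        assert (ht : t ^ n <= 1) by (rewrite <- (pow1 n); apply pow_incr; lra).
        simpl; nra.
      - apply (filterlim_zero_at_infty (V := R_NormedModule) _ (fun t => Rpower (1 + t) (- a)));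
          [|now apply is_lim_power_tail].
        intros t Ht.
        change (Rabs (t ^ S n / Rpower (t + 1) (INR n + 1 + a)) <= Rpower (1 + t) (- a)).
        rewrite Rabs_pos_eq
          by (apply Rmult_le_pos; [apply pow_le; lra|left; apply Rinv_0_lt_compat, exp_pos]).
        rewrite Rpower_plus, <- S_INR, Rpower_pow, Rpower_Ropp, (Rplus_comm 1 t) by lra.
        assert (hp : t ^ S n <= (t + 1) ^ S n) by (apply pow_incr; lra).
        assert (hq : 0 < (t + 1) ^ S n) by (apply pow_lt; lra).
        assert (hr := Rpower_pos (t + 1) a).
        apply Rle_div_l; [now apply Rmult_lt_0_compat|].
        replace (/ Rpower (t + 1) a * ((t + 1) ^ S n * Rpower (t + 1) a)) with ((t + 1) ^ S n) by (field; lra).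
        exact hp. }
    assert (H' := is_Int0infR_scal (/ (INR n + 1 + a)) _ _
      (is_Int0infR_minus _ _ _ _ (is_Int0infR_scal (INR n + 1) _ _ IH) H)).
    simpl; replace (phi_mass a n * ((INR n + 1) / (INR n + 1 + a)))
      with (/ (INR n + 1 + a) * ((INR n + 1) * phi_mass a n - (0 - 0))) by (field; lra).
    revert H'; apply is_Int0infR_ext; intros t Ht; field; lra.
Qed.

Lemma ratio_le_power m s : 0 < m -> 0 < s -> 1 - s / m <= Rpower (m / (m + 1)) s.
Proof.
  intros Hm Hs; assert (K := exp_ineq1_le (- (s / m))).
  apply Rle_trans with (exp (- (s / m))); [lra|]; unfold Rpower; apply exp_le.
  assert (L := ln_le_minus_1 ((m + 1) / m) ltac:(apply Rdiv_lt_0_compat; lra)).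
  replace ((m + 1) / m - 1) with (/ m) in L by (field; lra).
  replace (m / (m + 1)) with (/ ((m + 1) / m)) by (field; lra).
  rewrite ln_Rinv by (apply Rdiv_lt_0_compat; lra).
  unfold Rdiv; apply (Rmult_le_compat_l s) in L; lra.
Qed.

(** Each step multiplies the left side by [1 - (a-1)/(n+a)], which is at most
    [((n+a)/(n+a+1))^(a-1)]; the product of these powers telescopes. *)
Lemma phi_mass_bound a n : 1 < a ->
  (INR n + a) * phi_mass a n <= Rpower (a / (INR n + a)) (a - 1).
Proof.
  intros Ha; induction n as [|n IH].
  - simpl; rewrite Rplus_0_l; replace (a / a) with 1 by (field; lra).
    rewrite Rpower_1_base; right; field; lra.
  - assert (h := pos_INR n); assert (hp := phi_mass_pos a n ltac:(lra)).
    rewrite S_INR; simpl.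
    replace ((INR n + 1 + a) * (phi_mass a n * ((INR n + 1) / (INR n + 1 + a))))
      with ((INR n + a) * phi_mass a n * (1 - (a - 1) / (INR n + a))) by (field; lra).
    replace (a / (INR n + 1 + a)) with (a / (INR n + a) * ((INR n + a) / (INR n + a + 1))) by (field; lra).
    rewrite <- Rpower_mult_distr by (apply Rdiv_lt_0_compat; lra).
    apply Rmult_le_compat.
    + apply Rmult_le_pos; lra.
    + assert ((a - 1) / (INR n + a) <= 1) by (apply Rle_div_l; lra); lra.
    + exact IH.
    + apply ratio_le_power; lra.
Qed.

(** The bound just obtained is [(1 + n/a)^(1 - a)], and [a > 1] sends it to zero. *)
Lemma phi_mass_lim a : 1 < a -> is_lim_seq (fun n => INR n * phi_mass a n) 0.
Proof.
  intros Ha; apply is_lim_seq_spec; intros [e He]; simpl.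
  assert (Z := is_lim_power_tail (a - 1) ltac:(lra)); apply is_lim_spec in Z.
  destruct (Z (mkposreal e He)) as [N HN]; simpl in HN.
  destruct (INR_unbounded (Rmax 0 (a * N))) as [n0 Hn0].
  exists n0; intros n Hn; apply le_INR in Hn; assert (h := pos_INR n).
  assert (hp := phi_mass_pos a n ltac:(lra)).
  assert (h1 := Rmax_l 0 (a * N)); assert (h2 := Rmax_r 0 (a * N)).
  specialize (HN (INR n / a)).
  rewrite Rminus_0_r, Rabs_pos_eq in HN by (left; apply exp_pos).
  rewrite Rminus_0_r, Rabs_pos_eq by (apply Rmult_le_pos; lra).
  apply Rle_lt_trans with ((INR n + a) * phi_mass a n); [apply Rmult_le_compat_r; lra|].
  eapply Rle_lt_trans; [now apply phi_mass_bound|].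
  replace (a / (INR n + a)) with (/ (1 + INR n / a)) by (field; lra).
  rewrite Rpower_inv, <- Rpower_Ropp.
  - apply HN; apply Rlt_div_r; lra.
  - assert (0 <= INR n / a) by (apply Rmult_le_pos; [lra|left; apply Rinv_0_lt_compat; lra]); lra.
Qed.

(* Discrete Sonin-type energy of the recurrence [Laguerre_step]; the cross term, with
   coefficient [a + 1/2 + t], compensates the drift of the two squares. *)
Definition lag_sonin (a t : R) (n : nat) : R :=
  Laguerre n a t ^ 2 + t / INR n * Laguerre n (a + 1) t ^ 2
  - (a + / 2 + t) / INR n * (Laguerre n a t * Laguerre n (a + 1) t).

(** The factor is the inverse of the ratio of [phi_mass]. The difference of the two sides is a
    quadratic form in [d = L_n^a] and [L = L_n^(a+1)]: its diagonal coefficients are at most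
    [-1/(2(x+1))] and [-t/(2x(x+1))], while the mixed one is only of order [1/x^2]. *)
Lemma lag_sonin_step a t : 1 < a -> 0 < t -> exists n0, (0 < n0)%nat /\ forall n, (n0 <= n)%nat ->
  lag_sonin a t (S n) <= (INR n + 1 + a) / (INR n + 1) * lag_sonin a t n.
Proof.
  intros Ha Ht.
  (* Divided by [x (x + 1)], this bounds the mixed coefficient, the factor [a + 1] coming from [p].
     The form is then nonpositive once [kb^2 <= x t], the discriminant condition that determines
     [n0]. *)
  set (kb := (a + 1) * (a + / 2 + t + 2 * t * (a + / 2))).
  assert (hkb : 0 < kb) by (unfold kb; apply Rmult_lt_0_compat; nra).
  destruct (INR_unbounded (kb * kb / t)) as [n0 Hn0].
  exists (S n0); split; [lia|]; intros n Hn; apply le_INR in Hn; rewrite S_INR in Hn.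
  assert (h0 := pos_INR n0); set (x := INR n) in *.
  assert (hx : 1 <= x) by lra.
  assert (hxt : kb * kb <= x * t).
  { apply Rle_trans with (kb * kb / t * t); [right; field; lra|]; apply Rmult_le_compat_r; lra. }
  assert (Rd := Laguerre_step n a t); fold x in Rd.
  assert (RL := Laguerre_param_succ n a t).
  unfold lag_sonin; rewrite RL, S_INR; fold x.
  set (d := Laguerre n a t) in *; set (L := Laguerre n (a + 1) t) in *.
  assert (Ed : Laguerre (S n) a t = ((x + a + 1) * d - t * L) / (x + 1)).
  { rewrite <- Rd; field; lra. }
  rewrite Ed; clear Ed Rd RL.
  set (c := a + / 2 + t).
  set (p := (x + 1 + a) / (x + 1)).
  set (Bc := c / (x * (x + 1)) + 2 * t * (a + / 2) / (x + 1) ^ 2).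
  assert (key : (((x + a + 1) * d - t * L) / (x + 1)) ^ 2
     + t / (x + 1) * (((x + a + 1) * d - t * L) / (x + 1) + L) ^ 2
     - c / (x + 1) * (((x + a + 1) * d - t * L) / (x + 1) * (((x + a + 1) * d - t * L) / (x + 1) + L))
     - p * (d ^ 2 + t / x * L ^ 2 - c / x * (d * L))
    = p * (- / (2 * (x + 1)) - a * (a + / 2) / (x + 1) ^ 2) * d ^ 2
      + p * Bc * (d * L)
      + (- t * (a + 1) / (x * (x + 1)) + t * (a + / 2) / (x + 1) ^ 2 - t ^ 2 * (a + / 2) / (x + 1) ^ 3) * L ^ 2).
  { unfold p, Bc, c; field; lra. }
  apply Rminus_le; rewrite key; clear key.
  assert (hp1 : 1 <= p) by (unfold p; apply Rle_div_r; lra).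
  assert (hp2 : p <= a + 1) by (unfold p; apply Rle_div_l; nra).
  assert (hxx : 0 < x * (x + 1)) by (apply Rmult_lt_0_compat; lra).
  assert (i1 : 0 < / (x * (x + 1))) by now apply Rinv_0_lt_compat.
  assert (i2 : 0 < / (x + 1)) by (apply Rinv_0_lt_compat; lra).
  assert (i3 : / (x + 1) ^ 2 <= / (x * (x + 1))).
  { apply Rinv_le_contravar; [easy|nra]. }
  assert (i4 : 0 < / (x + 1) ^ 2) by (apply Rinv_0_lt_compat, pow_lt; lra).
  assert (i5 : 0 < / (x + 1) ^ 3) by (apply Rinv_0_lt_compat, pow_lt; lra).
  assert (c0 : 0 < c) by (unfold c; lra).
  assert (T1 : p * (- / (2 * (x + 1)) - a * (a + / 2) / (x + 1) ^ 2) * d ^ 2 <= - / 2 * / (x + 1) * d ^ 2).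
  { apply Rmult_le_compat_r; [apply pow2_ge_0|].
    rewrite Rinv_mult; unfold Rdiv.
    assert (0 < a * (a + / 2) * / (x + 1) ^ 2) by (repeat apply Rmult_lt_0_compat; lra).
    nra. }
  assert (T2 : p * Bc * (d * L) <= kb * / (x * (x + 1)) * Rabs (d * L)).
  { assert (hB : 0 <= p * Bc <= kb * / (x * (x + 1))).
    { assert (hB0 : 0 <= Bc <= (c + 2 * t * (a + / 2)) * / (x * (x + 1))).
      { unfold Bc, Rdiv; rewrite Rmult_plus_distr_r.
        assert (0 < 2 * t * (a + / 2)) by (repeat apply Rmult_lt_0_compat; lra).
        split; [apply Rplus_le_le_0_compat; apply Rmult_le_pos; lra|].
        apply Rplus_le_compat_l, Rmult_le_compat_l; lra. }
      split; [apply Rmult_le_pos; lra|].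
      unfold kb; rewrite (Rmult_assoc (a + 1)); apply Rmult_le_compat; try lra; apply hB0. }
    eapply Rle_trans; [apply Rle_abs|]; rewrite Rabs_mult, (Rabs_pos_eq (p * Bc)) by apply hB.
    apply Rmult_le_compat_r; [apply Rabs_pos|apply hB]. }
  assert (T3 : (- t * (a + 1) / (x * (x + 1)) + t * (a + / 2) / (x + 1) ^ 2 - t ^ 2 * (a + / 2) / (x + 1) ^ 3) * L ^ 2
     <= - / 2 * t * / (x * (x + 1)) * L ^ 2).
  { apply Rmult_le_compat_r; [apply pow2_ge_0|]; unfold Rdiv.
    assert (0 < t ^ 2 * (a + / 2) * / (x + 1) ^ 3) by (repeat apply Rmult_lt_0_compat; lra).
    assert (t * (a + / 2) * / (x + 1) ^ 2 <= t * (a + / 2) * / (x * (x + 1)))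
      by (apply Rmult_le_compat_l; [apply Rmult_le_pos; lra|easy]).
    lra. }
  assert (T4 : - / 2 * / (x + 1) * d ^ 2 + kb * / (x * (x + 1)) * Rabs (d * L) + - / 2 * t * / (x * (x + 1)) * L ^ 2
    = - / 2 * / (x * (x + 1)) * (x * Rabs d ^ 2 - 2 * kb * (Rabs d * Rabs L) + t * Rabs L ^ 2)).
  { rewrite Rabs_mult, !pow2_abs; field; lra. }
  assert (T5 : 0 <= x * Rabs d ^ 2 - 2 * kb * (Rabs d * Rabs L) + t * Rabs L ^ 2).
  { assert (E : x * (x * Rabs d ^ 2 - 2 * kb * (Rabs d * Rabs L) + t * Rabs L ^ 2)
      = (x * Rabs d - kb * Rabs L) ^ 2 + (x * t - kb * kb) * Rabs L ^ 2) by ring.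
    assert (0 <= x * (x * Rabs d ^ 2 - 2 * kb * (Rabs d * Rabs L) + t * Rabs L ^ 2)).
    { rewrite E; apply Rplus_le_le_0_compat; [apply pow2_ge_0|].
      apply Rmult_le_pos; [lra|apply pow2_ge_0]. }
    apply Rmult_le_reg_l with x; lra. }
  assert (0 <= / 2 * / (x * (x + 1)) * (x * Rabs d ^ 2 - 2 * kb * (Rabs d * Rabs L) + t * Rabs L ^ 2)).
  { apply Rmult_le_pos; [apply Rmult_le_pos; lra|easy]. }
  lra.
Qed.

(** For [x t >= c^2] the cross term is absorbed by half of the [L^2] term, after completing the
    square in [x d - c L]. *)
Lemma lag_sonin_lower a t : 1 < a -> 0 < t -> exists n0, (0 < n0)%nat /\ forall n, (n0 <= n)%nat ->
  t * Laguerre n (a + 1) t ^ 2 <= 2 * INR n * lag_sonin a t n.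
Proof.
  intros Ha Ht; set (c := a + / 2 + t).
  destruct (INR_unbounded (c * c / t)) as [n0 Hn0].
  exists (S n0); split; [lia|]; intros n Hn; apply le_INR in Hn; rewrite S_INR in Hn.
  assert (h0 := pos_INR n0); set (x := INR n) in *.
  assert (hxt : c * c <= x * t).
  { apply Rle_trans with (c * c / t * t); [right; field; lra|]; apply Rmult_le_compat_r; lra. }
  unfold lag_sonin; fold x; fold c.
  set (d := Laguerre n a t); set (L := Laguerre n (a + 1) t).
  replace (2 * x * (d ^ 2 + t / x * L ^ 2 - c / x * (d * L)))
    with (2 * x * d ^ 2 + 2 * t * L ^ 2 - 2 * c * (d * L)) by (field; lra).
  assert (E : x * (2 * x * d ^ 2 + t * L ^ 2 - 2 * c * (d * L))
    = (x * d - c * L) ^ 2 + x ^ 2 * d ^ 2 + (x * t - c * c) * L ^ 2) by ring.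
  assert (0 <= x * (2 * x * d ^ 2 + t * L ^ 2 - 2 * c * (d * L))).
  { rewrite E; apply Rplus_le_le_0_compat; [apply Rplus_le_le_0_compat; [apply pow2_ge_0|]|].
    - apply Rmult_le_pos; apply pow2_ge_0.
    - apply Rmult_le_pos; [lra|apply pow2_ge_0]. }
  assert (0 <= 2 * x * d ^ 2 + t * L ^ 2 - 2 * c * (d * L)) by (apply Rmult_le_reg_l with x; lra).
  lra.
Qed.

(** The product of [lag_sonin] and [phi_mass] is eventually nonincreasing, hence at most [C].
    Squaring the sequence then leaves [2 C / t] times [n phi_mass], which tends to zero. *)
Lemma Laguerre_phi_mass_lim a t : 1 < a -> 0 < t ->
  is_lim_seq (fun n => Rabs (Laguerre n (a + 1) t) * phi_mass a (S n)) 0.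
Proof.
  intros Ha Ht.
  destruct (lag_sonin_step a t Ha Ht) as [n1 [Hn1 H1]].
  destruct (lag_sonin_lower a t Ha Ht) as [n2 [Hn2 H2]].
  set (n0 := max n1 n2); set (C := lag_sonin a t n0 * phi_mass a n0).
  assert (dec : forall n, (n0 <= n)%nat -> lag_sonin a t n * phi_mass a n <= C).
  { intros n Hn; induction Hn as [|n Hn IH]; [unfold C; lra|].
    eapply Rle_trans; [|exact IH].
    assert (h := pos_INR n); assert (hp := phi_mass_pos a n ltac:(lra)).
    assert (hps := phi_mass_pos a (S n) ltac:(lra)).
    eapply Rle_trans; [apply Rmult_le_compat_r; [lra|apply H1; lia]|].
    simpl; right; field; lra. }
  assert (bound : forall n, (n0 <= n)%nat ->
    (Rabs (Laguerre n (a + 1) t) * phi_mass a (S n)) ^ 2 <= 2 * C / t * (INR n * phi_mass a n)).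
  { intros n Hn; specialize (H2 n ltac:(lia)); specialize (dec n Hn).
    assert (h := pos_INR n); assert (hp := phi_mass_pos a n ltac:(lra)).
    assert (hps := phi_mass_pos a (S n) ltac:(lra)); assert (hd := phi_mass_decr a n ltac:(lra)).
    apply Rle_trans with ((Rabs (Laguerre n (a + 1) t) * phi_mass a n) ^ 2).
    - apply pow_incr; split; [apply Rmult_le_pos; [apply Rabs_pos|lra]|].
      apply Rmult_le_compat_l; [apply Rabs_pos|easy].
    - rewrite Rpow_mult_distr, pow2_abs.
      apply (Rmult_le_reg_l t); [easy|].
      replace (t * (2 * C / t * (INR n * phi_mass a n))) with (2 * INR n * phi_mass a n * C) by (field; lra).
      apply Rle_trans with (2 * INR n * lag_sonin a t n * phi_mass a n ^ 2).
      + rewrite <- Rmult_assoc; apply Rmult_le_compat_r; [apply pow2_ge_0|easy].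
      + replace (2 * INR n * lag_sonin a t n * phi_mass a n ^ 2)
          with (2 * INR n * phi_mass a n * (lag_sonin a t n * phi_mass a n)) by ring.
        apply Rmult_le_compat_l; [repeat apply Rmult_le_pos; lra|easy]. }
  assert (Z := is_lim_seq_scal_l _ (2 * C / t) 0 (phi_mass_lim a Ha)).
  simpl in Z; rewrite Rmult_0_r in Z; apply is_lim_seq_spec in Z.
  apply is_lim_seq_spec; intros [e He]; cbn [pos].
  destruct (Z (mkposreal (e ^ 2) (pow_lt e 2 He))) as [N HN]; cbn [pos] in HN.
  exists (max n0 N); intros n Hn; specialize (HN n ltac:(lia)); specialize (bound n ltac:(lia)).
  assert (hps := phi_mass_pos a (S n) ltac:(lra)).
  assert (hpos : 0 <= Rabs (Laguerre n (a + 1) t) * phi_mass a (S n))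
    by (apply Rmult_le_pos; [apply Rabs_pos|lra]).
  rewrite Rminus_0_r, Rabs_pos_eq by easy.
  rewrite Rminus_0_r in HN; apply Rabs_def2 in HN.
  apply Rnot_le_lt; intros h.
  assert (e ^ 2 <= (Rabs (Laguerre n (a + 1) t) * phi_mass a (S n)) ^ 2) by (apply pow_incr; lra).
  lra.
Qed.

(** * The theorem *)

Section Main.
Context {X0 : CompleteNormedModule R_AbsRing}.
Local Notation X := (CompleteNormedModule.NormedModule R_AbsRing X0).
Variables (T : R -> X -> X) (M : R).
Hypothesis HT : bounded_C0_semigroup (X := X0) T M.

Lemma lcoeff_series x a t : inDA (X := X0) T x -> -1 < a -> 0 < t ->
  is_series (fun n => scal (Laguerre n a t) (lcoeff T (a + 1) n x)) (T t x).
Proof.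
  intros [y Hy] Ha Ht; apply (gen_iff T) in Hy.
  set (K := Rabs M * norm (plus x y)).
  assert (HS := laguerre_expansion (X0 := X0) (a + 1) t (fun s => T s (plus x y)) (fun _ => K)
    (K ^ 2 * Gamma (a + 1 + 1)) (fun n => lcoeff T (a + 1) n x) (T t x)).
  replace (a + 1 - 1) with a in HS by ring; apply HS; try lra.
  - apply tail_density_approximable; lra.
  - intros s Hs; apply (T_norm T M HT); lra.
  - apply (is_Int0infR_ext (fun s => K ^ 2 * weight (a + 1) s)); [intros; ring|].
    apply is_Int0infR_scal, is_Int0inf_weight; lra.
  - intros n; rewrite (lcoeff_domain T M HT n x y Hy) by lra.
    apply (is_Int0inf_ell_T T M HT); lra.
  - now apply (T_as_integral T M HT).
Qed.

Variable x : X.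
Let K := Rabs M * norm x + 1.

Lemma orbit_bound_pos : 0 < K.
Proof.
  unfold K; assert (0 <= Rabs M * norm x) by (apply Rmult_le_pos; [apply Rabs_pos|apply norm_ge_0]); lra.
Qed.

Lemma orbit_bound v : 0 < v -> norm (T v x) <= K * (1 + v) ^ 0.
Proof. intros Hv; simpl; assert (h := T_norm T M HT v x ltac:(lra)); unfold K; lra. Qed.

(** The counterpart of [x + A x] for the resolvent: differentiating [e^(-s) e^(-sv)] in [s] brings
    down [-(1 + v)], so the Laplace transform of this function is the resolvent minus its
    derivative. *)
Definition weighted_orbit (v : R) : X := scal (1 + v) (T v x).

Lemma continuous_weighted_orbit v : 0 < v -> continuous weighted_orbit v.
Proof.
  intros Hv; apply (continuous_scal (fun v => 1 + v) (fun v => T v x)); [|now apply (continuous_T T M HT)].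
  apply (ex_derive_continuous (V := R_NormedModule)); auto_derive; easy.
Qed.

Lemma weighted_orbit_bound v : 0 < v -> norm (weighted_orbit v) <= K * (1 + v) ^ 1.
Proof.
  intros Hv; unfold weighted_orbit; rewrite norm_scal_R, Rabs_pos_eq, Rmult_comm, pow_1 by lra.
  apply Rmult_le_compat_r; [lra|]; assert (h := orbit_bound v Hv); simpl in h; lra.
Qed.

Lemma laplace_orbit t : 0 < t -> laplace (X0 := X0) (fun v => T v x) t = Res (X := X0) T 1 t x.
Proof.
  intros Ht; apply (is_Int0inf_inj (V0 := X0) (fun v => scal (exp (- t * v)) (T v x))).
  - apply (is_laplace (X0 := X0) (fun v => T v x) K 0 orbit_bound_pos); [|exact orbit_bound|easy].
    intros; now apply (continuous_T T M HT).
  - generalize (is_Res T M HT 1 t x Rlt_0_1 Ht); apply (is_Int0inf_ext (V0 := X0)); intros v Hv.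
    f_equal; rewrite Rminus_diag, Rpower_O, Gamma_1 by easy; field.
Qed.

Lemma norm_Res_one t : 0 < t -> norm (Res (X := X0) T 1 t x : X) <= K * / t.
Proof.
  intros Ht; rewrite <- laplace_orbit by easy.
  assert (HL : is_Int0inf (fun v => scal (exp (- t * v)) (T v x)) (laplace (X0 := X0) (fun v => T v x) t)).
  { apply (is_laplace (X0 := X0) (fun v => T v x) K 0 orbit_bound_pos); [|exact orbit_bound|easy].
    intros; now apply (continuous_T T M HT). }
  destruct (is_Int0inf_dominated (V0 := X0) _ (fun v => K * exp (- t * v)) (K * / t)
    (is_Int0inf_loc (V0 := X0) _ _ HL)) as [l [Hl Hn]].
  - intros v Hv; rewrite norm_scal_R, Rabs_pos_eq, Rmult_comm by (left; apply exp_pos).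
    apply Rmult_le_compat_r; [left; apply exp_pos|].
    assert (h := orbit_bound v Hv); simpl in h; lra.
  - now apply is_Int0infR_scal, is_Int0inf_exp.
  - now rewrite (is_Int0inf_inj (V0 := X0) _ _ _ HL Hl).
Qed.

Lemma norm_laplace_weighted t : 0 < t -> norm (laplace weighted_orbit t) <= K * (/ t + / t ^ 2).
Proof.
  intros Ht.
  assert (HL : is_Int0inf (fun v => scal (exp (- t * v)) (weighted_orbit v)) (laplace weighted_orbit t)).
  { apply (is_laplace weighted_orbit K 1 orbit_bound_pos); [|exact weighted_orbit_bound|easy].
    exact continuous_weighted_orbit. }
  assert (HV : is_Int0infR (fun v => Rpower v (2 - 1) * exp (- t * v)) (/ t ^ 2)).
  { replace (/ t ^ 2) with (Gamma 2 / Rpower t 2); [apply is_Gamma_scaled; lra|].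
    replace 2 with (1 + 1) at 1 by ring; rewrite Gamma_succ, Gamma_1 by lra.
    replace 2 with (INR 2) by (simpl; ring); rewrite Rpower_pow by easy; field; lra. }
  destruct (is_Int0inf_dominated (V0 := X0) _
    (fun v => K * (exp (- t * v) + Rpower v (2 - 1) * exp (- t * v))) (K * (/ t + / t ^ 2))
    (is_Int0inf_loc (V0 := X0) _ _ HL)) as [l [Hl Hn]].
  - intros v Hv; rewrite norm_scal_R, Rabs_pos_eq by (left; apply exp_pos).
    replace (2 - 1) with 1 by ring; rewrite Rpower_1 by easy.
    replace (K * (exp (- t * v) + v * exp (- t * v))) with (exp (- t * v) * (K * (1 + v) ^ 1)) by ring.
    apply Rmult_le_compat_l; [left; apply exp_pos|now apply weighted_orbit_bound].
  - apply is_Int0infR_scal, is_Int0infR_plus; [now apply is_Int0inf_exp|exact HV].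
  - now rewrite (is_Int0inf_inj (V0 := X0) _ _ _ HL Hl).
Qed.

(** On [[lam, c]] Fubini's theorem leaves an explicit inner integral of [e^(lam - t) e^(-tv)], whose
    factor [1 / (1 + v)] cancels the one in [weighted_orbit]; the contribution of [c] decays like
    [e^(-c)]. *)
Lemma Res_as_integral lam : 0 < lam ->
  is_Int0inf (step (V0 := X0) lam (fun _ => zero) (fun s => scal (exp (lam - s)) (laplace weighted_orbit s)))
    (Res (X := X0) T 1 lam x : X).
Proof.
  intros Hl.
  assert (HP : forall t, 0 < t -> is_Int0inf (fun v => scal (exp (- t * v)) (T v x)) (Res (X := X0) T 1 t x : X)).
  { intros t Ht; rewrite <- laplace_orbit by easy.
    apply (is_laplace (X0 := X0) (fun v => T v x) K 0 orbit_bound_pos); [|exact orbit_bound|easy].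
    intros; now apply (continuous_T T M HT). }
  apply (is_Int0inf_step_zero (V0 := X0) lam _
    (fun c => minus (Res (X := X0) T 1 lam x : X) (scal (exp (lam - c)) (Res (X := X0) T 1 c x)))); [easy| |].
  - intros c Hc.
    destruct (fubini_laplace weighted_orbit K 1 orbit_bound_pos continuous_weighted_orbit weighted_orbit_bound
      (fun s => exp (lam - s)) (lam / 2) ltac:(lra)
      ltac:(intros; apply (ex_derive_continuous (V := R_NormedModule)); auto_derive; easy)
      lam c ltac:(lra) ltac:(lra)) as [l [H1 H2]].
    replace (minus (Res (X := X0) T 1 lam x : X) (scal (exp (lam - c)) (Res (X := X0) T 1 c x))) with l; [exact H1|].
    refine (is_Int0inf_inj (V0 := X0) _ _ _ H2 _).
    apply (is_Int0inf_ext (V0 := X0) (fun v => minus (scal (exp (- lam * v)) (T v x))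
      (scal (exp (lam - c)) (scal (exp (- c * v)) (T v x))))).
    + intros v Hv.
      assert (E : RInt (fun t => exp (lam - t) * exp (- t * v)) lam c
        = (exp (- lam * v) - exp (lam - c) * exp (- c * v)) / (1 + v)).
      { apply is_RInt_unique.
        replace ((exp (- lam * v) - exp (lam - c) * exp (- c * v)) / (1 + v))
          with (minus (- / (1 + v) * (exp (lam - c) * exp (- c * v)))
                      (- / (1 + v) * (exp (lam - lam) * exp (- lam * v)))).
        2: { rewrite Rminus_diag, exp_0; unfold minus, plus, opp; simpl; field; lra. }
        apply (is_RInt_derive (V := R_CompleteNormedModule)
          (fun t => - / (1 + v) * (exp (lam - t) * exp (- t * v)))).
        - intros t _; auto_derive; [easy|]; unfold Rminus; field; lra.
        - intros t _; apply (ex_derive_continuous (V := R_NormedModule)); auto_derive; easy. }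
      rewrite E; unfold weighted_orbit; lincomb; field; lra.
    + apply is_Int0inf_minus; [now apply HP|]; apply is_Int0inf_scal, HP; lra.
  - assert (Hz : filterlim (fun c => scal (exp (lam - c)) (Res (X := X0) T 1 c x : X))
      (Rbar_locally p_infty) (locally (zero : X))).
    { apply (filterlim_zero_at_infty (V := X) _ (fun c => exp lam * K * exp (- (1) * c)));
        [|apply is_lim_exp_decay; lra].
      intros c Hc; rewrite norm_scal_R, Rabs_pos_eq by (left; apply exp_pos).
      replace (lam - c) with (lam + - (1) * c) by ring; rewrite exp_plus.
      replace (exp lam * K * exp (- (1) * c)) with (exp lam * exp (- (1) * c) * K) by ring.
      apply Rmult_le_compat_l; [left; apply Rmult_lt_0_compat; apply exp_pos|].
      eapply Rle_trans; [apply norm_Res_one; lra|].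
      rewrite <- (Rmult_1_r K) at 2; apply Rmult_le_compat_l; [left; apply orbit_bound_pos|].
      rewrite <- Rinv_1; apply Rinv_le_contravar; lra. }
    apply (filterlim_norm_eps (V := X) (Rbar_locally p_infty)); intros e He.
    generalize (proj1 (filterlim_norm_eps (V := X) (Rbar_locally p_infty) _ zero) Hz e He).
    apply filter_imp; intros c Hc.
    norm_as (opp (minus (scal (exp (lam - c)) (Res (X := X0) T 1 c x : X)) zero)); rewrite norm_opp; exact Hc.
Qed.

Definition phi_coeff (a : R) (n : nat) : X := Int0inf (V := X0) (fun v => scal (phi n a v) (T v x)).

Lemma ell_Res n a : 0 < a ->
  is_Int0inf (fun t => scal (ell n a t) (Res (X := X0) T 1 t x)) (phi_coeff a n) /\
  is_Int0inf (fun t => scal (phi n a t) (T t x)) (phi_coeff a n).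
Proof.
  intros Ha.
  destruct (ell_laplace (X0 := X0) (fun v => T v x) K 0 orbit_bound_pos
    ltac:(intros; now apply (continuous_T T M HT)) orbit_bound n a Ha) as [l [H1 H2]].
  assert (E : phi_coeff a n = l) by exact (Int0inf_unique (V0 := X0) _ _ H2).
  rewrite E; split; [|exact H2].
  revert H1; apply (is_Int0inf_ext (V0 := X0)); intros t Ht; f_equal; now apply laplace_orbit.
Qed.

Lemma phi_coeff_succ n a : 0 < a -> phi_coeff (a + 1) n = minus (phi_coeff a n) (phi_coeff a (S n)).
Proof.
  intros Ha; apply (is_Int0inf_inj (V0 := X0) (fun t => scal (phi n (a + 1) t) (T t x))); [apply ell_Res; lra|].
  apply (is_Int0inf_ext (V0 := X0) (fun t => minus (scal (phi n a t) (T t x)) (scal (phi (S n) a t) (T t x)))).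
  - intros t Ht; rewrite phi_succ by easy; module_eq.
  - apply is_Int0inf_minus; now apply ell_Res.
Qed.

Lemma norm_phi_coeff a n : 0 < a -> norm (phi_coeff a n) <= K * phi_mass a n.
Proof.
  intros Ha; destruct (ell_Res n a Ha) as [_ H].
  destruct (is_Int0inf_dominated (V0 := X0) _ (fun t => K * phi n a t) (K * phi_mass a n)
    (is_Int0inf_loc (V0 := X0) _ _ H)) as [l [Hl Hn]].
  - intros t Ht; rewrite norm_scal_R, Rabs_pos_eq, Rmult_comm by (left; now apply phi_pos).
    apply Rmult_le_compat_r; [left; now apply phi_pos|].
    assert (h := orbit_bound t Ht); simpl in h; lra.
  - now apply is_Int0infR_scal, is_Int0inf_phi.
  - now rewrite (is_Int0inf_inj (V0 := X0) _ _ _ H Hl).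
Qed.

(** The squared bound against [w_(a+1)] is a sum of multiples of [w_(a-1)], [w_(a-2)] and [w_(a-3)];
    the last is integrable at 0 because [a > 2]. The coefficients return to parameter [a] by
    [phi_lower]. *)
Lemma resolvent_series_gt2 a lam : 2 < a -> 0 < lam ->
  is_series (fun n => scal (Laguerre n a lam) (phi_coeff a n)) (Res (X := X0) T 1 lam x : X).
Proof.
  intros Ha Hl.
  assert (HS := laguerre_expansion (X0 := X0) (a + 1) lam (laplace weighted_orbit)
    (fun t => K * (/ t + / t ^ 2))
    (K ^ 2 * (Gamma (a - 1 + 1) + 2 * Gamma (a - 2 + 1) + Gamma (a - 3 + 1)))
    (phi_coeff a) (Res (X := X0) T 1 lam x)).
  replace (a + 1 - 1) with a in HS by ring; apply HS; try lra.
  - apply tail_density_approximable; lra.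
  - intros t Ht; now apply norm_laplace_weighted.
  - apply (is_Int0infR_ext (fun t => K ^ 2 * (weight (a - 1) t + 2 * weight (a - 2) t + weight (a - 3) t))).
    + intros t Ht.
      replace (a + 1) with (a - 3 + 1 + 1 + 1 + 1) by ring.
      replace (a - 1) with (a - 3 + 1 + 1) by ring; replace (a - 2) with (a - 3 + 1) by ring.
      rewrite !weight_succ by easy; field; lra.
    + apply is_Int0infR_scal, is_Int0infR_plus; [apply is_Int0infR_plus; [|apply is_Int0infR_scal]|];
        apply is_Int0inf_weight; lra.
  - intros n.
    destruct (ell_laplace weighted_orbit K 1 orbit_bound_pos continuous_weighted_orbit
      weighted_orbit_bound n (a + 1)) as [l [H1 H2]]; [simpl; lra|].
    replace (phi_coeff a n) with l; [exact H1|].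
    apply (is_Int0inf_inj (V0 := X0) (fun v => scal (phi n a v) (T v x))); [|apply ell_Res; lra].
    revert H2; apply (is_Int0inf_ext (V0 := X0)); intros v Hv.
    unfold weighted_orbit; rewrite <- (phi_lower n a) by easy; module_eq.
  - now apply Res_as_integral.
Qed.

(* Summation by parts shifts [a] to [a + 1]; the boundary term vanishes at infinity by
   [Laguerre_phi_mass_lim]. *)
Lemma resolvent_series a lam : 1 < a -> 0 < lam ->
  is_series (fun n => scal (Laguerre n a lam) (phi_coeff a n)) (Res (X := X0) T 1 lam x : X).
Proof.
  intros Ha Hl.
  (* Abel summation: [L_n^a] is the increment of [L_n^(a+1)] in [n], and [phi_coeff (a + 1) n] is
     minus the increment of [phi_coeff a]. *)
  assert (parts : forall n, sum_n (fun n => scal (Laguerre n a lam) (phi_coeff a n)) n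
    = plus (sum_n (fun n => scal (Laguerre n (a + 1) lam) (phi_coeff (a + 1) n)) n)
        (scal (Laguerre n (a + 1) lam) (phi_coeff a (S n)))).
  { induction n as [|n IH].
    - rewrite !sum_O, !Laguerre_0, phi_coeff_succ by lra; module_eq.
    - rewrite !sum_Sn, IH, (phi_coeff_succ (S n)), Laguerre_param_succ by lra; module_eq. }
  assert (S1 := resolvent_series_gt2 (a + 1) lam ltac:(lra) Hl).
  apply (filterlim_norm_eps (V := X) eventually); intros e He.
  destruct (proj1 (filterlim_norm_eps (V := X) eventually _ _) S1 (e / 2) ltac:(lra)) as [N1 H1].
  assert (Z := Laguerre_phi_mass_lim a lam Ha Hl); apply is_lim_seq_spec in Z.
  assert (hK := orbit_bound_pos).
  assert (hq : 0 < e / (2 * K)) by (apply Rdiv_lt_0_compat; lra).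
  destruct (Z (mkposreal _ hq)) as [N2 H2].
  exists (max N1 N2); intros n Hn.
  specialize (H1 n ltac:(lia)); specialize (H2 n ltac:(lia)); cbn [pos] in H2.
  rewrite parts.
  norm_as (plus (minus (sum_n (fun n => scal (Laguerre n (a + 1) lam) (phi_coeff (a + 1) n)) n)
      (Res (X := X0) T 1 lam x : X)) (scal (Laguerre n (a + 1) lam) (phi_coeff a (S n)))).
  eapply Rle_lt_trans; [apply norm_triangle|].
  assert (B : norm (scal (Laguerre n (a + 1) lam) (phi_coeff a (S n))) < e / 2).
  { rewrite norm_scal_R.
    apply Rle_lt_trans with (Rabs (Laguerre n (a + 1) lam) * (K * phi_mass a (S n))).
    - apply Rmult_le_compat_l; [apply Rabs_pos|apply norm_phi_coeff; lra].
    - rewrite Rminus_0_r in H2; apply Rabs_def2 in H2; destruct H2 as [H2 _].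
      apply (Rmult_lt_compat_l K) in H2; [|easy].
      replace (K * (e / (2 * K))) with (e / 2) in H2 by (field; lra).
      rewrite <- Rmult_assoc, (Rmult_comm _ K), Rmult_assoc; exact H2. }
  replace e with (e / 2 + e / 2) by field; apply Rplus_lt_compat; [exact H1|exact B].
Qed.

End Main.

Theorem theorem4p1 (X : CompleteNormedModule R_AbsRing) (T : R -> X -> X) (M : R)
  (HT : bounded_C0_semigroup T M) :
  (* (i) *)
  (forall (n : nat) (alpha : R), -1 < alpha -> forall x : X,
     exists y : X,
       Apow T n (Res T (INR n + alpha + 1) 1 x) y /\
       is_Int0inf (fun t => scal (ell n alpha t) (T t x)) y) /\
  (* (ii) *)
  (forall (n : nat) (alpha : R), 0 < alpha -> forall x : X,
     exists v : X,
       is_Int0inf (fun t => scal (ell n alpha t) (Res T 1 t x)) v /\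
       is_Int0inf (fun t => scal (phi n alpha t) (T t x)) v) /\
  (* (iii) *)
  (forall (x : X) (alpha t : R), inDA T x -> -1 < alpha -> 0 < t ->
     exists c : nat -> X,
       (forall n, Apow T n (Res T (INR n + alpha + 1) 1 x) (c n)) /\
       is_series (fun n => scal (Laguerre n alpha t) (c n)) (T t x)) /\
  (* (iv) *)
  (forall (x : X) (alpha t : R), inDA T x -> -1 < alpha -> 0 < t ->
     is_series
       (fun n => scal (Laguerre n alpha t) (Res T (alpha + 1) 1 (Nat.iter n (Vhalf T) x)))
       (T t x)) /\
  (* (v) *)
  (forall (x : X) (alpha lam : R), 1 < alpha -> 0 < lam ->
     exists c : nat -> X,
       (forall n, is_Int0inf (fun t => scal (phi n alpha t) (T t x)) (c n)) /\
       is_series (fun n => scal (Laguerre n alpha lam) (c n)) (Res T 1 lam x)).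
Proof.
  assert (HA : forall (x : X) n alpha, -1 < alpha ->
    Apow T n (Res T (INR n + alpha + 1) 1 x) (lcoeff (X0 := X) T (alpha + 1) n x)).
  { intros x n alpha Ha; rewrite Rplus_assoc; apply (Apow_Res T M HT); lra. }
  split; [|split; [|split; [|split]]].
  - intros n alpha Ha x; exists (lcoeff (X0 := X) T (alpha + 1) n x); split; [now apply HA|].
    now apply (is_Int0inf_ell_T T M HT).
  - intros n alpha Ha x; exists (phi_coeff (X0 := X) T x alpha n); now apply (ell_Res T M HT).
  - intros x alpha t Hx Ha Ht; exists (fun n => lcoeff (X0 := X) T (alpha + 1) n x); split.
    + intros n; now apply HA.
    + now apply (lcoeff_series T M HT).
  - intros x alpha t Hx Ha Ht.
    (* With the fractional power applied to each term, the series of (iv) coincides term by term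
       with that of (iii). *)
    apply (is_series_ext (fun n => scal (Laguerre n alpha t) (lcoeff (X0 := X) T (alpha + 1) n x))).
    + intros n; f_equal; symmetry; apply (Res_iter_Vhalf T M HT); lra.
    + now apply (lcoeff_series T M HT).
  - intros x alpha lam Ha Hl; exists (phi_coeff (X0 := X) T x alpha); split.
    + intros n; apply (ell_Res T M HT); lra.
    + now apply (resolvent_series T M HT).
Qed.
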